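(* Let $k$ be an algebraically closed field and let $A$ be a basic finite-dimensional $k$-algebra with a complete set of primitive orthogonal idempotents $\{e_1,\dots,e_n\}$. Then $A$ is biserial if and only if $A$ is $\mathbb{D}_4$-free.
   Context: Modules are finitely generated; ''module'' means left module unless stated otherwise. $\operatorname{rad}(A)$ is the Jacobson radical, $\operatorname{rad}^2(A)=\operatorname{rad}(A)\operatorname{rad}(A)$, and $l(\cdot)$ denotes composition length. A module is local if it has a unique maximal submodule, and colocal if it has a simple socle. Biserial: $A$ is called biserial if for every indecomposable projective left or right $A$-module $P$ there exist uniserial submodules $U,V$ of $P$ with $\operatorname{rad}(P)=U+V$ (the sum not necessarily direct) such that $U\cap V$ is zero or simple. $\mathbb{D}_4$-free: the basic algebra $A$ with complete set of primitive orthogonal idempotents $\{e_1,\dots,e_n\}$ is called $\mathbb{D}_4$-free if none of the following exists: (1) a local module $M$ of Loewy length two with $l(\operatorname{rad} M)=3$; (2) a colocal module $M$ of Loewy length two with $l(M/\operatorname{soc} M)=3$; (3) a local module $M$, together with indices $i,j\in\{1,\dots,n\}$ and elements $\tilde a_1\in e_i\operatorname{rad}(A)e_j$, $\tilde a_2,\tilde a_3\in\operatorname{rad}(A)$, $b_0\in M$, such that (a) $\tilde a_2\tilde a_1b_0$ and $\tilde a_3\tilde a_1b_0$ are linearly independent over $k$; (b) $\operatorname{rad}^2(A)\tilde a_1b_0=0$; (c) there do not exist $\hat a_1,\hat a_1'\in e_i\operatorname{rad}(A)e_j$ and $\hat a_2,\hat a_3\in\operatorname{rad}(A)$ such that ($\alpha$)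 the classes $\overline{\hat a_2},\overline{\hat a_3}$ are linearly independent elements of $\langle\tilde a_2,\tilde a_3\rangle_k/(\operatorname{rad}^2(A)\cap\langle\tilde a_2,\tilde a_3\rangle_k)$, ($\beta$) $\hat a_1b_0+\hat a_1'b_0=\tilde a_1b_0$, ($\gamma$) $\hat a_2\hat a_1'b_0=0$ and $\hat a_3\hat a_1b_0=0$; (4) a local right module $M$, together with indices $i,j\in\{1,\dots,n\}$ and elements $\tilde a_1\in e_j\operatorname{rad}(A)e_i$, $\tilde a_2,\tilde a_3\in\operatorname{rad}(A)$, $b_0\in M$, such that (a) $b_0\tilde a_1\tilde a_2$ and $b_0\tilde a_1\tilde a_3$ are linearly independent over $k$; (b) $b_0\tilde a_1\operatorname{rad}^2(A)=0$; (c) there do not exist $\hat a_1,\hat a_1'\in e_j\operatorname{rad}(A)e_i$ and $\hat a_2,\hat a_3\in\operatorname{rad}(A)$ such that ($\alpha$) the classes $\overline{\hat a_2},\overline{\hat a_3}$ are linearly independent elements of $\langle\tilde a_2,\tilde a_3\rangle_k/(\operatorname{rad}^2(A)\cap\langle\tilde a_2,\tilde a_3\rangle_k)$, ($\beta$) $b_0\hat a_1+b_0\hat a_1'=b_0\tilde a_1$, ($\gamma$) $b_0\hat a_1'\hat a_2=0$ and $b_0\hat a_1\hat a_3=0$. Here $\langle\tilde a_2,\tilde a_3\rangle_k$ is the $k$-linear span, a bar denotes the class modulo $\operatorname{rad}^2(A)$, and $\langle\tilde a_2,\tilde a_3\rangle_k/(\operatorname{rad}^2(A)\cap\langle\tilde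 a_2,\tilde a_3\rangle_k)$ is regarded as a subspace of $\operatorname{rad}(A)/\operatorname{rad}^2(A)$; so ($\alpha$) says that $\hat a_2,\hat a_3\in\langle\tilde a_2,\tilde a_3\rangle_k+\operatorname{rad}^2(A)$ and that they are linearly independent modulo $\operatorname{rad}^2(A)$. *)

(* Defs.v *)
From HB Require Import structures.
From mathcomp Require Import all_boot all_order all_algebra all_field.
From mathcomp Require Import boolp classical_sets functions.

Set Implicit Arguments.
Unset Strict Implicit.
Unset Printing Implicit Defensive.

Import GRing.Theory.

Local Open Scope classical_set_scope.
Local Open Scope ring_scope.

(* Left R-modules are lmodType R and right R-modules are lmodType R^c, where
   R^c is the opposite ring.  The lattice-theoretic notions below are stated
   for a submodule U of an ambient module M, so that they apply to rad M,
   soc M, ... as well as to M itself, which is [set: M]. *)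
Section Modules.
Variable R : nzRingType.
Implicit Type M : lmodType R.

Definition submodule M (U : set M) : Prop := submod_closed (mem U).

Definition fin_gen M : Prop :=
  exists (m : nat) (g : 'I_m -> M),
    forall x : M, exists c : 'I_m -> R, x = \sum_(i < m) c i *: g i.

Definition maximal_in M (N U : set M) : Prop :=
  [/\ submodule N, submodule U, N `<=` U, N <> U &
      forall L : set M, submodule L -> N `<=` L -> L `<=` U -> L = N \/ L = U].

Definition simple_sub M (S : set M) : Prop :=
  [/\ submodule S, S <> [set 0] &
      forall L : set M, submodule L -> L `<=` S -> L = [set 0] \/ L = S].

Definition uniserial M (U : set M) : Prop :=
  submodule U /\
  forall L N : set M, submodule L -> submodule N -> L `<=` U -> N `<=` U ->
    L `<=` N \/ N `<=` L.

Definition sum_sub M (U V : set M) : set M := [set u + v | u in U & v in V].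

Definition radm M (U : set M) : set M :=
  [set x | U x /\ forall N : set M, maximal_in N U -> N x].

Definition socle M : set M :=
  [set x | exists (m : nat) (s : 'I_m -> M),
     (forall i, exists S : set M, simple_sub S /\ S (s i)) /\
     x = \sum_(i < m) s i].

(* The composition length of the quotient U / L is m; its submodules are the
   submodules between L and U. *)
Definition quo_length M (U L : set M) (m : nat) : Prop :=
  [/\ submodule L, submodule U &
      exists N : nat -> set M,
        [/\ N 0%N = L, N m = U &
            forall i : nat, (i < m)%N -> maximal_in (N i) (N i.+1)]].

Definition comp_length M (U : set M) (m : nat) : Prop :=
  quo_length U [set 0] m.

Definition loewy_length M (m : nat) : Prop :=
  iter m (@radm M) [set: M] = [set 0] /\
  forall j : nat, (j < m)%N -> iter j (@radm M) [set: M] <> [set 0].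

Definition local_module M : Prop :=
  exists! N : set M, maximal_in N [set: M].

Definition colocal_module M : Prop := simple_sub (@socle M).

Definition projective M : Prop :=
  forall (X Y : lmodType R) (p : {linear X -> Y}) (f : {linear M -> Y}),
    (forall y : Y, exists x : X, p x = y) ->
    exists g : {linear M -> X}, forall x : M, p (g x) = f x.

Definition indecomposable M : Prop :=
  [set: M] <> [set 0] /\
  forall U V : set M, submodule U -> submodule V ->
    sum_sub U V = [set: M] -> U `&` V = [set 0] ->
    U = [set 0] \/ V = [set 0].

Definition submodule_iso M (U V : set M) : Prop :=
  exists f : M -> M, set_bij U V f /\
    forall (a : R) (x y : M), U x -> U y -> f (a *: x + y) = a *: f x + f y.

Definition biserial_projectives : Prop :=
  forall P : lmodType R, fin_gen P -> projective P -> indecomposable P ->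
    exists U V : set P,
      [/\ uniserial U, uniserial V, radm [set: P] = sum_sub U V &
          U `&` V = [set 0] \/ simple_sub (U `&` V)].

End Modules.

Section Algebra.
Variables (k : closedFieldType) (A : falgType k).

Definition biserial : Prop :=
  biserial_projectives A /\ biserial_projectives A^c.

Definition radA : set A := @radm A A^o [set: A^o].

Definition rad2A : set A :=
  [set x | exists (m : nat) (a b : 'I_m -> A),
     (forall i, radA (a i) /\ radA (b i)) /\ x = \sum_(i < m) a i * b i].

Definition primitive_idempotent (f : A) : Prop :=
  [/\ f <> 0, f * f = f &
      forall g h : A, g * g = g -> h * h = h -> g * h = 0 -> h * g = 0 ->
        f = g + h -> g = 0 \/ h = 0].

Definition complete_primitive_orthogonal (n : nat) (e : 'I_n -> A) : Prop :=
  [/\ forall i, primitive_idempotent (e i),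
      forall i j, i <> j -> e i * e j = 0 &
      \sum_(i < n) e i = 1].

Definition left_ideal (f : A) : set A^o := [set a * f | a in [set: A]].

Definition basic (n : nat) (e : 'I_n -> A) : Prop :=
  forall i j, i <> j -> ~ submodule_iso (left_ideal (e i)) (left_ideal (e j)).

Definition corner_rad (f g : A) : set A := [set f * r * g | r in radA].

(* The scalar c : k acts on an A-module through c%:A : A. *)
Definition lin_indep2 (M : lmodType A) (x y : M) : Prop :=
  forall c d : k, c%:A *: x + d%:A *: y = 0 -> c = 0 /\ d = 0.

Definition ract (M : lmodType A^c) (b : M) (a : A) : M := (a : A^c) *: b.

Definition lin_indep2r (M : lmodType A^c) (x y : M) : Prop :=
  forall c d : k, ract x c%:A + ract y d%:A = 0 -> c = 0 /\ d = 0.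

(* a2' and a3' lie in <a2, a3>_k + rad^2(A) and are linearly independent
   modulo rad^2(A). *)
Definition indep_classes (a2 a3 a2' a3' : A) : Prop :=
  [/\ exists2 u, u \in <<[:: a2; a3]>>%VS & rad2A (a2' - u),
      exists2 u, u \in <<[:: a2; a3]>>%VS & rad2A (a3' - u) &
      forall c d : k, rad2A (c *: a2' + d *: a3') -> c = 0 /\ d = 0].

Definition D4_local_rad3 : Prop :=
  exists M : lmodType A,
    [/\ fin_gen M, local_module M, loewy_length M 2 &
        comp_length (radm [set: M]) 3].

Definition D4_colocal_top3 : Prop :=
  exists M : lmodType A,
    [/\ fin_gen M, colocal_module M, loewy_length M 2 &
        quo_length [set: M] (@socle _ M) 3].

Definition D4_left (n : nat) (e : 'I_n -> A) : Prop :=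
  exists M : lmodType A, fin_gen M /\ local_module M /\
  exists (i j : 'I_n) (a1 a2 a3 : A) (b0 : M),
    [/\ corner_rad (e i) (e j) a1, radA a2 & radA a3] /\
    [/\ lin_indep2 ((a2 * a1) *: b0) ((a3 * a1) *: b0),
        forall r, rad2A r -> (r * a1) *: b0 = 0 &
        ~ exists a1h a1h' a2h a3h : A,
            [/\ corner_rad (e i) (e j) a1h, corner_rad (e i) (e j) a1h',
                radA a2h & radA a3h] /\
            [/\ indep_classes a2 a3 a2h a3h,
                a1h *: b0 + a1h' *: b0 = a1 *: b0,
                (a2h * a1h') *: b0 = 0 &
                (a3h * a1h) *: b0 = 0]].

Definition D4_right (n : nat) (e : 'I_n -> A) : Prop :=
  exists M : lmodType A^c, fin_gen M /\ local_module M /\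
  exists (i j : 'I_n) (a1 a2 a3 : A) (b0 : M),
    [/\ corner_rad (e j) (e i) a1, radA a2 & radA a3] /\
    [/\ lin_indep2r (ract b0 (a1 * a2)) (ract b0 (a1 * a3)),
        forall r, rad2A r -> ract b0 (a1 * r) = 0 &
        ~ exists a1h a1h' a2h a3h : A,
            [/\ corner_rad (e j) (e i) a1h, corner_rad (e j) (e i) a1h',
                radA a2h & radA a3h] /\
            [/\ indep_classes a2 a3 a2h a3h,
                ract b0 a1h + ract b0 a1h' = ract b0 a1,
                ract b0 (a1h' * a2h) = 0 &
                ract b0 (a1h * a3h) = 0]].

Definition D4_free (n : nat) (e : 'I_n -> A) : Prop :=
  [/\ ~ D4_local_rad3, ~ D4_colocal_top3, ~ D4_left e & ~ D4_right e].

End Algebra.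

(* Main.v *)
(* Both directions compare left and right uniserial ideals.  Let J = rad A.

   D4-free => biserial.  The condition on local modules, applied to quotients of
   A e_j, shows that the first layer at which a cyclic left ideal A b can branch
   is J b, and that an a in e_i J e_j with J a / J^2 a two-dimensional is, modulo
   J^2, a sum of two elements with smaller J a.  By descent every arrow space
   e_i J e_j / J^2 is spanned by classes of elements a with A a uniserial, and
   dually on the right.  So rad (A e_j) = A a + A b with A a, A b uniserial; if
   these have minimal dimension, a uniserial right ideal f A acting on the
   intersection A z shows that a longer intersection would allow a smaller
   choice of a.

   Biserial => D4-free.  A given y in e_i J e_j is u + v with u, v in the two
   uniserial ideals U, V of rad (A e_j).  If no pair of arrows kills v and u
   respectively, then some uniserial right ideal f A acts nontrivially on the
   tops of both, which forces v to agree with u times an element of V up to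
   deeper terms; moving this part to u lowers dim A u + dim A v. *)
Require Import Defs.
From HB Require Import structures.
From mathcomp Require Import all_boot all_order all_algebra all_field.
From mathcomp Require Import zify ring.
From mathcomp Require Import boolp classical_sets functions.

Set Implicit Arguments.
Unset Strict Implicit.
Unset Printing Implicit Defensive.

Import GRing.Theory.

Local Open Scope classical_set_scope.
Local Open Scope ring_scope.

(** * Subspaces *)

(** Modules are translated into subspaces of A. This is possible because A / J is a product of
    copies of k: algebraic closedness makes each corner e_i A e_i local with residue field k, and
    basicness puts e_i A e_j into J for distinct i and j. Simple modules are then lines, length is
    dimension, and A b is uniserial exactly when every layer J^p b / J^(p+1) b has dimension at most
    1. The obstacle is that neither side can be treated alone. Left ideals are compared by means of
    an f with f A uniserial: f detects the top of A z, and since f J^p / f J^(p+1) is at most a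
    line, two functionals on J^p detected by f must be proportional. So uniserial elements spanning
    the arrow spaces are needed on both sides before either side can be concluded. Right-hand
    statements are the left-hand ones for A^c. Items (1) and (2) bound the number of generators of
    rad(A e_j) and rad(e_j A) by two, (2) through k-duals of cyclic right modules. In the converse
    the splitting required by item (3) is found inside A, so it serves every M and b_0 at once. *)

Lemma ex_min_nat (T : Type) (P : T -> Prop) (f : T -> nat) (t0 : T) : P t0 ->
  exists2 t, P t & forall t', P t' -> (f t <= f t')%N.
Proof.
move=> Pt0; pose Q m := `[< exists2 t, P t & f t = m >].
have exQ : exists m, Q m by exists (f t0); apply/asboolP; exists t0.
case: (ex_minnP exQ) => m /asboolP[t Pt <-] mt.
by exists t => // t' Pt'; apply: mt; apply/asboolP; exists t'.
Qed.

Section VectorSpaces.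
Variables (k : fieldType) (V : vectType k).
Implicit Types (U W : {vspace V}) (u v x : V).

Lemma line_addE u W x : x \in (<[u]> + W)%VS -> exists c, x - c *: u \in W.
Proof.
case/memv_addP=> _ /vlineP[c ->] [w wW ->].
by exists c; rewrite addrAC subrr add0r.
Qed.

Lemma mem_line_add u W x c : x - c *: u \in W -> x \in (<[u]> + W)%VS.
Proof.
move=> xW; apply/memv_addP; exists (c *: u); first exact/memvZ/memv_line.
by exists (x - c *: u) => //; rewrite addrC subrK.
Qed.

(** The quotient of [U + W] by [W] has dimension at most 1. With [W] the next radical layer, this is
    the local form of uniseriality. *)
Definition thin U W := exists u, (U <= <[u]> + W)%VS.

Definition indep W x y := forall c d : k, c *: x + d *: y \in W -> c = 0 /\ d = 0.

Definition span2 x y W := (<[x]> + <[y]> + W)%VS.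

Lemma span2P x y W v :
  v \in span2 x y W <-> exists c d, v - (c *: x + d *: y) \in W.
Proof.
split.
  rewrite /span2 -addvA => /line_addE[c /line_addE[d vW]].
  by exists c, d; rewrite opprD addrA.
case=> c [d vW]; rewrite /span2 -addvA.
by apply: (@mem_line_add _ _ _ c); apply: (@mem_line_add _ _ _ d); rewrite -addrA -opprD.
Qed.

Lemma memv_congr W x y : x - y \in W -> (x \in W) = (y \in W).
Proof.
move=> xy; apply/idP/idP => h.
  by rewrite -[y](subKr x) memvB.
by rewrite -[x](subrK y) memvD.
Qed.

Lemma span2_indep U W x y : (U <= span2 x y W)%VS -> ~ thin U W -> indep W x y.
Proof.
move=> sU nt c d cd.
have thin_of z z' (a b : k) : a != 0 -> a *: z + b *: z' \in W ->
    (span2 z z' W <= <[z']> + W)%VS.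
  move=> a0 ab; rewrite /span2 -addvA subv_add subvv andbT -memvE.
  apply: (@mem_line_add _ _ _ (- (a^-1 * b))).
  by rewrite scaleNr opprK -[z in z + _](scalerK a0) -scalerA -scalerDr memvZ.
have [c0|c0] := eqVneq c 0; last first.
  by case: nt; exists y; apply: (subv_trans sU (thin_of _ _ _ _ c0 cd)).
have [d0|d0] := eqVneq d 0; first by [].
case: nt; exists x; apply: (subv_trans sU); rewrite /span2 [(<[x]> + _)%VS]addvC.
by apply: (thin_of _ _ _ c d0); rewrite addrC.
Qed.

(** Cramer's rule modulo [W]: if the transition determinant vanished, its entries would be
    coefficients of relations between [u] and [v], hence zero, and [u] itself would lie in [W]. *)
Lemma span2_change W x y u v : u \in span2 x y W -> v \in span2 x y W ->
  indep W u v -> (span2 x y W <= span2 u v W)%VS.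
Proof.
move=> /span2P[a [b ab]] /span2P[c [d cd]] iuv.
have comb s t : (s *: u + t *: v) - ((s * a + t * c) *: x + (s * b + t * d) *: y) \in W.
  have -> : s *: u + t *: v - ((s * a + t * c) *: x + (s * b + t * d) *: y) =
     s *: (u - (a *: x + b *: y)) + t *: (v - (c *: x + d *: y)).
    rewrite !scalerBr !scalerDr !scalerDl !scalerA !opprD.
    by rewrite [RHS]addrACA; congr (_ + _); rewrite addrACA.
  by rewrite memvD // memvZ.
have det0 : a * d - b * c != 0.
  apply/eqP => det0.
  have h1 : d *: u + (- b) *: v \in W.
    rewrite (memv_congr (comb _ _)).
    have -> : d * a + - b * c = 0 by rewrite mulNr [d * a]mulrC.
    have -> : d * b + - b * d = 0 by rewrite mulNr mulrC subrr.
    by rewrite !scale0r addr0 mem0v.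
  have h2 : (- c) *: u + a *: v \in W.
    rewrite (memv_congr (comb _ _)).
    have -> : - c * a + a * c = 0 by rewrite mulNr mulrC addNr.
    have -> : - c * b + a * d = 0 by rewrite mulNr addrC mulrC [c * b]mulrC mulrC det0.
    by rewrite !scale0r addr0 mem0v.
  have [_ /eqP] := iuv _ _ h1; rewrite oppr_eq0 => /eqP b0.
  have [_ a0] := iuv _ _ h2.
  have [/eqP] : 1 = 0 :> k /\ 0 = 0 :> k; last by rewrite oner_eq0.
  apply: iuv; rewrite (memv_congr (comb _ _)) a0 b0.
  by rewrite !mul0r !mulr0 addr0 !scale0r addr0 mem0v.
have key s t z : z = s *: x + t *: y -> z \in span2 u v W.
  move=> ->; apply/span2P.
  exists ((a * d - b * c)^-1 * (s * d - t * c)), ((a * d - b * c)^-1 * (t * a - s * b)).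
  rewrite -memvN opprB.
  set s' := _^-1 * _; set t' := _^-1 * _.
  have <- : s' * a + t' * c = s.
    rewrite /s' /t' -!mulrA -mulrDr; apply: (canLR (mulKf det0)); ring.
  have <- : s' * b + t' * d = t.
    rewrite /s' /t' -!mulrA -mulrDr; apply: (canLR (mulKf det0)); ring.
  exact: comb.
rewrite {1}/span2 subv_add addvSr andbT subv_add -!memvE.
rewrite (key 1 0) ?scale1r ?scale0r ?addr0 // (key 0 1) //.
by rewrite scale1r scale0r add0r.
Qed.

Lemma max_vspace (P : {vspace V} -> Prop) U0 : P U0 ->
  exists2 U, P U & forall W, P W -> (\dim W <= \dim U)%N.
Proof.
move=> PU0.
pose Q m := `[< exists2 U, P U & \dim U = m >].
have exQ : exists m, Q m by exists (\dim U0); apply/asboolP; exists U0.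
have ubQ m : Q m -> (m <= \dim {: V})%N.
  by move=> /asboolP[U _ <-]; apply: dimvS; apply: subvf.
case: (ex_maxnP exQ ubQ) => m /asboolP[U PU <-] mU.
by exists U => // W PW; apply: mU; apply/asboolP; exists W.
Qed.

(** Bridge from propositional sets to [{vspace V}]: a subspace of largest dimension inside [S]
    absorbs every element of [S]. *)
Lemma vspace_of_set (S : V -> Prop) : S 0 ->
  (forall c x y, S x -> S y -> S (c *: x + y)) ->
  exists U, forall x, x \in U <-> S x.
Proof.
move=> S0 SZ; pose P U := forall x, x \in U -> S x.
have P0 : P 0%VS by move=> x; rewrite memv0 => /eqP ->.
case: (max_vspace P0) => U PU maxU; exists U => x; split=> [/PU //|Sx].
have PUx : P (U + <[x]>)%VS.
  move=> _ /memv_addP[u uU [_ /vlineP[c ->] ->]].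
  by rewrite addrC; apply: SZ => //; apply: PU.
have /eqP-> : U == (U + <[x]>)%VS by rewrite eqEdim addvSl maxU.
by apply: (subvP (addvSr _ _)); apply: memv_line.
Qed.

Lemma dim_lt U W : (U <= W)%VS -> ~~ (W <= U)%VS -> (\dim U < \dim W)%N.
Proof.
move=> sUW; apply: contraR; rewrite -leqNgt => le.
by have /eqP-> : U == W by rewrite eqEdim sUW.
Qed.

Lemma dim_line_add u W : (\dim (<[u]> + W) <= (\dim W).+1)%N.
Proof.
have := dimv_sum_cap <[u]>%VS W; rewrite dim_vline.
have : ((u != 0%R) <= 1)%N by case: eqP.
lia.
Qed.

End VectorSpaces.

(** * Left ideals of a split basic algebra *)

Section Split.
Variables (k : fieldType) (A : falgType k).
Implicit Types (U W L N : {vspace A}) (a b r s u v w x y z : A).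

Definition lideal U := forall a x, x \in U -> a * x \in U.

Definition unis U := lideal U /\
  forall L N, lideal L -> lideal N -> (L <= U)%VS -> (N <= U)%VS ->
    (L <= N)%VS \/ (N <= L)%VS.

Variables (n : nat) (e : 'I_n -> A) (J : {vspace A}).

Definition pw p : {vspace A} := iter p (prodv J) fullv.

(** [J] is a nilpotent two-sided ideal complementing the span of the [e i], hence the radical. The
    conditions are symmetric in left and right, so they pass to [A^c]. *)
Record split_data : Prop := SplitData {
  sd_neq0 : forall i, e i != 0;
  sd_idem : forall i, e i * e i = e i;
  sd_orth : forall i j, i != j -> e i * e j = 0;
  sd_sum : \sum_i e i = 1;
  sd_mull : forall a x, x \in J -> a * x \in J;
  sd_mulr : forall x a, x \in J -> x * a \in J;
  sd_nil : exists m, pw m = 0%VS;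
  sd_res : forall i a, exists c : k, e i * a * e i - c *: e i \in J;
  sd_off : forall i j a, i != j -> e i * a * e j \in J }.

Hypothesis sd : split_data.
Let idem := sd_idem sd.
Let orth := sd_orth sd.
Let esum := sd_sum sd.

(** For such [u] the ideal A u is a quotient of A e_i, so its top A u / J u is spanned by [u]. *)
Definition hom u := exists i, e i * u = u.

Lemma mem_pw0 x : x \in pw 0. Proof. exact: memvf. Qed.

Lemma pwS p : pw p.+1 = (J * pw p)%VS. Proof. by []. Qed.

Lemma prodv_ind (P : A -> Prop) U W :
  P 0 -> (forall c x y, P x -> P y -> P (c *: x + y)) ->
  (forall u w, u \in U -> w \in W -> P (u * w)) ->
  forall x, x \in (U * W)%VS -> P x.
Proof.
move=> P0 PZ PM; have [X PX] := vspace_of_set P0 PZ.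
have sX : (U * W <= X)%VS by apply/prodvP => u w uU wW; apply/PX/PM.
by move=> x /(subvP sX)/PX.
Qed.

Lemma pw_mull p a x : x \in pw p -> a * x \in pw p.
Proof.
case: p => [|p]; first by rewrite !mem_pw0.
rewrite pwS; move: x; apply: prodv_ind => [|c x y ax ay|u w uJ wp].
- by rewrite mulr0 mem0v.
- by rewrite mulrDr -scalerAr memvD // memvZ.
by rewrite mulrA memv_mul // (sd_mull sd).
Qed.

Lemma pw_mulr p x a : x \in pw p -> x * a \in pw p.
Proof.
elim: p x => [|p IH] x; first by rewrite !mem_pw0.
rewrite pwS; move: x; apply: prodv_ind => [|c x y ax ay|u w uJ wp].
- by rewrite mul0r mem0v.
- by rewrite mulrDl -scalerAl memvD // memvZ.
by rewrite -mulrA memv_mul // IH.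
Qed.

Lemma prod_fullv U : lideal U -> (fullv * U)%VS = U.
Proof.
move=> lU; apply/eqP; rewrite eqEsubv; apply/andP; split.
  by apply/prodvP => a x _ xU; apply: lU.
by apply/subvP => x xU; rewrite -[x]mul1r memv_mul ?memvf.
Qed.

Lemma pw_lideal p : lideal (pw p).
Proof. by move=> a x; apply: pw_mull. Qed.

Lemma pwD p q : (pw p * pw q)%VS = pw (p + q).
Proof.
elim: p => [|p IH]; first exact/prod_fullv/pw_lideal.
by rewrite addSn !pwS -prodvA IH.
Qed.

Lemma pw1 : pw 1 = J.
Proof.
rewrite pwS; apply/eqP; rewrite eqEsubv; apply/andP; split.
  by apply/prodvP => x a xJ _; apply: (sd_mulr sd).
by apply/subvP => x xJ; rewrite -[x]mulr1 memv_mul ?memvf.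
Qed.

Lemma pwSr p : (pw p * J)%VS = pw p.+1.
Proof. by rewrite -[X in (_ * X)%VS]pw1 pwD addn1. Qed.

Lemma pw_le p q : (p <= q)%N -> (pw q <= pw p)%VS.
Proof.
move/subnKC => <-; rewrite -pwD; apply/prodvP => x y xp _; exact: pw_mulr.
Qed.

Lemma pw_sub p q x : (p <= q)%N -> x \in pw q -> x \in pw p.
Proof. by move/pw_le/subvP; apply. Qed.

Lemma mem_pwM p q x y : x \in pw p -> y \in pw q -> x * y \in pw (p + q).
Proof. by move=> xp yq; rewrite -pwD memv_mul. Qed.

Lemma prodv_lideal U W : lideal U -> lideal (U * W)%VS.
Proof.
move=> lU a; apply: prodv_ind => [|c x y ax ay|u w uJ wp].
- by rewrite mulr0 mem0v.
- by rewrite mulrDr -scalerAr memvD // memvZ.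
by rewrite mulrA memv_mul // lU.
Qed.

Lemma addv_lideal U W : lideal U -> lideal W -> lideal (U + W)%VS.
Proof.
move=> lU lW a _ /memv_addP[u uU [w wW ->]].
by rewrite mulrDr memv_add ?lU ?lW.
Qed.

Lemma capv_lideal U W : lideal U -> lideal W -> lideal (U :&: W)%VS.
Proof.
move=> lU lW a x; rewrite !memv_cap => /andP[xU xW].
by rewrite lU ?lW.
Qed.

Lemma nakayama U L : lideal L -> (U <= L + J * U)%VS -> (U <= L)%VS.
Proof.
move=> lL sU.
have step m : (U <= L + pw m * U)%VS.
  elim: m => [|m IH].
    apply/subvP => x xU; rewrite -[x]add0r memv_add ?mem0v //.
    by rewrite -[x]mul1r memv_mul ?memvf.
  apply: subv_trans IH _; rewrite subv_add addvSl /=.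
  apply: (subv_trans (prodvSr _ sU)); rewrite prodvDr prodvA pwSr.
  by apply: addvS => //; apply/prodvP => a x _; apply: lL.
have [m m0] := sd_nil sd.
by have := step m; rewrite m0 prod0v addv0.
Qed.

Lemma nakayama0 U : (U <= J * U)%VS -> U = 0%VS.
Proof.
move=> sU; apply/eqP; rewrite -subv0; apply: nakayama; last by rewrite add0v.
by move=> a x; rewrite !memv0 => /eqP->; rewrite mulr0.
Qed.

Lemma hom_sum x : x = \sum_i e i * x.
Proof. by rewrite -mulr_suml esum mul1r. Qed.

Lemma hom_sumr x : x = \sum_i x * e i.
Proof. by rewrite -mulr_sumr esum mulr1. Qed.

Lemma homP i x : hom (e i * x).
Proof. by exists i; rewrite mulrA idem. Qed.

Lemma ex_hom_notin U x : x \notin U -> exists i, e i * x \notin U.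
Proof.
move=> xU; apply/existsP; apply: contraR xU.
rewrite negb_exists => /forallP xU.
by rewrite [x]hom_sum memv_suml // => i _; have := xU i; rewrite negbK.
Qed.

Lemma ex_homr_notin U x : x \notin U -> exists i, x * e i \notin U.
Proof.
move=> xU; apply/existsP; apply: contraR xU.
rewrite negb_exists => /forallP xU.
by rewrite [x]hom_sumr memv_suml // => i _; have := xU i; rewrite negbK.
Qed.

Lemma n_gt0 : (0 < n)%N.
Proof.
case: n e esum => // e0; rewrite big_ord0 => /esym/eqP.
by rewrite oner_eq0.
Qed.

Lemma hom0 : hom 0.
Proof. by exists (Ordinal n_gt0); rewrite mulr0. Qed.

(* [pl p b] is J^p b; in particular [pl 0 b] is the left ideal A b. *)
Definition pl p b := (pw p * <[b]>)%VS.
Arguments pl p%_nat_scope b%_ring_scope.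

Lemma mem_pl p b x : reflect (exists2 r, r \in pw p & x = r * b) (x \in pl p b).
Proof. exact: memv_cosetP. Qed.

Lemma pl_lideal p b : lideal (pl p b).
Proof. exact/prodv_lideal/pw_lideal. Qed.

Lemma pw_pl q p b : (pw q * pl p b)%VS = pl (q + p) b.
Proof. by rewrite prodvA pwD. Qed.

Lemma J_pl p b : (J * pl p b)%VS = pl p.+1 b.
Proof. by rewrite -[X in (X * _)%VS]pw1 pw_pl. Qed.

Lemma memJ_pl p r b x : r \in J -> x \in pl p b -> r * x \in pl p.+1 b.
Proof. by move=> rq xp; rewrite -J_pl memv_mul. Qed.

Lemma pl_le p q b : (p <= q)%N -> (pl q b <= pl p b)%VS.
Proof. by move/pw_le => s; apply: prodvSl. Qed.

Lemma pl_sub p q b x : (p <= q)%N -> x \in pl q b -> x \in pl p b.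
Proof. by move/pl_le => s; move/(subvP (s b)). Qed.

Lemma pl_id b : b \in pl 0 b.
Proof. by apply/mem_pl; exists 1; rewrite ?mem_pw0 ?mul1r. Qed.

Lemma pl_subl U b : lideal U -> b \in U -> (pl 0 b <= U)%VS.
Proof. by move=> lU bU; apply/subvP => _ /mem_pl[r _ ->]; apply: lU. Qed.

Lemma pl_eq q p b x : pl 0 x = pl p b -> pl q x = pl (q + p) b.
Proof. by move=> E; rewrite -pw_pl -E pw_pl addn0. Qed.

Lemma pl_nil b : exists m, pl m b = 0%VS.
Proof. by have [m m0] := sd_nil sd; exists m; rewrite /pl m0 prod0v. Qed.

Lemma split_elt i a : exists2 c, exists2 r, r \in J & a * e i = c *: e i + r & True.
Proof.
have [c cJ] := sd_res sd i a; exists c => //; exists (a * e i - c *: e i).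
  rewrite [a * e i]hom_sum (bigD1 i) //= mulrA addrAC memvD //.
  by apply: memv_suml => l li; rewrite mulrA (sd_off sd).
by rewrite addrC subrK.
Qed.

Lemma hom_mul u a : hom u -> exists c, exists2 r, r \in J & a * u = c *: u + r * u.
Proof.
case=> i iu; have [c [r rJ E] _] := split_elt i a.
by exists c, r => //; rewrite -[in LHS]iu mulrA E mulrDl -scalerAl iu.
Qed.

Lemma pl_hom b : hom b -> (pl 0 b <= <[b]> + pl 1 b)%VS.
Proof.
move=> hb; apply/subvP => _ /mem_pl[a _ ->].
have [c [r rJ ->]] := hom_mul a hb.
apply: memv_add; first exact/memvZ/memv_line.
by apply/mem_pl; exists r; rewrite // pw1.
Qed.

Lemma thin_hom U W : lideal U -> lideal W -> thin U W ->
  exists u, [/\ hom u, u \in U & (U <= <[u]> + W)%VS].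
Proof.
move=> lU lW [u sU].
have [sUW|/subvPn[x xU xW]] := boolP (U <= W)%VS.
  by exists 0; split; [exact: hom0|exact: mem0v|rewrite (subv_trans sUW) ?addvSr].
have [i xi] := ex_hom_notin xW; have xiU := lU (e i) x xU.
exists (e i * x); split=> //; first exact: homP.
have [c cW] := line_addE (subvP sU _ xiU).
have c0 : c != 0 by apply: contraNneq xi => c0; rewrite c0 scale0r subr0 in cW.
apply: (subv_trans sU); rewrite subv_add addvSr andbT -memvE.
apply: (@mem_line_add _ _ _ _ _ c^-1).
by rewrite -opprB memvN -[u in _ - u](scalerK c0) -scalerBr memvZ.
Qed.

(** For homogeneous [y] in [U] the space [<[y]> + J * U] is a left ideal. Comparability of these
    ideals leaves room for at most one line in U / J U. *)
Lemma thin_layer U : unis U -> thin U (J * U)%VS.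
Proof.
case=> lU cU; have lJU : lideal (J * U)%VS by apply/prodv_lideal/(sd_mull sd).
have sJU : (J * U <= U)%VS by apply/prodvP => a x _; apply: lU.
have [sUW|/subvPn[x xU xW]] := boolP (U <= J * U)%VS.
  by exists 0; rewrite (subv_trans sUW) ?addvSr.
have [i xi] := ex_hom_notin xW; have xiU := lU (e i) x xU.
have lineL y : hom y -> y \in U -> lideal (<[y]> + J * U)%VS.
  move=> hy yU a _ /memv_addP[_ /vlineP[c ->] [w wW ->]].
  rewrite mulrDr -scalerAr; have [d [r rJ ->]] := hom_mul a hy.
  rewrite scalerDr scalerA -addrA memv_add ?memvZ ?memv_line //.
  by rewrite memvD ?lJU // memvZ // memv_mul.
exists (e i * x); apply/subvP => y yU; rewrite [y]hom_sum.
apply: memv_suml => l _; set z := e l * y.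
have zU : z \in U by apply: lU.
have sub u : u \in U -> (<[u]> + J * U <= U)%VS.
  by move=> uU; rewrite subv_add -memvE uU.
have [] := cU _ _ (lineL _ (homP l y) zU) (lineL _ (homP i x) xiU)
             (sub _ zU) (sub _ xiU).
  by move/subvP; apply; apply: (subvP (addvSl _ _)); apply: memv_line.
move=> s; have /line_addE[c cW] : e i * x \in (<[z]> + J * U)%VS.
  by apply: (subvP s); rewrite memvE addvSl.
have c0 : c != 0 by apply: contraNneq xi => c0; rewrite c0 scale0r subr0 in cW.
apply: (@mem_line_add _ _ _ _ _ c^-1).
by rewrite -opprB memvN -[z in _ - z](scalerK c0) -scalerBr memvZ.
Qed.

Lemma unis_sub U L : unis U -> lideal L -> (L <= U)%VS -> unis L.
Proof.
move=> [lU cU] lL sLU; split=> // L1 L2 l1 l2 s1 s2.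
by apply: cU => //; apply: subv_trans sLU.
Qed.

Lemma unis_gen U : unis U -> exists u, [/\ hom u, u \in U & U = pl 0 u].
Proof.
move=> uU; have [lU _] := uU.
have lJU : lideal (J * U)%VS by apply/prodv_lideal/(sd_mull sd).
have [u [hu uinU sU]] := thin_hom lU lJU (thin_layer uU).
exists u; split=> //; apply/eqP; rewrite eqEsubv pl_subl // andbT.
apply: nakayama; first exact: pl_lideal.
by apply: (subv_trans sU); apply: addvS => //; rewrite -memvE; apply: pl_id.
Qed.

Lemma unis_thin b p : unis (pl 0 b) -> thin (pl p b) (pl p.+1 b).
Proof.
move=> ub; rewrite -J_pl; apply/thin_layer/(unis_sub ub (@pl_lideal p b))/pl_le.
by [].
Qed.

Lemma layer_gen q b u : thin (pl q b) (pl q.+1 b) -> u \in pl q b ->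
  u \notin pl q.+1 b -> pl 0 u = pl q b.
Proof.
move=> [x sx] uq uq'; apply/eqP; rewrite eqEsubv pl_subl //=; last exact: pl_lideal.
apply: nakayama; first exact: pl_lideal.
rewrite J_pl; apply: (subv_trans sx); rewrite subv_add addvSr andbT -memvE.
have su : (<[u]> <= pl 0 u)%VS by rewrite -memvE; apply: pl_id.
apply: (subvP (addvS su (subvv _))).
have [c cu] := line_addE (subvP sx _ uq).
have c0 : c != 0 by apply: contraNneq uq' => c0; rewrite c0 scale0r subr0 in cu.
apply: (@mem_line_add _ _ _ _ _ c^-1).
by rewrite -opprB memvN -[x in _ - x](scalerK c0) -scalerBr memvZ.
Qed.

Lemma ex_layer m b U : (U <= pl 0 b)%VS -> ~~ (U <= pl m b)%VS ->
  exists q, [/\ (q < m)%N, (U <= pl q b)%VS & ~~ (U <= pl q.+1 b)%VS].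
Proof.
elim: m => [sU|m IH sU nU]; first by rewrite sU.
have [sm|nm] := boolP (U <= pl m b)%VS; first by exists m.
by have [q [qm s1 s2]] := IH sU nm; exists q; split=> //; apply: ltnW.
Qed.

Lemma ex_layer1 m b u : u \in pl 0 b -> u \notin pl m b ->
  exists q, [/\ (q < m)%N, u \in pl q b & u \notin pl q.+1 b].
Proof. by rewrite !memvE; apply: ex_layer. Qed.

(** The deepest J^q b containing [L] also lies in [L]: an element of [L] outside J^(q+1) b generates
    it by Nakayama. *)
Lemma thin_ideal b L : (forall p, thin (pl p b) (pl p.+1 b)) ->
  lideal L -> (L <= pl 0 b)%VS -> exists p, L = pl p b.
Proof.
move=> tb lL sL; have [m m0] := pl_nil b.
have [sm|nm] := boolP (L <= pl m b)%VS.
  by exists m; apply/eqP; rewrite eqEsubv sm m0 sub0v.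
have [q [_ sq nq]] := ex_layer sL nm; exists q.
have [x xL xq] := subvPn nq.
apply/eqP; rewrite eqEsubv sq /= -(layer_gen (tb q) _ xq) ?(subvP sq) //.
exact: pl_subl.
Qed.

(** Converse of [unis_thin]: uniseriality of A b may be checked layer by layer. *)
Lemma thin_unis b : (forall p, thin (pl p b) (pl p.+1 b)) -> unis (pl 0 b).
Proof.
move=> tb; split=> [|L N lL lN sL sN]; first exact: pl_lideal.
have [p ->] := thin_ideal tb lL sL; have [q ->] := thin_ideal tb lN sN.
by case: (leqP p q) => pq; [right|left]; apply: pl_le => //; apply: ltnW.
Qed.

Lemma unis_ideal b L : unis (pl 0 b) -> lideal L -> (L <= pl 0 b)%VS ->
  exists p, L = pl p b.
Proof. by move=> ub; apply: thin_ideal => p; apply: unis_thin. Qed.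

Lemma pl_eq0 b : b != 0 -> ~~ (pl 0 b <= pl 1 b)%VS.
Proof.
move=> b0; apply/negP; rewrite -J_pl => /nakayama0 E.
by have := pl_id b; rewrite E memv0 (negPf b0).
Qed.

Lemma pl_notin b : b != 0 -> b \notin pl 1 b.
Proof.
move=> b0; apply: contra (pl_eq0 b0) => b1; apply: pl_subl b1.
exact: pl_lideal.
Qed.

Lemma dim_pl p b : unis (pl 0 b) -> (\dim (pl 0 b) <= p + \dim (pl p b))%N.
Proof.
move=> ub; elim: p => [|p IH]; first by [].
apply: (leq_trans IH); have [x sx] := unis_thin p ub.
have := leq_trans (dimvS sx) (dim_line_add _ _); lia.
Qed.

Lemma dim_pl_eq p b : unis (pl 0 b) -> pl p b != 0%VS ->
  \dim (pl 0 b) = (p + \dim (pl p b))%N.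
Proof.
move=> ub; elim: p => [|p IH] p0; first by [].
have sp : (pl p.+1 b <= pl p b)%VS by apply: pl_le.
have p0' : pl p b != 0%VS by apply: contraNneq p0 => p0'; rewrite p0' subv0 in sp.
have [x sx] := unis_thin p ub.
have := leq_trans (dimvS sx) (dim_line_add _ _).
have : (\dim (pl p.+1 b) < \dim (pl p b))%N.
  apply: dim_lt => //; apply: contraNN p0'.
  by rewrite -J_pl => /nakayama0 ->.
by have := IH p0'; lia.
Qed.

Definition corner i j a := [/\ a \in J, e i * a = a & a * e j = a].

Lemma cornerI i j a : a \in J -> corner i j (e i * a * e j).
Proof.
move=> aJ; split; first by rewrite (sd_mulr sd) // (sd_mull sd).
  by rewrite !mulrA idem.
by rewrite -mulrA idem.
Qed.

(** What item (3c) forbids: [Y] plays the annihilator of b_0, and [a], [a'], [b], [b'] are the four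
    hatted elements in order. *)
Definition splits (Y : {vspace A}) i j a1 a2 a3 := exists a a' b b',
  [/\ corner i j a, corner i j a', b \in J & b' \in J] /\
  [/\ b \in span2 a2 a3 (pw 2), b' \in span2 a2 a3 (pw 2), indep (pw 2) b b' &
      [/\ a + a' - a1 \in Y, b * a' \in Y & b' * a \in Y]].

(* D4-freeness, item (3), for the local module A / Y. *)
Definition D4_split := forall i j (Y : {vspace A}) a1 a2 a3, lideal Y ->
  (forall x, x - x * e j \in Y) -> corner i j a1 -> a2 \in J -> a3 \in J ->
  indep Y (a2 * a1) (a3 * a1) -> (forall r, r \in pw 2 -> r * a1 \in Y) ->
  splits Y i j a1 a2 a3.

(** J e_j / J^2 e_j has dimension at most 2; this is the content of item (1). *)
Definition top2 j := exists x1 x2, [/\ x1 \in J, x2 \in J &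
  forall x, x \in J -> x * e j \in span2 x1 x2 (pw 2)].

Lemma mem_pl_pw p r b : r \in pw p -> r * b \in pl p b.
Proof. by move=> rp; apply/mem_pl; exists r. Qed.

Lemma mem_pl1 r b : r \in J -> r * b \in pl 1 b.
Proof. by rewrite -pw1; apply: mem_pl_pw. Qed.

Lemma e_notin i : e i \notin J.
Proof.
apply/negP => eJ; have /negP := pl_notin (sd_neq0 sd i); apply.
by rewrite -{1}[e i]idem mem_pl1.
Qed.

Lemma pl1P b x : reflect (exists2 r, r \in J & x = r * b) (x \in pl 1 b).
Proof.
by apply: (iffP (mem_pl 1 b x)) => -[r rJ ->]; exists r; rewrite // ?pw1 // -pw1.
Qed.

Lemma line_gen U x : lideal U -> x \in U -> (U <= <[x]> + J * U)%VS -> U = pl 0 x.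
Proof.
move=> lU xU sU; apply/eqP; rewrite eqEsubv pl_subl // andbT.
apply: nakayama; first exact: pl_lideal.
by apply: (subv_trans sU); apply: addvS => //; rewrite -memvE; apply: pl_id.
Qed.

Lemma span2_mul x y u v : x \in span2 u v (pw 2) ->
  x * y \in span2 (u * y) (v * y) (pl 2 y).
Proof.
case/span2P=> c [d cd]; apply/span2P; exists c, d.
by rewrite !scalerAl -mulrDl -mulrBl mem_pl_pw.
Qed.

Lemma indep_change y u v W b b' : indep W (u * y) (v * y) ->
  (forall r, r \in pw 2 -> r * y \in W) ->
  b \in span2 u v (pw 2) -> b' \in span2 u v (pw 2) -> indep (pw 2) b b' ->
  indep W (b * y) (b' * y).
Proof.
move=> iu rW sb sb' ib c d cd; apply: ib.
have sbb : c *: b + d *: b' \in span2 u v (pw 2) by rewrite memvD // memvZ.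
have [s [t st]] := (span2P _ _ _ _).1 sbb.
suff [s0 t0] : s = 0 /\ t = 0 by rewrite s0 t0 !scale0r addr0 subr0 in st.
apply: iu; rewrite !scalerAl -mulrDl.
rewrite -memvN -[_ * y](subrK ((c *: b + d *: b') * y)) -mulrBl opprD memvB //.
  by rewrite memvN -opprB mulNr memvN rW.
by rewrite mulrDl -!scalerAl.
Qed.

Lemma top2_span i y a2 a3 : e i * y = y -> a2 \in J -> a3 \in J ->
  (forall x, x \in J -> x * e i \in span2 a2 a3 (pw 2)) ->
  (pl 1 y <= span2 (a2 * y) (a3 * y) (pl 2 y))%VS.
Proof.
move=> iy a2J a3J top; apply/subvP => _ /pl1P[r rJ ->].
by rewrite -iy mulrA; have := span2_mul y (top _ rJ); rewrite -mulrA iy.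
Qed.

Lemma indep_neq W u v : indep W u v -> u \notin W /\ v \notin W.
Proof.
move=> iuv; split; apply/negP => h.
  by have [|/eqP] := iuv 1 0; rewrite ?scale1r ?scale0r ?addr0 // oner_eq0.
by have [|_ /eqP] := iuv 0 1; rewrite ?scale1r ?scale0r ?add0r // oner_eq0.
Qed.

Lemma thin0 p q : thin (pl p 0) (pl q 0).
Proof.
exists 0; apply/subvP => _ /mem_pl[r _ ->]; rewrite mulr0; exact: mem0v.
Qed.

(** * Branching of cyclic left ideals *)

Section Branching.
Hypothesis top : forall i, top2 i.
Hypothesis D4 : D4_split.

(* If J^p b is the first layer at which A b branches, then x generating
   J^(p-1) b contradicts [D4]: a splitting of x inside J b cannot move x up. *)
Lemma thin1_unis b : hom b -> thin (pl 1 b) (pl 2 b) -> unis (pl 0 b).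
Proof.
move=> hb t1; apply: thin_unis; elim/ltn_ind=> -[_|[_|p IH]] //.
  by exists b; apply: pl_hom.
have [//|nt] := pselect (thin (pl p.+2 b) (pl p.+3 b)); exfalso.
have [x [hx xp sx]] := thin_hom (@pl_lideal p.+1 b) (@pl_lideal p.+2 b) (IH _ (leqnn _)).
have Ex : pl 0 x = pl p.+1 b by apply/esym/line_gen; rewrite ?J_pl //; apply: pl_lideal.
have Ex1 : pl 1 x = pl p.+2 b := pl_eq 1 Ex.
have Ex2 : pl 2 x = pl p.+3 b := pl_eq 2 Ex.
have ntx : ~ thin (pl 1 x) (pl 2 x) by rewrite Ex1 Ex2.
case: hb => j jb; case: hx => i ix.
have [x1 [x2 [x1J x2J topx]]] := top i.
have ind := span2_indep (top2_span ix x1J x2J topx) ntx.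
have [r rp xE] : exists2 r, r \in pw p.+1 & x = r * b by apply/mem_pl.
have rJ : r \in J by rewrite -pw1; apply: pw_sub rp.
have [a1 ca1 a1b] : exists2 a1, corner i j a1 & a1 * b = x.
  by exists (e i * r * e j); [apply: cornerI|rewrite -!mulrA jb -xE ix].
(* A / Y is A b / J^2 x, with the class of 1 corresponding to [b]. *)
pose Y := (amulr b @^-1: pl 2 x)%VS.
have memY y : (y \in Y) = (y * b \in pl 2 x) by rewrite -memv_preim lfunE.
have [|||||||a [a' [c [c' [[ca ca' cJ c'J] [sc sc' icc [aa ca'0 c'a0]]]]]]] :=
  D4 (i := i) (j := j) (Y := Y) (a1 := a1) (a2 := x1) (a3 := x2).
- by move=> y z; rewrite !memY -mulrA; apply: pl_lideal.
- by move=> y; rewrite memY mulrBl -mulrA jb subrr mem0v.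
- exact: ca1.
- exact: x1J.
- exact: x2J.
- by move=> s t; rewrite memY mulrDl -!scalerAl -!mulrA a1b; apply: ind.
- by move=> s s2; rewrite memY -mulrA a1b mem_pl_pw.
move: aa ca'0 c'a0; rewrite !memY mulrBl mulrDl a1b -!mulrA.
set u := a * b; set v := a' * b => uv cv c'u.
have ub : u \in pl 0 b by apply: mem_pl_pw; apply: mem_pw0.
have iu : e i * u = u by case: ca => _ ia _; rewrite mulrA ia.
have rW s : s \in pw 2 -> s * x \in pl 2 x by apply: mem_pl_pw.
have icx := indep_change ind rW sc sc' icc.
have [cx c'x] := indep_neq icx.
(* If [u] lies in A x, then [c' * u] in J^2 x forces [u] into J x. So [v] agrees with [x] modulo J
   x, and [c * v] in J^2 x contradicts [cx]. *)
have [up|up] := boolP (u \in pl p.+1 b).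
  have [s us] := line_addE (subvP sx _ up); rewrite -Ex1 in us.
  have s0 : s = 0.
    have := memJ_pl c'J us; rewrite mulrBr -scalerAr => /memv_congr us'.
    have [//|s0] := eqVneq s 0; case/negP: c'x.
    by rewrite -[_ * _](scalerK s0) memvZ // -us'.
  rewrite s0 scale0r subr0 in us.
  have vx : v - x \in pl 1 x.
    have -> : v - x = (u + v - x) - u by rewrite addrAC [u + v]addrC addrK.
    by rewrite memvB // (pl_sub _ uv).
  by case/negP: cx; rewrite -[c * x](subKr (c * v)) memvB // -mulrBr memJ_pl.
(* Otherwise [u] generates J^q b with q at most p. Modulo J^2 u, J u is spanned by [c * u] and
   [c' * u], both in J x, so J u lies in J x. But J u = J^(q+1) b contains [x], whence x = 0. *)
have [q [qp uq uq1]] := ex_layer1 ub up.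
have tq : thin (pl q b) (pl q.+1 b) by apply: IH; apply: ltnW.
have Eu := layer_gen tq uq uq1.
have s1 : (pl 1 u <= pl p.+2 b)%VS.
  apply: nakayama; first exact: pl_lideal.
  rewrite J_pl; apply/subvP => _ /pl1P[s sJ ->].
  have : s * u \in span2 (c * u) (c' * u) (pl 2 u).
    rewrite -iu mulrA; have /(subvP (span2_change sc sc' icc)) := topx _ sJ.
    by move/(span2_mul u); rewrite -mulrA iu.
  rewrite /span2; apply: (subvP (addvS _ (subvv _))).
  rewrite subv_add -!memvE -Ex1 (pl_sub _ c'u) // andbT.
  have -> : c * u = c * x - c * v + c * (u + v - x).
    rewrite -mulrBr -mulrDr; congr (_ * _).
    by rewrite addrC addrA subrK addrK.
  rewrite memvD //; last by rewrite pl_lideal // (pl_sub _ uv).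
  by rewrite memvB ?mem_pl1 // (pl_sub _ cv).
have xx : x \in pl 1 x.
  rewrite Ex1; apply: (subvP s1); rewrite (pl_eq 1 Eu).
  by apply: pl_sub xp.
have x0 : x = 0 by apply: contraTeq xx; apply: pl_notin.
by case: ntx; rewrite x0; apply: thin0.
Qed.

(** Apply [D4] to A e_j / J^2 a. For a summand u, J u is spanned modulo J^2 u by an element of J a
    and one of J^2 a. Nakayama puts J u inside J a, and equality would make J a / J^2 a at most a
    line. *)
Lemma thick_split i j a : corner i j a -> ~ thin (pl 1 a) (pl 2 a) ->
  exists a1 a2, a1 + a2 - a \in pl 2 a /\
    forall b, b = a1 \/ b = a2 ->
      [/\ corner i j b, (pl 1 b <= pl 1 a)%VS & (\dim (pl 1 b) < \dim (pl 1 a))%N].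
Proof.
move=> ca nt; have [aJ ia aj] := ca.
have [x1 [x2 [x1J x2J topx]]] := top i.
have ind := span2_indep (top2_span ia x1J x2J topx) nt.
pose Y := (amulr (e j) @^-1: pl 2 a)%VS.
have memY y : (y \in Y) = (y * e j \in pl 2 a) by rewrite -memv_preim lfunE.
have [|||||||a1 [a2 [c [c' [[ca1 ca2 cJ c'J] [sc sc' icc [aa ca2' c'a1]]]]]]] :=
  D4 (i := i) (j := j) (Y := Y) (a1 := a) (a2 := x1) (a3 := x2).
- by move=> y z; rewrite !memY -mulrA; apply: pl_lideal.
- by move=> y; rewrite memY mulrBl -mulrA idem subrr mem0v.
- exact: ca.
- exact: x1J.
- exact: x2J.
- by move=> s t; rewrite memY mulrDl -!scalerAl -!mulrA aj; apply: ind.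
- by move=> s s2; rewrite memY -mulrA aj mem_pl_pw.
move: aa ca2' c'a1; rewrite !memY mulrBl mulrDl aj -!mulrA.
have [_ ia1 a1j] := ca1; have [_ ia2 a2j] := ca2.
rewrite a1j a2j => aa ca2' c'a1.
have half u v d d' : e i * u = u -> u + v - a \in pl 2 a ->
    d \in J -> d * v \in pl 2 a -> d' * u \in pl 2 a ->
    (span2 x1 x2 (pw 2) <= span2 d d' (pw 2))%VS ->
    (pl 1 u <= pl 1 a)%VS /\ (\dim (pl 1 u) < \dim (pl 1 a))%N.
  move=> iu uv dJ dv d'u sd'.
  have su : (pl 1 u <= span2 (d * u) (d' * u) (pl 2 u))%VS.
    apply/subvP => _ /pl1P[s sJ ->].
    rewrite -iu mulrA; have /(subvP sd') := topx _ sJ.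
    by move/(span2_mul u); rewrite -mulrA iu.
  have du : d * u \in pl 1 a.
    have -> : d * u = d * a - d * v + d * (u + v - a).
      rewrite -mulrBr -mulrDr; congr (_ * _).
      by rewrite addrC addrA subrK addrK.
    rewrite memvD ?memvB ?mem_pl1 ?(pl_sub _ dv) //.
    by rewrite pl_lideal // (pl_sub _ uv).
  have sua : (pl 1 u <= pl 1 a)%VS.
    apply: nakayama; first exact: pl_lideal.
    rewrite J_pl; apply: (subv_trans su); apply: addvS => //.
    by rewrite subv_add -!memvE du (pl_sub _ d'u).
  split=> //; apply: dim_lt => //; apply/negP => sau.
  have E : pl 1 u = pl 1 a by apply/eqP; rewrite eqEsubv sua.
  have E2 : pl 2 u = pl 2 a by rewrite -[LHS]J_pl -[RHS]J_pl E.
  apply: nt; exists (d * u); rewrite -E -E2; apply: (subv_trans su).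
  rewrite /span2 -addvA; apply: addvS => //.
  by rewrite subv_add subvv andbT -memvE E2.
have s12 := span2_change sc sc' icc.
exists a1, a2; split=> // b [->|->].
  by have [] := half a1 a2 c c' ia1 aa cJ ca2' c'a1 s12.
have aa' : a2 + a1 - a \in pl 2 a by rewrite [a2 + _]addrC.
have s21 : (span2 x1 x2 (pw 2) <= span2 c' c (pw 2))%VS.
  by rewrite /span2 [(<[c']> + _)%VS]addvC.
by have [] := half a2 a1 c' c ia2 aa' c'J c'a1 ca2' s21.
Qed.

(* Descent on dim (J a): of the two summands provided by [thick_split], one is
   still outside N. *)
Lemma ex_unis_below i j N a : (pw 2 <= N)%VS -> corner i j a -> a \notin N ->
  exists a', [/\ corner i j a', a' \notin N, unis (pl 0 a') & (pl 1 a' <= pl 1 a)%VS].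
Proof.
move=> sN; have [m] := ubnP (\dim (pl 1 a)).
elim: m a => // m IH a lm ca aN.
have [t|nt] := pselect (thin (pl 1 a) (pl 2 a)).
  exists a; split=> //; apply: thin1_unis => //; exists i.
  by case: ca.
have [a1 [a2 [a12 half]]] := thick_split ca nt.
have {}a12 : a1 + a2 - a \in N.
  apply: (subvP sN); have /mem_pl[r r2 ->] := a12; exact: pw_mulr.
have : (a1 \notin N) || (a2 \notin N).
  rewrite -negb_and; apply: contra aN => /andP[a1N a2N].
  by rewrite -memvN -[- a](addKr (a1 + a2)) memvD // memvN memvD.
have step b : b = a1 \/ b = a2 -> b \notin N -> exists a',
    [/\ corner i j a', a' \notin N, unis (pl 0 a') & (pl 1 a' <= pl 1 a)%VS].
  move=> /half[cb sb db] bN.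
  have [a' [ca' a'N ua' sa']] := IH b (leq_trans db lm) cb bN.
  by exists a'; split=> //; apply: subv_trans sb.
by case/orP; apply: step; [left|right].
Qed.

End Branching.

(* Layerwise form, inside A, of the statement that w A is a uniserial right
   module: w J^p / w J^(p+1) has dimension at most 1. *)
Definition right_thin w := forall p, exists2 x0, x0 \in pw p &
  forall x, x \in pw p -> exists c, exists2 r, r \in pw p.+1 & w * (x - c *: x0 - r) = 0.

(** Letting [N] range over all subspaces above J^2 says that the classes of such [a'] span e_i J e_j
    / J^2, and it allows [a'] to be kept off a prescribed subspace, such as that of the y with y z
    in J^2 z. *)
Definition right_gen := forall i j (N : {vspace A}) a, (pw 2 <= N)%VS -> corner i j a ->
  a \notin N -> exists a', [/\ corner i j a', a' \notin N & right_thin a'].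

(** The bound on [pl 1 a'] makes [a'] inherit upper bounds on the deeper layers of [a], as the
    minimality argument in [biserial_atI] requires. *)
Definition left_gen := forall i j (N : {vspace A}) a, (pw 2 <= N)%VS -> corner i j a ->
  a \notin N -> exists a', [/\ corner i j a', a' \notin N, unis (pl 0 a') &
    (pl 1 a' <= pl 1 a)%VS].

(** Simple modules are lines, so an intersection that is zero or simple is one of dimension at most
    1. *)
Definition biserial_pair U V j :=
  [/\ unis U, unis V, (U + V)%VS = pl 1 (e j) & (\dim (U :&: V) <= 1)%N].

Definition biserial_at j := exists U V, biserial_pair U V j.

(** * Uniserial generators of minimal dimension *)

Lemma unis0 : unis 0%VS.
Proof.
split=> [a x|L N _ _ sL sN]; first by rewrite !memv0 => /eqP->; rewrite mulr0.
by left; apply: (subv_trans sL); apply: sub0v.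
Qed.

Lemma pl_split l z y : e l * z = z -> y \in pl 0 z -> y - e l * y \in pl 1 z.
Proof.
move=> lz /(subvP (pl_hom (ex_intro _ l lz)))/line_addE[c cy].
have -> : y - e l * y = (y - c *: z) - e l * (y - c *: z).
  by rewrite mulrBr -scalerAr lz opprB addrA subrK.
by rewrite memvB // pl_lideal.
Qed.

Lemma dim_thin U : unis U -> (J * U)%VS = 0%VS -> (\dim U <= 1)%N.
Proof.
move=> uU U0; have [u] := thin_layer uU; rewrite U0 addv0 => /dimvS.
by rewrite dim_vline; case: (u != 0%R) => // /leqW.
Qed.

Lemma pl_pw p q b x : b \in pw p -> x \in pl q b -> x \in pw (q + p).
Proof. by move=> bp /mem_pl[r rq ->]; apply: mem_pwM. Qed.

Lemma mem_plE j x : x \in pl 1 (e j) -> x \in J /\ x * e j = x.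
Proof. by move/pl1P=> [r rJ ->]; rewrite (sd_mulr sd) // -mulrA idem. Qed.

Lemma pl_e p j x : x \in pw p -> x * e j = x -> x \in pl p (e j).
Proof. by move=> xp <-; apply: mem_pl_pw. Qed.

(** Multiplication by [f] detects the top of A z: as [f * z] is outside J^2 z, an element of e_l (A
    z) killed by [f] has no component along [z] modulo J z. The term [r] only contributes to J^(p+1)
    g = J z. *)
Lemma functional_kernel m f l z g p x0 x c r : corner m l f -> e l * z = z ->
  f * z \notin pl 2 z -> pl p g = pl 0 z -> x0 \in pw p -> x \in pw p ->
  r \in pw p.+1 -> f * (x - c *: x0 - r) = 0 ->
  e l * ((x - c *: x0) * g) \in pl 1 z.
Proof.
move=> [fJ _ fl] lz fz Eg x0p xp rp; set y := x - _ - r => fy.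
have yp : y \in pw p by rewrite !memvB ?memvZ // (pw_sub _ rp).
have yg : e l * (y * g) \in pl 0 z by rewrite pl_lideal // -Eg mem_pl_pw.
have rg : e l * (r * g) \in pl 1 z.
  by rewrite pl_lideal // (pl_eq 1 (esym Eg)) mem_pl_pw.
have [s sy] := line_addE (subvP (pl_hom (ex_intro _ l lz)) _ yg).
have s0 : s = 0.
  have := memJ_pl fJ sy; rewrite mulrBr [f * (e l * _)]mulrA fl [f * (y * g)]mulrA fy mul0r sub0r.
  rewrite memvN -scalerAr => fz2; have [//|s0] := eqVneq s 0.
  by case/negP: fz; rewrite -[_ * _](scalerK s0) memvZ.
rewrite s0 scale0r subr0 in sy.
by rewrite -[x - _](subrK r) mulrDl mulrDr memvD.
Qed.

(* x |-> x a and x |-> x b induce functionals J^p -> A z / J z.  Both vanish on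
   the x in J^p with f x in f J^(p+1), which has codimension at most 1, so they
   are proportional. *)
Lemma small_combination m f l z a b p : corner m l f -> right_thin f ->
  e l * z = z -> f * z \notin pl 2 z -> pl p a = pl 0 z -> pl p b = pl 0 z ->
  exists t, (pl p (a - t *: b) <= pl 1 z)%VS.
Proof.
move=> cf rf lz fz Ea Eb; have [x0 x0p K] := rf p.
have coef g : pl p g = pl 0 z -> exists s : k, e l * (x0 * g) - s *: z \in pl 1 z.
  move=> Eg; apply: line_addE; apply: (subvP (pl_hom (ex_intro _ l lz))).
  by rewrite pl_lideal // -Eg mem_pl_pw.
have [s sa] := coef a Ea; have [t tb] := coef b Eb.
have small g : (forall x, x \in pw p -> x * g \in pl 0 z) ->
    (forall x, x \in pw p -> exists c, e l * ((x - c *: x0) * g) \in pl 1 z) ->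
    e l * (x0 * g) \in pl 1 z -> (pl p g <= pl 1 z)%VS.
  move=> g0 gc gx0; apply/subvP => _ /mem_pl[x xp ->].
  rewrite -[x * g](subrK (e l * (x * g))) memvD ?(pl_split lz (g0 x xp)) //.
  have [c cx] := gc x xp; rewrite -[x](subrK (c *: x0)) mulrDl mulrDr memvD //.
  by rewrite -scalerAl -scalerAr memvZ.
have z0 : z != 0 by apply: contraNneq fz => ->; rewrite mulr0 mem0v.
have ker g : pl p g = pl 0 z -> forall x, x \in pw p -> forall c r, r \in pw p.+1 ->
    f * (x - c *: x0 - r) = 0 -> e l * ((x - c *: x0) * g) \in pl 1 z.
  by move=> Eg x xp c r rp; apply: functional_kernel cf lz fz Eg x0p xp rp.
(* If the functional of [b] vanished at [x0], it would vanish on all of J^p and put J^p b = A z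
   inside J z. *)
have t0 : t != 0.
  apply/eqP => t0; rewrite t0 scale0r subr0 in tb.
  case/negP: (pl_eq0 z0); rewrite -Eb; apply: small => //.
    by move=> x xp; rewrite -Eb mem_pl_pw.
  by move=> x xp; have [c [r rp fx]] := K x xp; exists c; apply: ker fx.
exists (s / t); apply: small.
- move=> x xp; rewrite mulrBr -scalerAr memvB ?memvZ // -?Ea ?mem_pl_pw //.
  by rewrite Ea -Eb mem_pl_pw.
- move=> x xp; have [c [r rp fx]] := K x xp; exists c.
  rewrite mulrBr -scalerAr mulrBr -scalerAr memvB ?memvZ //.
    exact: ker fx.
  exact: ker fx.
rewrite mulrBr -scalerAr mulrBr -scalerAr.
have -> : e l * (x0 * a) - (s / t) *: (e l * (x0 * b)) =
  (e l * (x0 * a) - s *: z) - (s / t) *: (e l * (x0 * b) - t *: z).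
  by rewrite scalerBr scalerA divfK // opprB addrA subrK.
by rewrite memvB // memvZ.
Qed.

(* A e_j has radical A a + A b with A a and A b uniserial of minimal dimension.
   If their intersection A z had length at least 2, [left_gen] applied to the
   a - t b' of [small_combination] would give a uniserial A a' smaller than A a. *)
Lemma biserial_atI j : left_gen -> right_gen -> top2 j -> biserial_at j.
Proof.
move=> LG RG [x1 [x2 [x1J x2J topx]]].
pose cand N b := exists i, [/\ corner i j b, b \notin N & unis (pl 0 b)].
have ex_cand (N : {vspace A}) : (pw 2 <= N)%VS -> (exists b, cand N b) \/ (pl 1 (e j) <= N)%VS.
  move=> sN; have [s|/subvPn[x /mem_plE[xJ xj] xN]] := boolP (pl 1 (e j) <= N)%VS.
    by right.
  left; have [i xi] := ex_hom_notin xN.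
  have cx : corner i j (e i * x).
    by split; rewrite ?(sd_mull sd) ?mulrA ?idem // -mulrA xj.
  by have [b [cb bN ub _]] := LG _ _ _ _ sN cx xi; exists b, i.
have [[a0 ca0]|s0] := ex_cand (pw 2) (subvv _); last first.
  exists 0%VS, 0%VS; split; rewrite ?addv0 ?capv0 ?dimv0 //; try exact: unis0.
  apply/esym; apply: nakayama0; rewrite J_pl; apply/subvP => x xj.
  by have [xJ xe] := mem_plE xj; apply: pl_e => //; apply: (subvP s0).
have [a [ia [ca a2 ua]] mina] := ex_min_nat (fun b => \dim (pl 0 b)) ca0.
have [aJ _ aj] := ca.
pose N := (<[a]> + pw 2)%VS.
have sub0 b : b \in J -> b * e j = b -> (pl 0 b <= pl 1 (e j))%VS.
  by move=> bJ bj; apply: pl_subl; [apply: pl_lideal|rewrite -bj mem_pl1].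
have [[b0 cb0]|sN] := ex_cand N (addvSr _ _); last first.
  exists (pl 0 a), 0%VS; split; rewrite ?addv0 ?capv0 ?dimv0 //; first exact: unis0.
  apply/esym/line_gen; first exact: pl_lideal.
    by rewrite -aj mem_pl1.
  rewrite J_pl; apply/subvP => x xj; have [xJ xe] := mem_plE xj.
  have [c cx] := line_addE (subvP sN _ xj); apply: (@mem_line_add _ _ _ _ _ c).
  by apply: pl_e => //; rewrite mulrBl -scalerAl xe aj.
have [b [ib [cb bN ub]] minb] := ex_min_nat (fun b => \dim (pl 0 b)) cb0.
have [bJ _ bj] := cb.
have b2 : b \notin pw 2 by apply: contra bN => b2; rewrite /N (subvP (addvSr _ _)).
have iab : indep (pw 2) a b.
  move=> c d cd; have d0 : d = 0.
    have [//|d0] := eqVneq d 0; case/negP: bN; apply: (@mem_line_add _ _ _ _ _ (- (d^-1 * c))).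
    by rewrite scaleNr opprK -[b](scalerK d0) -scalerA -scalerDr memvZ // addrC.
  rewrite d0 scale0r addr0 in cd; split=> //; have [//|c0] := eqVneq c 0.
  by case/negP: a2; rewrite -[a](scalerK c0) memvZ.
have sumE : (pl 0 a + pl 0 b)%VS = pl 1 (e j).
  apply/eqP; rewrite eqEsubv subv_add !sub0 //=.
  apply: nakayama; first by apply: addv_lideal; apply: pl_lideal.
  rewrite J_pl; apply/subvP => x xj; have [xJ xe] := mem_plE xj.
  have sa : a \in span2 x1 x2 (pw 2) by rewrite -aj topx.
  have sb : b \in span2 x1 x2 (pw 2) by rewrite -bj topx.
  have : x \in span2 a b (pw 2).
    by apply: (subvP (span2_change sa sb iab)); rewrite -xe topx.
  case/span2P=> c [d cd].
  have xcd : x - (c *: a + d *: b) \in pl 2 (e j).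
    by apply: pl_e => //; rewrite mulrBl mulrDl -!scalerAl xe aj bj.
  rewrite -[x](subrK (c *: a + d *: b)) addrC memv_add //.
  by rewrite memv_add ?memvZ ?pl_id.
exists (pl 0 a), (pl 0 b); split=> //.
set W := (_ :&: _)%VS; rewrite leqNgt; apply/negP => W1.
have lW : lideal W by apply: capv_lideal; apply: pl_lideal.
have sWa : (W <= pl 0 a)%VS by apply: capvSl.
have sWb : (W <= pl 0 b)%VS by apply: capvSr.
have [p Ep] := unis_ideal ua lW sWa; have [q Eq] := unis_ideal ub lW sWb.
have uW := unis_sub ua lW sWa.
have [z [[l lz] _ Ez]] := unis_gen uW.
have W0 : pl 0 z != 0%VS by apply: contraTneq W1 => z0; rewrite Ez z0 dimv0.
have JW0 : pl 1 z != 0%VS.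
  by apply: contraTneq W1 => z1; rewrite -leqNgt dim_thin // Ez J_pl.
have line_sub u : u \in J -> hom u -> (pl 0 u <= <[u]> + pw 2)%VS.
  move=> uJ hu; apply: (subv_trans (pl_hom hu)); apply: addvS => //.
  by apply/subvP => _ /pl1P[r rJ ->]; rewrite -(addn1 1) mem_pwM ?pw1.
(* For p = 0 the element [a] lies in A b, which puts [b] in <a> + J^2. Positivity matters at the
   end, where [left_gen] controls only J a'. *)
have p0 : (0 < p)%N.
  rewrite lt0n; apply: contra a2 => /eqP p0; rewrite p0 in Ep.
  have hb : hom b by exists ib; case: cb.
  have ab : a \in pl 0 b by apply: (subvP sWb); rewrite Ep pl_id.
  have /line_addE[c cab] := subvP (line_sub b bJ hb) _ ab.
  have [c0|c0] := eqVneq c 0; first by rewrite c0 scale0r subr0 in cab.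
  case/negP: bN; apply: (@mem_line_add _ _ _ _ _ c^-1).
  by rewrite -opprB memvN -[b in _ - b](scalerK c0) -scalerBr memvZ.
have W0p : pl p a != 0%VS by rewrite -Ep Ez.
have W0q : pl q b != 0%VS by rewrite -Eq Ez.
have pq : (p <= q)%N.
  have : (\dim (pl 0 a) <= \dim (pl 0 b))%N by apply: mina; exists ib.
  by rewrite (dim_pl_eq ua W0p) (dim_pl_eq ub W0q) -Ep -Eq leq_add2r.
(* [b'] generates J^(q-p) b, so J^p b' and J^p a are both the intersection. No a - t b' lies in J^2:
   for q = p by independence of [a] and [b], for p < q because [b'] itself lies in J^2. *)
have [b' [Eb' b'j ab']] : exists b', [/\ pl 0 b' = pl (q - p) b, b' * e j = b' /\ b' \in J &
    forall t, a - t *: b' \notin pw 2].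
  have [qp|] := eqVneq (q - p)%N 0%N.
    exists b; rewrite qp; split=> // t; apply/negP => abt.
    have [|/eqP] := iab 1 (- t); rewrite ?oner_eq0 //.
    by rewrite scale1r scaleNr.
  rewrite -lt0n => qp.
  have [b' [_ b'q Eb']] := unis_gen (unis_sub ub (@pl_lideal (q - p) b) (pl_le _ (leq0n _))).
  have b'2 : b' \in pw 2.
    have b1 : b \in pw 1 by rewrite pw1.
    by apply: pw_sub (pl_pw b1 b'q); rewrite addn1.
  exists b'; split=> //.
    by split; [case/mem_pl: b'q => r _ ->; rewrite -mulrA bj|rewrite -pw1 (pw_sub _ b'2)].
  by move=> t; apply: contra a2 => h; rewrite -[a](subrK (t *: b')) memvD // memvZ.
(* An [f] outside [N0] moves [z] to a nonzero class of J z / J^2 z, as [small_combination]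
   requires. *)
pose N0 := (amulr z @^-1: pl 2 z)%VS.
have memN0 y : (y \in N0) = (y * z \in pl 2 z) by rewrite -memv_preim lfunE.
have sN0 : (pw 2 <= N0)%VS by apply/subvP => y y2; rewrite memN0 mem_pl_pw.
have [w wJ wz] : exists2 w, w \in J & w \notin N0.
  have [s|/subvPn[_ /pl1P[w wJ ->] wz]] := boolP (pl 1 z <= pl 2 z)%VS.
    by case/eqP: JW0; apply: nakayama0; rewrite J_pl.
  by exists w => //; rewrite memN0.
have [m wm] := ex_hom_notin wz.
have cw := cornerI m l wJ.
have wlN : e m * w * e l \notin N0 by rewrite memN0 -mulrA lz -memN0.
have [f [cf fN rf]] := RG _ _ _ _ sN0 cw wlN.
rewrite memN0 in fN.
have Ea : pl p a = pl 0 z by rewrite -Ep Ez.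
have Eb : pl p b' = pl 0 z.
  by rewrite -Ez Eq (pl_eq p Eb') subnKC.
have [t st] := small_combination cf rf lz fN Ea Eb.
set d := a - t *: b' in st.
have [i' di'] := ex_hom_notin (ab' t); rewrite -/d in di'.
have [b'e b'J] := b'j.
have cd : corner i' j (e i' * d).
  split; rewrite ?mulrA ?idem //; first by rewrite (sd_mull sd) // memvB ?memvZ.
  by rewrite -mulrA mulrBl -scalerAl aj b'e.
have [a' [ca' a'2 ua' sa']] := LG _ _ _ _ (subvv _) cd di'.
(* J^p a' lies in J^p d and so in J z, strictly inside A z = J^p a. Hence A a' has smaller dimension
   than A a. *)
have : (\dim (pl 0 a) <= \dim (pl 0 a'))%N by apply: mina; exists i'.
rewrite (dim_pl_eq ua W0p) leqNgt => /negP; apply.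
apply: (leq_ltn_trans (dim_pl p ua')); rewrite ltn_add2l.
have sp : (pl p a' <= pl p (e i' * d))%VS.
  by case: (p) p0 => // p' _; rewrite -addn1 -!pw_pl; apply: prodvSr.
have sp' : (pl p (e i' * d) <= pl 1 z)%VS.
  apply: subv_trans st; apply/subvP => _ /mem_pl[x xp ->].
  by rewrite mulrA mem_pl_pw // pw_mulr.
apply: (leq_ltn_trans (dimvS (subv_trans sp sp'))); rewrite Ea.
apply: dim_lt; first exact: pl_le.
by apply: pl_eq0; apply: contraNneq fN => ->; rewrite mulr0 mem0v.
Qed.

(** * Splitting an element along a biserial pair *)

Lemma biserial_pairC U V j : biserial_pair U V j -> biserial_pair V U j.
Proof. by case=> uU uV UV d; split; rewrite // ?[(V + U)%VS]addvC // capvC. Qed.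

(** Each combination kills its element only up to an excess [r * v] or [r' * u]. Subtracting [r] and
    [r'], which lie in J^2, makes the products exactly 0 without changing classes. The result has
    [Y = 0], hence holds in every quotient of [A]. *)
Lemma splits_of_combination U V i j u v a2 a3 (c d s t : k) :
  biserial_pair U V j -> u \in U -> v \in V -> e i * u = u -> e i * v = v ->
  a2 \in J -> a3 \in J -> indep (pl 2 (u + v)) (a2 * (u + v)) (a3 * (u + v)) ->
  c * t - d * s != 0 -> (c *: a2 + d *: a3) * v \in pl 2 v ->
  (s *: a2 + t *: a3) * u \in pl 2 u -> splits 0 i j (u + v) a2 a3.
Proof.
case=> uU uV UV _ uinU vinV iu iv a2J a3J ind det /mem_pl[r r2 rv] /mem_pl[r' r'2 ru].
have cor w : w \in (U + V)%VS -> e i * w = w -> corner i j w.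
  by rewrite UV => /mem_plE[wJ wj] iw.
exists u, v, (c *: a2 + d *: a3 - r), (s *: a2 + t *: a3 - r').
have inJ (x y : k) z : z \in pw 2 -> x *: a2 + y *: a3 - z \in J.
  by move=> z2; rewrite memvB ?memvD ?memvZ // -pw1 (pw_sub _ z2).
split; first split; rewrite ?inJ //.
- by apply: cor => //; apply: (subvP (addvSl _ _)).
- by apply: cor => //; apply: (subvP (addvSr _ _)).
split.
- by apply/span2P; exists c, d; rewrite addrAC subrr add0r memvN.
- by apply/span2P; exists s, t; rewrite addrAC subrr add0r memvN.
- move=> x y xy.
  have : (x * c + y * s) *: a2 + (x * d + y * t) *: a3 \in pw 2.
    have -> : (x * c + y * s) *: a2 + (x * d + y * t) *: a3 =
      x *: (c *: a2 + d *: a3 - r) + y *: (s *: a2 + t *: a3 - r') + (x *: r + y *: r').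
      rewrite addrACA -!scalerDr !subrK !scalerDr !scalerDl !scalerA.
      by rewrite addrACA.
    by rewrite memvD // memvD // memvZ.
  move/(mem_pl_pw (u + v)); rewrite mulrDl -!scalerAl => /ind[e1 e2].
  have h1 : x * (c * t - d * s) = 0.
    have -> : x * (c * t - d * s) = (x * c + y * s) * t - (x * d + y * t) * s by ring.
    by rewrite e1 e2 !mul0r subr0.
  have h2 : y * (c * t - d * s) = 0.
    have -> : y * (c * t - d * s) = (x * d + y * t) * c - (x * c + y * s) * d by ring.
    by rewrite e1 e2 !mul0r subr0.
  split; first by move/eqP: h1; rewrite mulf_eq0 (negPf det) orbF => /eqP.
  by move/eqP: h2; rewrite mulf_eq0 (negPf det) orbF => /eqP.
by split; rewrite ?subrr ?mem0v // mulrBl ?rv ?ru subrr mem0v.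
Qed.

Lemma thin_combination v a2 a3 : thin (pl 1 v) (pl 2 v) -> a2 \in J -> a3 \in J ->
  exists c : k, exists2 d : k, (c != 0) || (d != 0) & (c *: a2 + d *: a3) * v \in pl 2 v.
Proof.
move=> [x sx] a2J a3J.
have [a av] := line_addE (subvP sx _ (mem_pl1 v a2J)).
have [b bv] := line_addE (subvP sx _ (mem_pl1 v a3J)).
have [a0|a0] := eqVneq a 0.
  exists 1, 0; first by rewrite oner_eq0.
  by rewrite scale1r scale0r addr0; rewrite a0 scale0r subr0 in av.
exists b, (- a); first by rewrite oppr_eq0 a0 orbT.
have -> : (b *: a2 + - a *: a3) * v = b *: (a2 * v - a *: x) - a *: (a3 * v - b *: x).
  by rewrite mulrDl -!scalerAl !scalerBr !scalerA opprB mulrC addrA subrK scaleNr.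
by rewrite memvB // memvZ.
Qed.

(** [U :&: V] has dimension at most 1 and is comparable inside [U] with the nonzero J^2 u, so it is
    contained in it. *)
Lemma cap_contra U V u x : unis U -> (\dim (U :&: V) <= 1)%N -> lideal V -> u \in U ->
  pl 2 u != 0%VS -> x \in U -> x \in V -> x \in pl 2 u.
Proof.
move=> [lU cU] d1 lV uU n0 xU xV; apply: contraR n0 => x2.
have s2 : (pl 2 u <= U)%VS by apply: subv_trans (pl_le _ (leq0n 2)) (pl_subl lU uU).
have [s|s] := cU _ _ (@pl_lideal 2 u) (capv_lideal lU lV) s2 (capvSl _ _).
  rewrite -dimv_eq0 -leqn0 -ltnS; apply: leq_trans d1; apply: dim_lt => //.
  by apply: contra x2 => /subvP; apply; rewrite memv_cap xU.
by case/negP: x2; apply: (subvP s); rewrite memv_cap xU.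
Qed.

Lemma pl_mulr p b g : pl p (b * g) = (pl p b * <[g]>)%VS.
Proof. by rewrite /pl -prodvA prodv_line. Qed.

Lemma unis_mulr b g : unis (pl 0 b) -> unis (pl 0 (b * g)).
Proof.
move=> ub; apply: thin_unis => p; have [x sx] := unis_thin p ub.
exists (x * g); rewrite !pl_mulr -prodv_line -prodvDl; exact: prodvSl.
Qed.

(** Right multiplication by 1 + x is injective: y = - y x pushes [y] into every J^m. *)
Lemma dim_mulr U x : x \in J -> \dim (U * <[1 + x]>) = \dim U.
Proof.
move=> xJ; rewrite -limg_amulr limg_dim_eq //.
apply/eqP; rewrite -subv0; apply: subv_trans (capvSr _ _) _.
apply/subvP => y; rewrite memv_ker lfunE /= mulrDr mulr1 => /eqP /(canRL (addrK _)).
rewrite sub0r => yx; have [m <-] := sd_nil sd.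
elim: m => [|m IH]; first exact: mem_pw0.
by rewrite yx memvN -pwSr memv_mul.
Qed.

(* As f A is uniserial, f J^(p+1) has a one-dimensional top, and f u spans it:
   otherwise J^2 u would be a proper submodule of U :&: V.  Hence v agrees up to
   a scalar and modulo J v with u v1, where v1 generates the layer of V that
   lies p + 1 steps above v.  This part of v is absorbed in u by replacing U
   with U (1 + c v1); for p = q there is no v1 and the same argument is a
   contradiction. *)
Lemma absorb U V i j l u v f u0 v0 p q : biserial_pair U V j -> u \in U -> v \in V ->
  e i * u = u -> e i * v = v -> corner l i f -> right_thin f ->
  f * u \notin pl 2 u -> f * v \notin pl 2 v -> pl 2 u != 0%VS -> pl 2 v != 0%VS ->
  U = pl 0 u0 -> V = pl 0 v0 -> pl 0 u = pl p u0 -> pl 0 v = pl q v0 -> (p <= q)%N ->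
  exists U' u' v', [/\ biserial_pair U' V j, u' \in U', v' \in V,
    [/\ e i * u' = u', e i * v' = v' & u' + v' = u + v] &
    (\dim (pl 0 u') + \dim (pl 0 v') < \dim (pl 0 u) + \dim (pl 0 v))%N].
Proof.
move=> bUV uU vV iu iv cf rf fu fv u2 v2 EU EV Eu Ev pq.
have [uniU uniV UV d1] := bUV; have [lU _] := uniU; have [lV _] := uniV.
have [fJ _ fi] := cf.
have UVJ w : w \in (U + V)%VS -> w \in J /\ w * e j = w by rewrite UV => /mem_plE.
have inU w : w \in U -> w \in J /\ w * e j = w.
  by move=> wU; apply: UVJ; apply: (subvP (addvSl _ _)).
have inV w : w \in V -> w \in J /\ w * e j = w.
  by move=> wV; apply: UVJ; apply: (subvP (addvSr _ _)).
have [uJ uj] := inU u uU; have [vJ vj] := inV v vV.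
have u0U : u0 \in U by rewrite EU pl_id.
have v0V : v0 \in V by rewrite EV pl_id.
have [u0J u0j] := inU u0 u0U; have [v0J v0j] := inV v0 v0V.
have u_in : u \in pw p.+1 by rewrite -addn1; apply: (@pl_pw 1 p u0); rewrite ?pw1 // -Eu pl_id.
have v_in : v \in pw q.+1 by rewrite -addn1; apply: (@pl_pw 1 q v0); rewrite ?pw1 // -Ev pl_id.
have Eu1 : pl p.+1 u0 = pl 1 u by rewrite (pl_eq 1 Eu).
have Ev1 : pl q.+1 v0 = pl 1 v by rewrite (pl_eq 1 Ev).
(* J^(m+2) e_j = J^(m+1) (U + V), which splits deep terms along the pair. *)
have deep m r : r \in pw m.+2 ->
    exists s, exists2 t, s \in pl m.+1 u0 & t \in pl m.+1 v0 /\ r * e j = s + t.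
  move=> rm; have : r * e j \in pl m.+2 (e j) by apply: mem_pl_pw.
  rewrite -(addn1 m.+1) -pw_pl -UV prodvDr EU EV !pw_pl !addn0.
  by case/memv_addP=> s su [t tv ->]; exists s, t.
have [x0 x0p K] := rf p.+1.
have [c [r1 r1p fu1]] := K u u_in.
(* With c = 0, f (u - s) = f t for some s in J u and t in [V]. This element lies in both [U] and
   [V], hence in J^2 u, and then so does [f * u]. *)
have c0 : c != 0.
  apply/eqP => c0; rewrite c0 scale0r subr0 in fu1.
  have [s [t su [tv rst]]] := deep p r1 r1p.
  have fst : f * (u - s) = f * t.
    have /= := congr1 (fun z => z * e j) fu1; rewrite mul0r -mulrA mulrBl uj rst opprD addrA.
    by rewrite mulrBr => /eqP; rewrite subr_eq0 => /eqP.
  have fs : f * s \in pl 2 u by apply: memJ_pl; rewrite // -Eu1.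
  case/negP: fu; rewrite -[f * u](subrK (f * s)) -mulrBr memvD //.
  have sU : s \in U by rewrite EU; apply: pl_sub su.
  have tV : t \in V by rewrite EV; apply: pl_sub tv.
  apply: (cap_contra uniU d1 lV uU u2); first by rewrite lU // memvB.
  by rewrite fst lV.
(* Since c is nonzero, [u] can replace [x0] as generator modulo f J^(p+2). *)
have K' x : x \in pw p.+1 -> exists d, exists2 r, r \in pw p.+2 & f * (x - d *: u - r) = 0.
  move=> xp; have [d [r rp fx]] := K x xp.
  exists (d / c), (r - (d / c) *: r1); first by rewrite memvB // memvZ.
  have -> : x - (d / c) *: u - (r - (d / c) *: r1) =
     (x - d *: x0 - r) - (d / c) *: (u - c *: x0 - r1).
    rewrite !scalerBr scalerA divfK // !opprB [_ + (_ - _ *: u)]addrC.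
    by rewrite [RHS]addrACA [X in _ = X + _]addrA subrK [- r + _]addrC.
  by rewrite mulrBr fx -scalerAr fu1 scaler0 subr0.
have [eqpq|neqpq] := eqVneq p q.
  have vp : v \in pw p.+1 by rewrite eqpq.
  have [d [r rp fv1]] := K' v vp; have [s [t su [tv rst]]] := deep p r rp.
  have fst : f * (v - t) = f * (d *: u + s).
    have /= := congr1 (fun z => z * e j) fv1.
    rewrite mul0r -mulrA !mulrBl -scalerAl uj vj rst.
    have -> : v - d *: u - (s + t) = (v - t) - (d *: u + s).
      by rewrite !opprD !addrA addrAC [v - _ - t]addrAC.
    by rewrite mulrBr => /eqP; rewrite subr_eq0 => /eqP.
  have ft : f * t \in pl 2 v by apply: memJ_pl; rewrite // -Ev1 -eqpq.
  case/negP: fv; rewrite -[f * v](subrK (f * t)) -mulrBr memvD //.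
  have sU : s \in U by rewrite EU; apply: pl_sub su.
  have tV : t \in V by rewrite EV; apply: pl_sub tv.
  rewrite capvC in d1.
  apply: (cap_contra uniV d1 lU vV v2); first by rewrite lV // memvB.
  by rewrite fst lU // memvD // memvZ.
have ltpq : (p < q)%N by rewrite ltn_neqAle neqpq.
have uniV0 : unis (pl 0 v0) by rewrite -EV.
have [v1 [_ v1q Ev']] := unis_gen (unis_sub uniV0 (@pl_lideal (q - p.+1) v0) (pl_le _ (leq0n _))).
have E1 : pl p.+1 v1 = pl 0 v by rewrite (pl_eq _ (esym Ev')) subnKC // -Ev.
have E2 : pl p.+2 v1 = pl 1 v.
  by rewrite (pl_eq _ (esym Ev')) -Ev1 addSn subnKC.
have v1V : v1 \in V by rewrite EV; apply: pl_sub v1q.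
have [v1J v1j] := inV v1 v1V.
have [x xp vx] : exists2 x, x \in pw p.+1 & v = x * v1.
  by apply/mem_pl; rewrite E1 pl_id.
have [d [r rp fx]] := K' x xp.
set v' := v - d *: (u * v1).
have uv1 : u * v1 \in pl 0 v by rewrite -E1 mem_pl_pw.
have v'v : v' \in pl 0 v by rewrite memvB ?pl_id // memvZ.
have iv' : e i * v' = v' by rewrite mulrBr iv -scalerAr mulrA iu.
(* [f * v'] equals [f * (r * v1)], which lies in J^2 v, and [f] detects the top of A v. *)
have v'1 : v' \in pl 1 v.
  have [t tv] := line_addE (subvP (pl_hom (ex_intro _ i iv)) _ v'v).
  have fv' : f * v' = f * (r * v1).
    have /= := congr1 (fun z => z * v1) fx; rewrite mul0r -mulrA !mulrBl -scalerAl -vx.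
    by rewrite mulrBr => /eqP; rewrite subr_eq0 => /eqP.
  have fv'2 : f * v' \in pl 2 v by rewrite fv' memJ_pl // -E2 mem_pl_pw.
  have [t0|t0] := eqVneq t 0; first by rewrite t0 scale0r subr0 in tv.
  have := memJ_pl fJ tv; rewrite mulrBr -scalerAr => /memv_congr E; case/negP: fv.
  by rewrite -[_ * _](scalerK t0) memvZ // -E.
pose nu := d *: (e j * v1); have nuJ : nu \in J by rewrite memvZ // (sd_mull sd).
have unu w : w * e j = w -> w * nu = d *: (w * v1).
  by move=> wj; rewrite -scalerAr mulrA wj.
pose U' := pl 0 (u0 * (1 + nu)).
have EU' : U' = (U * <[1 + nu]>)%VS by rewrite /U' pl_mulr -EU.
have v0v : v != 0 by apply: contraNneq fv => ->; rewrite mulr0 mem0v.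
exists U', (u * (1 + nu)), v'.
have sumU' : (U' + V)%VS = pl 1 (e j).
  have u0nu : u0 * nu \in V by rewrite unu // memvZ // lV.
  rewrite -UV; apply/eqP; rewrite eqEsubv !subv_add !addvSr !andbT; apply/andP; split.
    apply: pl_subl; first exact: addv_lideal.
    by rewrite mulrDr mulr1 memv_add.
  rewrite {1}EU; apply: pl_subl; first by apply: addv_lideal => //; apply: pl_lideal.
  rewrite -[u0](addrK (u0 * nu)) -{1}[u0]mulr1 -mulrDr.
  by rewrite memv_add ?memvN ?pl_id.
split.
- split=> //; first by apply: unis_mulr; rewrite -EU.
  (* As U' + V = U + V, preserving the dimension of [U] preserves that of the intersection. *)
  have dU : \dim U' = \dim U by rewrite EU' dim_mulr.
  have E := dimv_sum_cap U' V; rewrite sumU' dU -(dimv_sum_cap U V) UV in E.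
  by rewrite (addnI E).
- by rewrite EU' memv_mul // memv_line.
- exact: subvP (pl_subl lV vV) _ v'v.
- split=> //; first by rewrite mulrA iu.
  by rewrite mulrDr mulr1 unu // -addrA [_ *: _ + _]addrC subrK.
rewrite pl_mulr dim_mulr // ltn_add2l.
apply: leq_ltn_trans (dimvS (pl_subl (@pl_lideal 1 v) v'1)) _.
by apply: dim_lt; [apply: pl_le|apply: pl_eq0].
Qed.

(** Uniseriality of A u and A v provides, for each of [u] and [v], a combination of [a2], [a3]
    killing it up to J^2. Two independent combinations give the splitting; if one combination [w]
    has to serve both, [absorb] lowers the induction measure. *)
Lemma splits_of_biserial_pair i j U V u v a2 a3 : right_gen -> top2 i ->
  biserial_pair U V j -> u \in U -> v \in V -> e i * u = u -> e i * v = v ->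
  a2 \in J -> a3 \in J -> indep (pl 2 (u + v)) (a2 * (u + v)) (a3 * (u + v)) ->
  splits 0 i j (u + v) a2 a3.
Proof.
move=> RG [x1 [x2 [x1J x2J topx]]].
have [m] := ubnP (\dim (pl 0 u) + \dim (pl 0 v)).
elim: m U V u v => // m IH U V u v lm bUV uU vV iu iv a2J a3J ind.
have [uniU uniV UV d1] := bUV; have [lU _] := uniU; have [lV _] := uniV.
have uniu : unis (pl 0 u) by apply: (unis_sub uniU (@pl_lideal 0 u)); apply: pl_subl.
have univ : unis (pl 0 v) by apply: (unis_sub uniV (@pl_lideal 0 v)); apply: pl_subl.
have [c [d cd cdv]] := thin_combination (unis_thin 1 univ) a2J a3J.
have [s [t st stu]] := thin_combination (unis_thin 1 uniu) a2J a3J.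
have SC := splits_of_combination bUV uU vV iu iv a2J a3J ind.
have [det|det] := eqVneq (c * t - d * s) 0; last exact: SC det cdv stu.
have cdu : (c *: a2 + d *: a3) * u \in pl 2 u.
  have Es : s *: (c *: a2 + d *: a3) = c *: (s *: a2 + t *: a3).
    rewrite !scalerDr !scalerA [s * c]mulrC; congr (_ + _ *: _).
    by apply/esym/eqP; rewrite -subr_eq0 [s * d]mulrC det.
  have Et : t *: (c *: a2 + d *: a3) = d *: (s *: a2 + t *: a3).
    rewrite !scalerDr !scalerA [t * d]mulrC; congr (_ *: _ + _).
    by apply/eqP; rewrite -subr_eq0 [t * c]mulrC det.
  case/orP: st => [s0|t0].
    by rewrite -[_ + _](scalerK s0) Es -!scalerAl !memvZ.
  by rewrite -[_ + _](scalerK t0) Et -!scalerAl !memvZ.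
set w := c *: a2 + d *: a3 in cdv cdu.
have wJ : w \in J by rewrite memvD // memvZ.
(* [w1] completes [w] to a pair with nonzero transition determinant. *)
pose w1 := if c == 0 then a2 else a3.
have w1J : w1 \in J by rewrite /w1; case: ifP.
have [s1 [t1 [w1E det1]]] : exists s1 t1 : k, w1 = s1 *: a2 + t1 *: a3 /\ c * t1 - d * s1 != 0.
  rewrite /w1; have [c0|c0] := eqVneq c 0.
    exists 1, 0; rewrite scale1r scale0r addr0; split=> //.
    by rewrite c0 mul0r sub0r mulr1 oppr_eq0; move: cd; rewrite c0 eqxx.
  exists 0, 1; rewrite scale0r scale1r add0r; split=> //.
  by rewrite mulr1 mulr0 subr0.
have [w1v|w1v] := boolP (w1 * v \in pl 2 v).
  apply: (SC s1 t1 c d) => //; last by rewrite -w1E.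
  by rewrite -oppr_eq0 opprB [t1 * c]mulrC [s1 * d]mulrC.
have [w1u|w1u] := boolP (w1 * u \in pl 2 u).
  by apply: (SC c d s1 t1) => //; rewrite -w1E.
set y := u + v in ind.
have iy : e i * y = y by rewrite mulrDr iu iv.
have indw : indep (pl 2 y) (w * y) (w1 * y).
  move=> x z; rewrite w1E !mulrDl -!scalerAl !scalerDr !scalerA addrACA -!scalerDl.
  case/ind => e1 e2.
  have h1 : x * (c * t1 - d * s1) = 0.
    have -> : x * (c * t1 - d * s1) = (x * c + z * s1) * t1 - (x * d + z * t1) * s1 by ring.
    by rewrite e1 e2 !mul0r subr0.
  have h2 : z * (c * t1 - d * s1) = 0.
    have -> : z * (c * t1 - d * s1) = (x * d + z * t1) * c - (x * c + z * s1) * d by ring.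
    by rewrite e1 e2 !mul0r subr0.
  split; first by move/eqP: h1; rewrite mulf_eq0 (negPf det1) orbF => /eqP.
  by move/eqP: h2; rewrite mulf_eq0 (negPf det1) orbF => /eqP.
have indwi : indep (pw 2) (w * e i) (w1 * e i).
  move=> x z /(mem_pl_pw y); rewrite mulrDl -!scalerAl -!mulrA iy; exact: indw.
have topw x : x \in J -> x * e i \in span2 (w * e i) (w1 * e i) (pw 2).
  move=> xJ; apply: (subvP (span2_change (topx _ wJ) (topx _ w1J) indwi)).
  exact: topx.
pose N := (amulr u @^-1: pl 2 u)%VS.
have memN z : (z \in N) = (z * u \in pl 2 u) by rewrite -memv_preim lfunE.
have sN : (pw 2 <= N)%VS by apply/subvP => z z2; rewrite memN mem_pl_pw.
have w1N : w1 \notin N by rewrite memN.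
have [l lw1] := ex_hom_notin w1N.
have cw1 := cornerI l i w1J.
have w1iN : e l * w1 * e i \notin N by rewrite memN -mulrA iu -memN.
have [f [cf fN rf]] := RG _ _ _ _ sN cw1 w1iN.
have [fJ _ fi] := cf; rewrite memN in fN.
have [a [b ab]] := (span2P _ _ _ _).1 (topw f fJ); rewrite fi in ab.
have fE z : e i * z = z -> f * z - (a *: (w * z) + b *: (w1 * z)) \in pl 2 z.
  by move=> iz; have := mem_pl_pw z ab; rewrite mulrBl mulrDl -!scalerAl -!mulrA iz.
(* [w] sends [u] and [v] into J^2 u and J^2 v, so modulo these [f] acts as [b *: w1]. Hence [b] is
   nonzero, and [f * v] is outside J^2 v because [w1 * v] is. *)
have b0 : b != 0.
  apply: contraNneq fN => b0; have := fE u iu.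
  by rewrite b0 scale0r addr0 => /memv_congr ->; rewrite memvZ.
have fv : f * v \notin pl 2 v.
  apply: contra w1v; rewrite (memv_congr (fE v iv)) => h.
  rewrite -[w1 * v](scalerK b0) memvZ //.
  by rewrite -[b *: _](addKr (a *: (w * v))) memvD // memvN memvZ.
have [wy _] := indep_neq indw.
(* If J^2 g = 0, then w g = 0 and w h = r h with r in J^2 and r g = 0; so w y = r y would lie in J^2
   y. *)
have nz g h : g + h = y -> w * g \in pl 2 g -> w * h \in pl 2 h -> pl 2 g != 0%VS.
  move=> gh wg wh; apply: contra wy => /eqP g0.
  move: wg; rewrite g0 memv0 => /eqP wg.
  have /mem_pl[r r2 rh] := wh.
  have rg : r * g = 0 by apply/eqP; rewrite -memv0 -g0 mem_pl_pw.
  by rewrite -gh mulrDr wg rh add0r -[r * h]add0r -rg -mulrDr gh mem_pl_pw.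
have u2 : pl 2 u != 0%VS by apply: nz cdu cdv.
have v2 : pl 2 v != 0%VS by apply: nz cdv cdu; rewrite addrC.
have [u0 [_ _ EU]] := unis_gen uniU; have [v0 [_ _ EV]] := unis_gen uniV.
have uniU0 : unis (pl 0 u0) by rewrite -EU.
have uniV0 : unis (pl 0 v0) by rewrite -EV.
have [p Eu] : exists p, pl 0 u = pl p u0.
  by apply: unis_ideal => //; [apply: pl_lideal|rewrite -EU; apply: pl_subl].
have [q Ev] : exists q, pl 0 v = pl q v0.
  by apply: unis_ideal => //; [apply: pl_lideal|rewrite -EV; apply: pl_subl].
case: (leqP p q) => [pq|/ltnW qp].
  have [U' [u' [v' [bU' u'U v'V [iu' iv' E] dl]]]] :=
    absorb bUV uU vV iu iv cf rf fN fv u2 v2 EU EV Eu Ev pq.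
  rewrite /y -E; apply: (IH U' V) => //; last by rewrite E.
  by apply: leq_trans dl _; rewrite -ltnS.
have [V' [v' [u' [bV' v'V u'U [iv' iu' E] dl]]]] :=
  absorb (biserial_pairC bUV) vV uU iv iu cf rf fv fN v2 u2 EV EU Ev Eu qp.
rewrite /y addrC -E; apply: (IH V' U) => //; last by rewrite E addrC.
by apply: leq_trans dl _; rewrite addnC -ltnS.
Qed.

Lemma top2_of_biserial j : biserial_at j -> top2 j.
Proof.
case=> U [V [uU uV UV _]]; have [u [hu uinU EU]] := unis_gen uU.
have [v [hv vinV EV]] := unis_gen uV.
have uj : u \in pl 1 (e j) by rewrite -UV; apply: (subvP (addvSl _ _)).
have vj : v \in pl 1 (e j) by rewrite -UV; apply: (subvP (addvSr _ _)).
have [uJ _] := mem_plE uj; have [vJ _] := mem_plE vj.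
exists u, v; split=> // x xJ.
have : x * e j \in (U + V)%VS by rewrite UV mem_pl1.
apply: subvP; rewrite EU EV.
have line_sub w : w \in J -> hom w -> (pl 0 w <= <[w]> + pw 2)%VS.
  move=> wJ hw; apply: (subv_trans (pl_hom hw)); apply: addvS => //.
  by apply/subvP => _ /pl1P[r rJ ->]; rewrite -(addn1 1) mem_pwM ?pw1.
rewrite subv_add /span2; apply/andP; split.
  apply: (subv_trans (line_sub u uJ hu)); apply: addvS => //; exact: addvSl.
by apply: (subv_trans (line_sub v vJ hv)); apply: addvS => //; apply: addvSr.
Qed.

(** * Uniserial elements outside a given subspace *)

Definition left_thin w := forall p, exists2 x0, x0 \in pw p &
  forall x, x \in pw p -> exists c, exists2 r, r \in pw p.+1 & (x - c *: x0 - r) * w = 0.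

Lemma unis_left_thin w : unis (pl 0 w) -> left_thin w.
Proof.
move=> uw p.
have [_ [_ /mem_pl[x0 x0p ->] s]] :=
  thin_hom (@pl_lideal p w) (@pl_lideal p.+1 w) (unis_thin p uw).
exists x0 => // x xp.
have [c /mem_pl[r rp E]] := line_addE (subvP s _ (mem_pl_pw w xp)).
by exists c, r => //; rewrite !mulrBl -scalerAl E subrr.
Qed.

Definition uniserial_gen := forall i j (N : {vspace A}) a, (pw 2 <= N)%VS ->
  corner i j a -> a \notin N -> exists a', [/\ corner i j a', a' \notin N & unis (pl 0 a')].

Lemma uniserial_gen_of_biserial : (forall j, biserial_at j) -> uniserial_gen.
Proof.
move=> bis i j N a _ [aJ ia aj] aN; have [U [V [uU uV UV _]]] := bis j.
have : a \in (U + V)%VS by rewrite UV -aj mem_pl1.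
case/memv_addP=> u uinU [v vinV auv].
have good W w : unis W -> (W <= pl 1 (e j))%VS -> w \in W -> e i * w \notin N ->
    exists a', [/\ corner i j a', a' \notin N & unis (pl 0 a')].
  move=> uW sW wW wN; exists (e i * w); have [lW _] := uW; split=> //.
    have [wJ wj] := mem_plE (subvP sW _ wW).
    by split; rewrite ?(sd_mull sd) // ?mulrA ?idem // -mulrA wj.
  by apply: (unis_sub uW (@pl_lideal 0 _)); apply: pl_subl => //; apply: lW.
have [uN|uN] := boolP (e i * u \in N); last first.
  by apply: (good U u); rewrite // -UV addvSl.
apply: (good V v); rewrite // -?UV ?addvSr //.
by apply: contra aN => vN; rewrite -ia auv mulrDr memvD.
Qed.

Lemma uniserial_gen_of_D4 : (forall j, top2 j) -> D4_split -> left_gen.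
Proof. by move=> t d i j N a sN ca aN; apply: (ex_unis_below t d sN ca aN). Qed.

End Split.

(** * The opposite algebra *)

Section Converse.
Variables (k : fieldType) (A : falgType k).

(** [A^c] keeps the vector space of [A] unchanged, so one [{vspace A}] can be read in either
    algebra. *)
HB.instance Definition _ := Vector.copy A^c A.

Fact converse_scaleAl (c : k) (x y : A^c) :
  c *: @GRing.mul A^c x y = @GRing.mul A^c (c *: x) y.
Proof. exact: (@scalerAr k A). Qed.

HB.instance Definition _ :=
  GRing.Lmodule_isLalgebra.Build k A^c converse_scaleAl.

Fact converse_scaleAr (c : k) (x y : A^c) :
  c *: @GRing.mul A^c x y = @GRing.mul A^c x (c *: y).
Proof. exact: (@scalerAl k A). Qed.

HB.instance Definition _ :=
  GRing.Lalgebra_isAlgebra.Build k A^c converse_scaleAr.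

End Converse.

Section ConverseData.
Variables (k : fieldType) (A : falgType k) (n : nat) (e : 'I_n -> A) (J : {vspace A}).
Hypothesis sd : split_data e J.

Let Ac : falgType k := A^c.
Let ec : 'I_n -> Ac := e.
Let Jc : {vspace Ac} := J.

Lemma converse_mul (x y : A) : @GRing.mul Ac x y = y * x.
Proof. by []. Qed.

(** J^p is the same space for both multiplications because J J^p = J^p J. *)
Lemma converse_pw_aux p (x : A) : ((x : Ac) \in pw Jc p) = (x \in pw J p).
Proof.
elim: p x => [|p IH] x; first by rewrite !mem_pw0.
apply/idP/idP.
  rewrite (pwS Jc); move: x; apply: (@prodv_ind k Ac) => [|c x y|u w uJ wp].
  - exact: mem0v.
  - by move=> xp yp; rewrite memvD // memvZ.
  have -> : u * w = @GRing.mul A w u by [].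
  by rewrite -(pwSr sd) memv_mul // -IH.
rewrite -(pwSr sd); move: x; apply: prodv_ind => [|c x y|u w up wJ].
- exact: mem0v.
- by move=> xp yp; rewrite memvD // memvZ.
have -> : u * w = @GRing.mul Ac w u by [].
by rewrite pwS memv_mul // IH.
Qed.

Lemma converse_pw p : pw Jc p = pw J p :> {vspace A}.
Proof. by apply/vspaceP => x; apply: converse_pw_aux. Qed.

Lemma converse_split_data : split_data ec Jc.
Proof.
split.
- exact: sd_neq0 sd.
- exact: sd_idem sd.
- by move=> i j ij; apply: (sd_orth sd); rewrite eq_sym.
- exact: sd_sum sd.
- by move=> a x; apply: (sd_mulr sd).
- by move=> x a; apply: (sd_mull sd).
- by have [m m0] := sd_nil sd; exists m; rewrite converse_pw.
- by move=> i a; have [c ca] := sd_res sd i a; exists c; rewrite !converse_mul mulrA.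
- by move=> i j a ij; rewrite !converse_mul mulrA; apply: (sd_off sd); rewrite eq_sym.
Qed.

Lemma converse_corner i j (a : A) : corner ec Jc i j a <-> corner e J j i a.
Proof. by split=> -[h1 h2 h3]; split. Qed.

Lemma converse_left_thin (w : A) : left_thin Jc (w : Ac) -> right_thin J w.
Proof.
move=> h p; have [x0 x0p h0] := h p; exists x0; first by rewrite -converse_pw_aux.
move=> x xp; have [|c [r rp E]] := h0 x; first by rewrite converse_pw_aux.
by exists c, r; rewrite // -converse_pw_aux.
Qed.

Lemma converse_right_thin (w : A) : left_thin J w -> right_thin Jc (w : Ac).
Proof.
move=> h p; have [x0 x0p h0] := h p; exists x0; first by rewrite converse_pw_aux.
move=> x xp; have [|c [r rp E]] := h0 x; first by rewrite -converse_pw_aux.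
by exists c, r; rewrite // converse_pw_aux.
Qed.

Lemma right_gen_of_converse : uniserial_gen ec Jc -> right_gen e J.
Proof.
move=> h i j N a sN ca aN; have [||a' [ca' a'N ua']] := h j i (N : {vspace Ac}) a _ _ aN.
- by rewrite converse_pw.
- exact/converse_corner.
exists a'; split=> //; first exact/converse_corner.
by apply: converse_left_thin; apply: unis_left_thin ua'; apply: converse_split_data.
Qed.

Lemma right_gen_converse : uniserial_gen e J -> right_gen ec Jc.
Proof.
move=> h i j N a sN ca aN.
have [||a' [ca' a'N ua']] := h j i (N : {vspace A}) a _ _ aN.
- by rewrite -converse_pw.
- exact/converse_corner.
exists a'; split=> //; first exact/converse_corner.
by apply: converse_right_thin; apply: (unis_left_thin sd ua').
Qed.

End ConverseData.

(** * Cyclic modules and duals of cyclic right modules *)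

Section Quotient.
Variables (k : fieldType) (A : falgType k) (Y : {vspace A}).

(** A / Y is realised on the complement [Y^C], with [qproj] the projection along [Y]. *)
Definition qproj : 'End(A) := daddv_pi Y^C Y.

Lemma qproj_mem x : qproj x \in (Y^C)%VS.
Proof. exact: memv_pi. Qed.

Lemma capCY : (Y^C :&: Y = 0)%VS.
Proof. by rewrite capvC capv_compl. Qed.

Lemma qproj_sub x : x - qproj x \in Y.
Proof.
have := @daddv_pi_add _ _ Y^C Y x capCY.
rewrite addvC addv_complf memvf => /(_ isT) E.
by rewrite -{1}E /qproj addrAC subrr add0r; apply: memv_pi.
Qed.

Lemma qproj0 x : (qproj x == 0) = (x \in Y).
Proof.
apply/eqP/idP => [x0|xY]; first by have := qproj_sub x; rewrite x0 subr0.
apply/eqP; rewrite -memv0 -capCY memv_cap qproj_mem /=.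
by rewrite -[qproj x](subKr x) memvB ?qproj_sub.
Qed.

Definition qspace := subvs_of (Y^C)%VS.

Definition qpi : 'Hom(A, qspace) := (linfun (vsproj Y^C) \o qproj)%VF.

Definition qact (a : A) : 'End(qspace) := (qpi \o (amull a \o linfun vsval))%VF.

Lemma qpiE x : vsval (qpi x) = qproj x.
Proof. by rewrite comp_lfunE /= lfunE vsprojK ?qproj_mem. Qed.

Lemma qpi_eq0 x : qpi x = 0 <-> x \in Y.
Proof.
rewrite -qproj0 -qpiE; split=> [->|/eqP h]; first by rewrite linear0.
exact: val_inj.
Qed.

Lemma qpiK (q : qspace) : qpi (vsval q) = q.
Proof.
apply: val_inj; rewrite /= qpiE; apply/eqP; rewrite eq_sym -subr_eq0 -memv0 -capCY.
by rewrite memv_cap qproj_sub memvB ?qproj_mem ?subvsP.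
Qed.

Lemma qactE a q : qact a q = qpi (a * vsval q).
Proof. by rewrite !comp_lfunE /= !lfunE. Qed.

Lemma qpi_eq x y : x - y \in Y -> qpi x = qpi y.
Proof. by move=> xy; apply/eqP; rewrite -subr_eq0 -linearB; apply/eqP/qpi_eq0. Qed.

Hypothesis lY : lideal Y.

Lemma qact_pi a x : qact a (qpi x) = qpi (a * x).
Proof.
rewrite qactE; apply: qpi_eq; rewrite -mulrBr -opprB mulrN memvN lY //.
by rewrite qpiE qproj_sub.
Qed.

Lemma qactA a b q : qact a (qact b q) = qact (a * b) q.
Proof. by rewrite -[q]qpiK !qact_pi mulrA. Qed.

Lemma qact1 q : qact 1 q = q.
Proof. by rewrite -[q]qpiK qact_pi mul1r. Qed.

Lemma qactDl q a b : qact (a + b) q = qact a q + qact b q.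
Proof. by rewrite -[q]qpiK !qact_pi mulrDl linearD. Qed.

(** The proof that [Y] is a left ideal is an argument of the type, because the module structure
    declared on it depends on that proof. *)
Definition quo of lideal Y : Type := qspace.
Definition dual_quo of lideal Y : Type := 'Hom(qspace, k^o).

End Quotient.

Section QuotientModule.
Variables (k : fieldType) (A : falgType k) (Y : {vspace A}) (lY : lideal Y).

HB.instance Definition _ := GRing.Zmodule.copy (quo lY) (qspace Y).

Definition quo_scale (a : A) (q : quo lY) : quo lY := qact Y a q.

Fact quo_scaleA a b q : quo_scale a (quo_scale b q) = quo_scale (a * b) q.
Proof. exact: qactA. Qed.
Fact quo_scale1 : left_id 1 quo_scale.
Proof. exact: qact1. Qed.
Fact quo_scaleDr : right_distributive quo_scale +%R.
Proof. by move=> a q r; apply: linearD. Qed.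
Fact quo_scaleDl q a b : quo_scale (a + b) q = quo_scale a q + quo_scale b q.
Proof. exact: qactDl. Qed.

HB.instance Definition _ := GRing.Zmodule_isLmodule.Build A (quo lY)
  quo_scaleA quo_scale1 quo_scaleDr quo_scaleDl.

Definition quo_pi (x : A) : quo lY := qpi Y x.

Lemma quo_piZ a x : a *: quo_pi x = quo_pi (a * x).
Proof. exact: qact_pi. Qed.

Lemma quo_piB x y : quo_pi x - quo_pi y = quo_pi (x - y).
Proof. by rewrite /quo_pi linearB. Qed.

Lemma quo_piD x y : quo_pi x + quo_pi y = quo_pi (x + y).
Proof. by rewrite /quo_pi linearD. Qed.

Lemma quo_pi0 x : quo_pi x = 0 <-> x \in Y.
Proof. exact: qpi_eq0. Qed.

Lemma quo_pi_surj (q : quo lY) : exists x, q = quo_pi x.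
Proof. by exists (vsval (q : qspace Y)); rewrite /quo_pi qpiK. Qed.

End QuotientModule.

(* A right ideal Y of A is a left ideal of A^c; the k-dual of A / Y is a left
   A-module through (a phi) (x) = phi (x a). *)
Section DualModule.
Variables (k : fieldType) (A : falgType k).
Let Ac : falgType k := A^c.
Variables (Y : {vspace Ac}) (lY : lideal Y).

HB.instance Definition _ := GRing.Zmodule.copy (dual_quo lY) 'Hom(qspace Y, k^o).

Definition dual_scale (a : A) (f : dual_quo lY) : dual_quo lY :=
  ((f : 'Hom(qspace Y, k^o)) \o qact Y (a : Ac))%VF.

Lemma dual_scaleE a f (q : qspace Y) :
  (dual_scale a f : 'Hom(qspace Y, k^o)) q = (f : 'Hom(qspace Y, k^o)) (qact Y (a : Ac) q).
Proof. by rewrite comp_lfunE. Qed.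

Fact dual_scaleA a b f : dual_scale a (dual_scale b f) = dual_scale (a * b) f.
Proof. by apply/lfunP => q; rewrite !dual_scaleE (qactA lY). Qed.
Fact dual_scale1 : left_id 1 dual_scale.
Proof. by move=> f; apply/lfunP => q; rewrite dual_scaleE (qact1 lY). Qed.
Fact dual_scaleDr : right_distributive dual_scale +%R.
Proof. by move=> a f g; apply/lfunP => q; rewrite dual_scaleE !add_lfunE !dual_scaleE. Qed.
Fact dual_scaleDl f a b : dual_scale (a + b) f = dual_scale a f + dual_scale b f.
Proof.
by apply/lfunP => q; rewrite add_lfunE !dual_scaleE (qactDl lY) linearD.
Qed.

HB.instance Definition _ := GRing.Zmodule_isLmodule.Build A (dual_quo lY)
  dual_scaleA dual_scale1 dual_scaleDr dual_scaleDl.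

Definition dual_eval (f : dual_quo lY) (x : A) : k := (f : 'Hom(qspace Y, k^o)) (qpi Y x).

Lemma dual_evalZ a f x : dual_eval (a *: f) x = dual_eval f (x * a).
Proof. by rewrite /dual_eval dual_scaleE (qact_pi lY). Qed.

Lemma dual_evalD f g x : dual_eval (f + g) x = dual_eval f x + dual_eval g x.
Proof. by rewrite /dual_eval add_lfunE. Qed.

Lemma dual_evalB f g x : dual_eval (f - g) x = dual_eval f x - dual_eval g x.
Proof. by rewrite /dual_eval add_lfunE opp_lfunE. Qed.

Lemma dual_eval_linear f c x y : dual_eval f (c *: x + y) = c * dual_eval f x + dual_eval f y.
Proof.
by rewrite /dual_eval [qpi Y _](@linearP _ _ _ _ (qpi Y) c x y) [LHS]linearP.
Qed.

Lemma dual_eval_inj f g : (forall x, dual_eval f x = dual_eval g x) -> f = g.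
Proof. by move=> fg; apply/lfunP => q; rewrite -[q]qpiK; apply: fg. Qed.

Lemma dual_evalY f x : (x : Ac) \in Y -> dual_eval f x = 0.
Proof. by move/qpi_eq0; rewrite /dual_eval => ->; rewrite linear0. Qed.

Lemma dual_eval_ex (W : {vspace Ac}) t : (Y <= W)%VS -> (t : Ac) \notin W ->
  exists f : dual_quo lY, (forall x, (x : Ac) \in W -> dual_eval f x = 0) /\ dual_eval f t = 1.
Proof.
move=> YW tW; have t0 : qproj W t != 0 by rewrite qproj0.
have frt : free [tuple qproj W t] by rewrite seq1_free.
(* The coordinate of a one-element free family is defined on all of [A]; composed with the
   projection along [W] it vanishes on [W]. *)
pose h : 'Hom(Ac, k^o) := (linfun (coord [tuple qproj W t] ord0 : Ac -> k^o) \o qproj W)%VF.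
pose f : 'Hom(qspace Y, k^o) := (h \o linfun vsval)%VF.
have hW x : x \in W -> h x = 0.
  by rewrite -qproj0 => /eqP x0; rewrite comp_lfunE x0 linear0.
have fE x : dual_eval (f : dual_quo lY) x = h x.
  have E : linfun vsval (qpi Y x) = qproj Y x by rewrite lfunE /= qpiE.
  rewrite /dual_eval comp_lfunE E.
  have h0 : h (x - qproj Y x) = 0 by apply: hW; apply: (subvP YW); apply: qproj_sub.
  by move: h0; rewrite linearB => /eqP; rewrite subr_eq0 => /eqP.
exists f; split=> [x xW|]; rewrite fE; first exact: hW.
by rewrite comp_lfunE lfunE /= (coord_free ord0 ord0 frt) eqxx.
Qed.

End DualModule.

(** * Modules *)

Section Modules.
Variables (k : closedFieldType) (A : falgType k) (n : nat) (e : 'I_n -> A) (J : {vspace A}).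
Hypothesis sd : split_data e J.

Section OneModule.
Variable M : lmodType A.
Implicit Types (U L N S : set M) (x y z : M) (a r : A).

Lemma submoduleP U :
  submodule U <-> U 0 /\ forall a x y, U x -> U y -> U (a *: x + y).
Proof.
split=> -[U0 UZ]; split.
- by move: U0; rewrite inE.
- by move=> a x y Ux Uy; have := UZ a x y; rewrite !inE; apply.
- by rewrite inE.
- by move=> a x y; rewrite !inE; apply: UZ.
Qed.

Lemma sub0 U : submodule U -> U 0. Proof. by case/submoduleP. Qed.

Lemma subZ U a x : submodule U -> U x -> U (a *: x).
Proof. by case/submoduleP=> U0 UZ Ux; rewrite -[a *: x]addr0; apply: UZ. Qed.

Lemma subD U x y : submodule U -> U x -> U y -> U (x + y).
Proof. by case/submoduleP=> U0 UZ Ux Uy; rewrite -[x]scale1r; apply: UZ. Qed.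

Lemma subN U x : submodule U -> U x -> U (- x).
Proof. by move=> sU Ux; rewrite -scaleN1r; apply: subZ. Qed.

Lemma subB U x y : submodule U -> U x -> U y -> U (x - y).
Proof. by move=> sU Ux Uy; apply: subD => //; apply: subN. Qed.

Lemma sub_sum U (I : finType) (f : I -> M) :
  submodule U -> (forall i, U (f i)) -> U (\sum_i f i).
Proof.
move=> sU Uf; elim/big_ind: _ => [|x y|i _]; [exact: sub0|exact: subD|exact: Uf].
Qed.

Lemma submodule0 : submodule ([set 0] : set M).
Proof.
by apply/submoduleP; split=> // a x y /= -> ->; rewrite scaler0 addr0.
Qed.

Lemma submoduleT : submodule ([set: M]).
Proof. by apply/submoduleP. Qed.

Lemma submodule_cyclic x : submodule [set y | exists a, y = a *: x].
Proof.
apply/submoduleP; split; first by exists 0; rewrite scale0r.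
by move=> a _ _ [b ->] [c ->]; exists (a * b + c); rewrite scalerDl scalerA.
Qed.

Lemma submoduleD U L : submodule U -> submodule L ->
  submodule [set z | exists x y, [/\ U x, L y & z = x + y]].
Proof.
move=> sU sL; apply/submoduleP; split.
  by exists 0, 0; split; rewrite ?addr0 //; apply: sub0.
move=> a _ _ [x [y [Ux Ly ->]]] [x' [y' [Ux' Ly' ->]]].
exists (a *: x + x'), (a *: y + y'); split.
- by apply: subD => //; apply: subZ.
- by apply: subD => //; apply: subZ.
by rewrite scalerDr addrACA.
Qed.

Lemma nil_absorb L r x : submodule L -> r \in J -> L (x - r *: x) -> L x.
Proof.
move=> sL rJ Lx.
have step m : exists2 s, s \in pw J m & L (x - s *: x).
  elim: m => [|m [s sm Ls]].
    by exists 1; [exact: mem_pw0|rewrite scale1r subrr; apply: sub0].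
  exists (s * r); first by rewrite -(pwSr sd) memv_mul.
  have -> : x - (s * r) *: x = (x - s *: x) + s *: (x - r *: x).
    by rewrite scalerBr scalerA addrA subrK.
  by apply: subD => //; apply: subZ.
have [m m0] := sd_nil sd; have [s] := step m.
by rewrite m0 memv0 => /eqP ->; rewrite scale0r subr0.
Qed.

Lemma maximal_J L U r y : maximal_in L U -> r \in J -> U y -> L (r *: y).
Proof.
move=> [sL sU LU _ mL] rJ Uy.
pose L' := [set z | exists x x', [/\ L x, [set y' | exists a, y' = a *: (r *: y)] x' & z = x + x']].
have sL' : submodule L' by apply: submoduleD => //; apply: submodule_cyclic.
have LL' : L `<=` L'.
  by move=> x Lx; exists x, 0; split; rewrite ?addr0 //; exists 0; rewrite scale0r.
have L'U : L' `<=` U.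
  move=> _ [x [_ [Lx [a ->] ->]]]; apply: subD => //; first exact: LU.
  by rewrite scalerA; apply: subZ.
have [<-|EU] := mL L' sL' LL' L'U.
  by exists 0, (r *: y); split; rewrite ?add0r //; [apply: sub0|exists 1; rewrite scale1r].
have : L' y by rewrite EU.
case=> x [_ [Lx [a ->] yE]]; apply: subZ => //.
apply: (nil_absorb (r := a * r) sL); first exact: (sd_mull sd).
by rewrite {1}yE scalerA addrK.
Qed.

Lemma radm_J U r y : submodule U -> r \in J -> U y -> radm U (r *: y).
Proof.
move=> sU rJ Uy; split; first exact: subZ.
by move=> N mN; apply: maximal_J mN rJ Uy.
Qed.

Lemma radm_submodule U : submodule U -> submodule (radm U).
Proof.
move=> sU; apply/submoduleP; split=> [|a x y [Ux hx] [Uy hy]].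
  by split=> [|N [sN _ _ _ _]]; apply: sub0.
split=> [|N mN]; first by apply: subD => //; apply: subZ.
have [sN _ _ _ _] := mN.
by apply: subD => //; [apply: subZ => //; apply: hx|apply: hy].
Qed.

Lemma scale_alg (c : k) a x : (c *: a) *: x = c%:A *: (a *: x).
Proof. by rewrite scalerA mulr_algl. Qed.

Lemma scale_algK (c : k) x : c != 0 -> c^-1%:A *: (c%:A *: x) = x.
Proof. by move=> c0; rewrite scalerA mulr_algl scalerA mulVf // !scale1r. Qed.

Lemma ex_max (P : set M -> Prop) L0 : fin_gen M -> submodule L0 -> P L0 ->
  exists L, [/\ submodule L, P L &
    forall L', submodule L' -> P L' -> L `<=` L' -> L' `<=` L].
Proof.
move=> [m [g gen]] sL0 PL0; pose V := {ffun 'I_m -> A} : vectType k.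
pose ev (c : V) := \sum_i c i *: g i.
have pre L : submodule L -> exists W : {vspace V}, forall c, c \in W <-> L (ev c).
  move=> sL; apply: vspace_of_set => [|t c d Lc Ld].
    by rewrite /ev big1 => [|i _]; rewrite ?ffunE ?scale0r //; apply: sub0.
  have -> : ev (t *: c + d) = t%:A *: ev c + ev d.
    rewrite /ev scaler_sumr -big_split; apply: eq_bigr => i _.
    by rewrite !ffunE scalerDl scale_alg.
  by apply: subD => //; apply: subZ.
pose Q (W : {vspace V}) := exists L, [/\ submodule L, P L & forall c, c \in W <-> L (ev c)].
have [W0 W0E] := pre L0 sL0.
have [W [L [sL PL WE]] maxW] : exists2 W, Q W & forall W', Q W' -> (\dim W' <= \dim W)%N.
  by apply: (max_vspace (U0 := W0)); exists L0.
exists L; split=> // L' sL' PL' LL' x; have [c ->] := gen x.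
have [W' W'E] := pre L' sL'.
have sWW' : (W <= W')%VS by apply/subvP => d /WE/LL'/W'E.
have /eqP EW : W == W' by rewrite eqEdim sWW' maxW //; exists L'.
have <- : ev [ffun i => c i] = \sum_i c i *: g i.
  by apply: eq_bigr => i _; rewrite ffunE.
by move/W'E; rewrite -EW => /WE.
Qed.

Lemma hom_sum_mod x : x = \sum_i e i *: x.
Proof. by rewrite -scaler_suml (sd_sum sd) scale1r. Qed.

Lemma sub_hom U x : submodule U -> (forall i, U (e i *: x)) -> U x.
Proof. by move=> sU Ux; rewrite [x]hom_sum_mod; apply: sub_sum. Qed.

Lemma ex_hom_mod U x : submodule U -> ~ U x -> exists i, ~ U (e i *: x).
Proof.
move=> sU nUx; apply/not_existsP => h; apply: nUx; apply: sub_hom => // i.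
by apply: contrapT => nUi; apply: (h i).
Qed.

Lemma scale_hom i a x : exists c : k, exists2 r, r \in J &
  a *: (e i *: x) = c%:A *: (e i *: x) + r *: x.
Proof.
have [c [r rJ E] _] := split_elt sd i a; exists c, r => //.
by rewrite [LHS]scalerA E scalerDl scale_alg.
Qed.

Lemma maximal_line N U t : submodule N -> submodule U -> N `<=` U -> U t -> ~ N t ->
  (forall x, U x -> exists c : k, N (x - c%:A *: t)) -> maximal_in N U.
Proof.
move=> sN sU NU Ut nNt h; split=> //; first by move=> E; apply: nNt; rewrite E.
move=> L sL NL LU; have [LN|nLN] := pselect (L `<=` N).
  by left; apply/seteqP.
right; apply/seteqP; split=> // x Ux.
have [y [Ly nNy]] : exists y, L y /\ ~ N y.
  apply/not_existsP => h'; apply: nLN => y Ly.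
  by apply: contrapT => nNy; apply: (h' y).
have [c Nc] := h y (LU y Ly).
have c0 : c != 0.
  by apply/eqP => c0; apply: nNy; move: Nc; rewrite c0 !scale0r subr0.
have Lt : L t.
  have -> : t = (c^-1)%:A *: (y - (y - c%:A *: t)).
    by rewrite subKr scale_algK.
  by apply: subZ => //; apply: subB => //; apply: NL.
have [d Nd] := h x Ux.
by rewrite -[x](subrK (d%:A *: t)); apply: subD => //; [apply: NL|apply: subZ].
Qed.

Lemma simple_line S s : submodule S -> S s -> s <> 0 ->
  (forall x, S x -> exists c : k, x = c%:A *: s) -> simple_sub S.
Proof.
move=> sS Ss s0 h.
have mS : maximal_in [set 0] S.
  apply: (maximal_line (t := s)) => //; first exact: submodule0.
    by move=> x /= ->; apply: sub0.
  by move=> x /h[c ->]; exists c; rewrite /= subrr.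
have [_ _ _ n0 m] := mS; split=> //; first by move=> E; apply: n0.
move=> L sL LS; apply: m => // x /= ->; exact: sub0.
Qed.

Lemma radm_sub N L : fin_gen M -> submodule N -> submodule L -> L `<=` N ->
  (forall r x, r \in J -> N x -> L (r *: x)) -> radm N `<=` L.
Proof.
move=> fgM sN sL LN JN x [Nx radx]; apply: contrapT => nLx.
have [i nLi] := ex_hom_mod sL nLx; set z := e i *: x in nLi.
have Nz : N z by apply: subZ.
have [L' [sL' [LL' L'N nL'z] mL']] :=
  ex_max (P := fun L' => [/\ L `<=` L', L' `<=` N & ~ L' z]) fgM sL
    (And3 (fun x h => h) LN nLi).
apply: (nL'z); apply: subZ => //; apply: radx; split=> //.
  by move=> E; apply: (nL'z); rewrite E.
move=> L'' sL'' L'L'' L''N; have [L''z|nL''z] := pselect (L'' z); last first.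
  left; apply/seteqP; split=> //; apply: mL' => //; split=> //.
  by apply: subset_trans L'L''.
right; apply/seteqP; split=> // y Ny; apply: sub_hom => // l.
have [|nL'l] := pselect (L' (e l *: y)); first exact: L'L''.
pose K := [set u | exists c : k, L' (u - c%:A *: (e l *: y))].
have sK : submodule K.
  apply/submoduleP; split; first by exists 0; rewrite !scale0r subr0; apply: sub0.
  move=> a u v [c cu] [d dv]; have [s [r rJ E]] := scale_hom l (a * c%:A) y.
  exists (s + d).
  have -> : a *: u + v - (s + d)%:A *: (e l *: y) =
      a *: (u - c%:A *: (e l *: y)) + (v - d%:A *: (e l *: y)) + r *: y.
    rewrite -scalerA in E; rewrite -{1}[u](subrK (c%:A *: (e l *: y))) scalerDr E.
    rewrite !scalerDl opprD -!addrA; congr (_ + _).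
    by rewrite [v + (- _ - _)]addrCA [r *: y + (- _ + _)]addrCA addNKr addrC addrA.
  apply: subD => //; last by apply/LL'/JN.
  by apply: subD => //; apply: subZ.
have Kz : K z.
  apply: contrapT => nKz; apply: nL'l; apply: (mL' K) => //; last first.
  - by exists 1; rewrite !scale1r subrr; apply: sub0.
  - by move=> u L'u; exists 0; rewrite !scale0r subr0.
  split=> //.
  - by move=> u Lu; exists 0; rewrite !scale0r subr0; apply: LL'.
  - move=> u [c cu]; rewrite -[u](subrK (c%:A *: (e l *: y))).
    by apply: subD => //; [apply: L'N|do 2!apply: subZ => //].
have [c cz] := Kz; have c0 : c != 0.
  by apply/eqP => c0; apply: (nL'z); move: cz; rewrite c0 !scale0r subr0.
have -> : e l *: y = (c^-1)%:A *: (z - (z - c%:A *: (e l *: y))).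
  by rewrite subKr scale_algK.
by apply: subZ => //; apply: subB => //; apply: L'L''.
Qed.

Lemma loewy2 : fin_gen M -> (forall r s x, r \in J -> s \in J -> r *: (s *: x) = 0) ->
  (exists r x, r \in J /\ r *: x <> 0) -> loewy_length M 2.
Proof.
move=> fgM JJ [r0 [x0 [r0J rx0]]]; pose L := [set x : M | forall r, r \in J -> r *: x = 0].
have sL : submodule L.
  apply/submoduleP; split=> [r _|a x y Lx Ly r rJ]; first exact: scaler0.
  by rewrite scalerDr scalerA Lx ?Ly ?addr0 // (sd_mulr sd).
have radL : radm [set: M] `<=` L.
  apply: radm_sub => //; first exact: submoduleT.
  by move=> s x sJ _ r rJ; apply: JJ.
have srad : submodule (radm [set: M]) := radm_submodule submoduleT.
have radr : radm [set: M] (r0 *: x0) by apply: radm_J => //; apply: submoduleT.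
split.
  apply/seteqP; split; last first.
    move=> _ /= ->; split; first exact: sub0.
    by move=> N [sN _ _ _ _]; apply: sub0.
  apply: radm_sub => //; first exact: submodule0.
    by move=> x /= ->; apply: sub0.
  by move=> r x rJ /radL; apply.
case=> [|[|//]] _ /= E; apply: rx0; first by have : [set: M] (r0 *: x0) by []; rewrite E.
by move: radr; rewrite E.
Qed.

Lemma loewy2_JJ r s x : loewy_length M 2 -> r \in J -> s \in J -> r *: (s *: x) = 0.
Proof.
case=> /= E _ rJ sJ; have sT := submoduleT.
have srad : submodule (radm [set: M]) := radm_submodule sT.
have : radm (radm [set: M]) (r *: (s *: x)) by do 2!apply: radm_J => //.
by rewrite E.
Qed.

Lemma socleP x : socle x <-> forall r, r \in J -> r *: x = 0.
Proof.
split.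
  case=> m [s [hs ->]] r rJ; rewrite scaler_sumr big1 // => i _.
  have [S [[sS nS mS] Ss]] := hs i.
  have [||E|E] := mS [set y | exists a, y = a *: (r *: s i)].
  - exact: submodule_cyclic.
  - by move=> _ [a ->]; do 2!apply: subZ => //.
  - have : [set y | exists a, y = a *: (r *: s i)] (r *: s i) by exists 1; rewrite scale1r.
    by rewrite E.
  have : [set y | exists a, y = a *: (r *: s i)] (s i) by rewrite E.
  case=> a sE; have -> : s i = 0; last by rewrite scaler0.
  apply: (nil_absorb (L := [set 0]) (r := a * r)); first exact: submodule0.
    exact: (sd_mull sd).
  by rewrite -scalerA -sE /= subrr.
move=> Jx; have [->|x0] := pselect (x = 0).
  by exists 0%N, (fun=> 0); split; [case|rewrite big_ord0].
have line i : e i *: x <> 0 -> simple_sub [set y | exists c : k, y = c%:A *: (e i *: x)].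
  move=> ix0; apply: (simple_line (s := e i *: x)) => //; last first.
    by exists 1; rewrite !scale1r.
  apply/submoduleP; split; first by exists 0; rewrite !scale0r.
  move=> a _ _ [c ->] [d ->]; have [s [r rJ E]] := scale_hom i (a * c%:A) x.
  by exists (s + d); rewrite scalerA E (Jx r rJ) addr0 !scalerDl.
have [i0 ix0] := ex_hom_mod submodule0 x0.
exists n, (fun i => e i *: x); split; last exact: hom_sum_mod.
move=> i; have [->|ix] := pselect (e i *: x = 0).
  exists [set y | exists c : k, y = c%:A *: (e i0 *: x)]; split; first exact: line.
  by exists 0; rewrite !scale0r.
exists [set y | exists c : k, y = c%:A *: (e i *: x)]; split; first exact: line.
by exists 1; rewrite !scale1r.
Qed.

Lemma flag_indep (N : nat -> set M) :
  (forall i, (i < 3)%N -> maximal_in (N i) (N i.+1)) ->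
  exists y1 y2 y3, [/\ N 3%N y1, N 3%N y2, N 3%N y3 &
    forall s1 s2 s3 : k, N 0%N (s1%:A *: y1 + s2%:A *: y2 + s3%:A *: y3) ->
      [/\ s1 = 0, s2 = 0 & s3 = 0]].
Proof.
move=> h.
have pick i : (i < 3)%N -> exists y, N i.+1 y /\ ~ N i y.
  move=> /h[_ _ s ne _]; apply/not_existsP => h'; apply: ne; apply/seteqP; split=> // y Ny.
  by apply: contrapT => nNy; apply: (h' y).
have [y1 [y11 y10]] := pick 0%N isT; have [y2 [y22 y21]] := pick 1%N isT.
have [y3 [y33 y32]] := pick 2%N isT.
have [s0 s1 i01 _ _] := h 0%N isT; have [_ s2 i12 _ _] := h 1%N isT.
have [_ s3 i23 _ _] := h 2%N isT.
have key N' y (s : k) : submodule N' -> ~ N' y -> N' (s%:A *: y) -> s = 0.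
  move=> sN' ny sy; have [//|s'] := eqVneq s 0; case: ny.
  have -> : y = (s^-1)%:A *: (s%:A *: y); last exact: subZ.
  by rewrite scale_algK.
exists y1, y2, y3; split; [by apply/i23/i12|exact: i23|done|].
move=> t1 t2 t3 N0.
have t30 : t3 = 0.
  apply: (key (N 2%N) y3) => //.
  rewrite -[t3%:A *: y3](addKr (t1%:A *: y1 + t2%:A *: y2)).
  apply: subD => //; last exact/i12/i01.
  apply: subN => //; apply: subD => //; apply: subZ => //; exact: i12.
rewrite t30 !scale0r addr0 in N0.
have t20 : t2 = 0.
  apply: (key (N 1%N) y2) => //.
  rewrite -[t2%:A *: y2](addKr (t1%:A *: y1)).
  by apply: subD => //; [apply: subN => //; apply: subZ|exact: i01].
rewrite t20 !scale0r addr0 in N0; split=> //.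
exact: (key (N 0%N) y1).
Qed.

End OneModule.

Notation pw := (pw J).
Notation pl := (pl J).
Notation corner := (corner e J).
Notation top2 := (top2 e J).

Lemma radAP (x : A) : radA x <-> x \in J.
Proof.
have sT := submoduleT (A^o : lmodType A); split=> [[_ mx]|xJ]; last first.
  have := @radm_J (A^o : lmodType A) [set: A^o] x (1 : A^o) sT xJ I.
  by rewrite /GRing.scale /= mulr1.
rewrite [x](hom_sumr sd); apply: memv_suml => i _.
pose L : set A^o := [set a : A | a * e i \in J].
have sL : @submodule A (A^o : lmodType A) L.
  apply/submoduleP; split; first by rewrite /L /= mul0r mem0v.
  by move=> a y z; rewrite /L /= => yJ zJ; rewrite mulrDl -mulrA memvD // (sd_mull sd).
apply: (mx L); apply: (maximal_line (t := (e i : A^o))) => //.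
  by rewrite /L /= (sd_idem sd) => eJ; have := e_notin sd i; rewrite eJ.
move=> y _; have [c [r rJ E] _] := split_elt sd i y; exists c.
rewrite /L /= /GRing.scale /= mulr_algl mulrBl E -scalerAl (sd_idem sd) addrAC subrr add0r.
exact: rJ.
Qed.

Lemma rad2AP (x : A) : rad2A x <-> x \in pw 2.
Proof.
split.
  case=> m [a [b [ab ->]]]; apply: memv_suml => i _.
  have [/radAP ai /radAP bi] := ab i.
  by rewrite -(addn1 1) (mem_pwM sd) ?(pw1 sd).
have -> : pw 2 = (J * J)%VS by rewrite pwS (pw1 sd).
move: x; apply: prodv_ind => [|c x y|u v uJ vJ].
- by exists 0%N, (fun=> 0), (fun=> 0); split; [case|rewrite big_ord0].
- case=> [m [a [b [ab ->]]]] [m' [a' [b' [ab' ->]]]].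
  exists (m + m')%N, (fun i => match fintype.split i with inl j => c *: a j | inr j => a' j end),
    (fun i => match fintype.split i with inl j => b j | inr j => b' j end); split.
    move=> i; case: (fintype.split i) => // j; have [/radAP aJ bJ] := ab j.
    by split=> //; apply/radAP; apply: memvZ.
  rewrite big_split_ord scaler_sumr; congr (_ + _); apply: eq_bigr => i _.
    by rewrite -[lshift _ i]/(unsplit (inl i)) unsplitK scalerAl.
  by rewrite -[rshift _ i]/(unsplit (inr i)) unsplitK.
exists 1%N, (fun=> u), (fun=> v); split=> [i|]; first by split; apply/radAP.
by rewrite big_ord1.
Qed.

Lemma corner_radP i j (a : A) : corner_rad (e i) (e j) a <-> corner i j a.
Proof.
split=> [[r /radAP rJ <-]|[aJ ia aj]]; first exact: cornerI.
by exists a; [apply/radAP|rewrite ia].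
Qed.

Lemma span_pair (a b u : A) : (u \in <<[:: a; b]>>%VS) <-> u \in (<[a]> + <[b]>)%VS.
Proof. by rewrite span_cons span_seq1. Qed.

Lemma indep_classesP (a2 a3 b2 b3 : A) : indep_classes a2 a3 b2 b3 <->
  [/\ b2 \in span2 a2 a3 (pw 2), b3 \in span2 a2 a3 (pw 2) & indep (pw 2) b2 b3].
Proof.
have eq b : (exists2 u, u \in <<[:: a2; a3]>>%VS & rad2A (b - u)) <->
    b \in span2 a2 a3 (pw 2).
  split=> [[u /span_pair us /rad2AP bu]|/memv_addP[u us [w w2 ->]]].
    by rewrite -[b](subrK u) addrC memv_add.
  exists u; first exact/span_pair.
  by apply/rad2AP; rewrite addrC addKr.
split=> [[/eq h2 /eq h3 h]|[/eq h2 /eq h3 h]]; split=> // c d.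
  by move=> cd; apply: h; apply/rad2AP.
by move/rad2AP/h.
Qed.

Lemma not_D4_left : (forall i, top2 i) -> right_gen e J ->
  (forall j, biserial_at e J j) -> ~ D4_left e.
Proof.
move=> top RG bis [M [_ [_ [i [j [a1 [a2 [a3 [b0]]]]]]]]].
move=> [[/corner_radP[a1J ia1 a1j] /radAP a2J /radAP a3J] [ind J2 ns]]; apply: ns.
have [U [V bUV]] := bis j; have [uU uV UV _] := bUV.
have : a1 \in (U + V)%VS by rewrite UV -a1j (mem_pl1 sd).
case/memv_addP=> u uinU [v vinV a1E].
have E : a1 = e i * u + e i * v by rewrite -mulrDr -a1E.
have idem w : e i * (e i * w) = e i * w by rewrite mulrA (sd_idem sd).
have ind' : indep (pl 2 (e i * u + e i * v)) (a2 * (e i * u + e i * v)) (a3 * (e i * u + e i * v)).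
  rewrite -E => c d /mem_pl[r r2 cd]; apply: ind.
  rewrite -!scale_alg -scalerDl cd; apply: J2; exact/rad2AP.
have [lU _] := uU; have [lV _] := uV.
have [a [a' [b [b' [[ca ca' bJ b'J] [sb sb' ib [aa ba b'a]]]]]]] :=
  splits_of_biserial_pair sd RG (top i) bUV (lU _ _ uinU) (lV _ _ vinV)
    (idem _) (idem _) a2J a3J ind'.
exists a, a', b, b'; split.
  by split; [exact/corner_radP|exact/corner_radP|exact/radAP|exact/radAP].
move: aa ba b'a; rewrite !memv0 => /eqP aa /eqP -> /eqP ->.
split; rewrite ?scale0r //; first exact/indep_classesP.
by rewrite -scalerDl; congr (_ *: _); apply/eqP; rewrite -subr_eq0 [a1 in X in _ - X]E aa.
Qed.

Lemma three_dependent (c1 c2 c3 d1 d2 d3 : k) : exists s1 s2 s3,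
  [/\ s1 * c1 + s2 * c2 + s3 * c3 = 0, s1 * d1 + s2 * d2 + s3 * d3 = 0 &
      ~ [/\ s1 = 0, s2 = 0 & s3 = 0]].
Proof.
have [/eqP D1|D1] := boolP (c1 * d2 - c2 * d1 == 0); last first.
  exists (c2 * d3 - c3 * d2), (c3 * d1 - c1 * d3), (c1 * d2 - c2 * d1).
  by split; [ring|ring|case=> _ _ /eqP; rewrite (negPf D1)].
have [/eqP c10|c10] := boolP (c1 == 0); last first.
  exists (- c2), c1, 0; split; first by ring.
    by rewrite mul0r addr0 mulNr addrC D1.
  by case=> _ /eqP; rewrite (negPf c10).
have [/eqP d10|d10] := boolP (d1 == 0); last first.
  exists (- d2), d1, 0; split; last by case=> _ /eqP; rewrite (negPf d10).
    have -> : - d2 * c1 + d1 * c2 + 0 * c3 = - (c1 * d2 - c2 * d1) by ring.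
    by rewrite D1 oppr0.
  by ring.
exists 1, 0, 0; rewrite c10 d10 !mul0r !mulr0 !addr0.
by split=> //; case=> /eqP; rewrite oner_eq0.
Qed.

Lemma not_D4_local_rad3 : (forall j, top2 j) -> ~ D4_local_rad3 A.
Proof.
move=> top [M [fgM [N [mN uN]] loew [_ _ [F [F0 F3 hF]]]]].
have [sN sT _ NT _] := mN; have sTM := submoduleT M.
have [y nNy] : exists y, ~ N y.
  apply/not_existsP => h; apply: NT; apply/seteqP; split=> // y _.
  by apply: contrapT => nNy; apply: (h y).
have [j nNx] := ex_hom_mod sN nNy; set x := e j *: y in nNx.
have gen z : exists a, z = a *: x.
  pose L := [set z | exists a, z = a *: x].
  have sL : submodule L by apply: submodule_cyclic.
  apply: contrapT => nz.
  have [L' [sL' [LL' nL'z] mL']] :=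
    ex_max (P := fun L' => L `<=` L' /\ ~ L' z) fgM sL (conj (fun x h => h) nz).
  have [L2 [sL2 [LL2 nL2] mL2]] :=
    ex_max (P := fun L' => L `<=` L' /\ L' <> [set: M]) fgM sL
      (conj (fun x h => h) (fun E : L = [set: M] => nz (eq_ind_r (fun S => S z) I E))).
  apply: nNx; rewrite (uN L2); first by apply: LL2; exists 1; rewrite scale1r.
  split=> // L3 sL3 L23 _; have [E|nE] := pselect (L3 = [set: M]); first by right.
  left; apply/seteqP; split=> //; apply: mL2 => //; split=> //.
  exact: subset_trans L23.
pose Jx := [set z : M | exists2 r, r \in J & z = r *: x].
have sJx : submodule Jx.
  apply/submoduleP; split; first by exists 0; rewrite ?mem0v ?scale0r.
  move=> a _ _ [r rJ ->] [s sJ ->]; exists (a * r + s); last by rewrite scalerDl scalerA.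
  by rewrite memvD // (sd_mull sd).
have radJx : radm [set: M] `<=` Jx.
  apply: radm_sub => // r z rJ _; have [a ->] := gen z.
  by exists (r * a); rewrite ?scalerA // (sd_mulr sd).
have J2 r : r \in pw 2 -> r *: x = 0.
  have -> : pw 2 = (J * J)%VS by rewrite pwS (pw1 sd).
  move: r; apply: prodv_ind => [|c u v u0 v0|u v uJ vJ].
  - by rewrite scale0r.
  - by rewrite scalerDl v0 scale_alg u0 scaler0 addr0.
  by rewrite -scalerA loewy2_JJ.
have [y1 [y2 [y3 [N1 N2 N3 ind]]]] := flag_indep hF.
rewrite F3 in N1 N2 N3; rewrite F0 in ind.
have [x1 [x2 [x1J x2J topx]]] := top j.
have comb z : radm [set: M] z -> exists c d : k, z = c%:A *: (x1 *: x) + d%:A *: (x2 *: x).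
  move=> /radJx[r rJ ->]; have [c [d cd]] := (span2P _ _ _ _).1 (topx r rJ).
  exists c, d; have := J2 _ cd; rewrite scalerBl scalerDl -!scale_alg -scalerA.
  by rewrite /x [e j *: (e j *: y)]scalerA (sd_idem sd) => /eqP; rewrite subr_eq0 => /eqP.
have [c1 [d1 E1]] := comb y1 N1; have [c2 [d2 E2]] := comb y2 N2.
have [c3 [d3 E3]] := comb y3 N3.
have [s1 [s2 [s3 [ec ed ns]]]] := three_dependent c1 c2 c3 d1 d2 d3.
apply: ns; apply: ind => /=; rewrite E1 E2 E3.
have mulA (s t : k) (z : M) : s%:A *: (t%:A *: z) = (s * t)%:A *: z.
  by rewrite -scale_alg scalerA.
rewrite !scalerDr !mulA [X in X + _]addrACA -!scalerDl addrACA -!scalerDl ec ed.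
by rewrite !scale0r addr0.
Qed.

Definition cotop2 j := exists x1 x2, [/\ x1 \in J, x2 \in J &
  forall x, x \in J -> e j * x \in span2 x1 x2 (pw 2)].

Lemma not_D4_colocal_top3 : (forall j, cotop2 j) -> ~ D4_colocal_top3 A.
Proof.
move=> top [M [fgM [sS S0 mS] loew [_ _ [F [F0 F3 hF]]]]].
have [s Ss s0] : exists2 s, socle s & s <> (0 : M).
  apply/not_exists2P => h; apply: S0; apply/seteqP; split=> x; last first.
    by move=> /= ->; apply: sub0.
  by move=> Sx /=; apply: contrapT => x0; case: (h x).
have [j js0] := ex_hom_mod (submodule0 M) s0; set t := e j *: s in js0.
have Jt r : r \in J -> r *: t = 0.
  by move=> rJ; rewrite scalerA; apply: (socleP s).1; rewrite // (sd_mulr sd).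
have line : [set y : M | exists c : k, y = c%:A *: t] = @socle A M.
  case: (mS [set y : M | exists c : k, y = c%:A *: t]) => //.
  - apply/submoduleP; split; first by exists 0; rewrite !scale0r.
    move=> a _ _ [c ->] [d ->]; have [u [r rJ E]] := scale_hom j (a * c%:A) s.
    exists (u + d); rewrite scalerA E !scalerDl -addrA; congr (_ + _).
    by rewrite ((socleP s).1 Ss) ?add0r.
  - by move=> _ [c ->]; do 2!apply: subZ => //.
  move=> E; have : [set y : M | exists c : k, y = c%:A *: t] t by exists 1; rewrite !scale1r.
  by rewrite E.
have Jsoc r x : r \in J -> exists c : k, r *: x = c%:A *: t.
  move=> rJ; have : socle (r *: x) by apply/socleP => r' r'J; apply: loewy2_JJ.
  by rewrite -line.
have J2 r (x : M) : r \in pw 2 -> r *: x = 0.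
  have -> : pw 2 = (J * J)%VS by rewrite pwS (pw1 sd).
  move: r; apply: prodv_ind => [|c u v u0 v0|u v uJ vJ].
  - by rewrite scale0r.
  - by rewrite scalerDl v0 scale_alg u0 scaler0 addr0.
  by rewrite -scalerA loewy2_JJ.
have [y1 [y2 [y3 [N1 N2 N3 ind]]]] := flag_indep hF.
have [x1 [x2 [x1J x2J topx]]] := top j.
have [c1 E1] := Jsoc x1 y1 x1J; have [c2 E2] := Jsoc x1 y2 x1J.
have [c3 E3] := Jsoc x1 y3 x1J; have [d1 G1] := Jsoc x2 y1 x2J.
have [d2 G2] := Jsoc x2 y2 x2J; have [d3 G3] := Jsoc x2 y3 x2J.
have [s1 [s2 [s3 [ec ed ns]]]] := three_dependent c1 c2 c3 d1 d2 d3.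
apply: ns; apply: ind; rewrite F0; apply/socleP => r rJ.
set y := _ + _.
have mulA (u v : k) (z : M) : u%:A *: (v%:A *: z) = (u * v)%:A *: z.
  by rewrite -scale_alg scalerA.
have scaleC (a : A) (u : k) (z : M) : a *: (u%:A *: z) = u%:A *: (a *: z).
  by rewrite !scalerA mulr_algr mulr_algl.
have x1y : x1 *: y = 0.
  by rewrite /y !scalerDr !scaleC E1 E2 E3 !mulA -!scalerDl ec !scale0r.
have x2y : x2 *: y = 0.
  by rewrite /y !scalerDr !scaleC G1 G2 G3 !mulA -!scalerDl ed !scale0r.
have [c rc] := Jsoc r y rJ.
have -> : r *: y = (e j * r) *: y.
  by rewrite -scalerA rc scaleC /t scalerA (sd_idem sd).
have [a [b ab]] := (span2P _ _ _ _).1 (topx r rJ).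
have := J2 _ y ab; rewrite scalerBl scalerDl (scale_alg a) (scale_alg b) x1y x2y.
by rewrite !scaler0 addr0 subr0.
Qed.

Lemma local_gen j (a : A) : a \notin J -> a * e j = a ->
  exists b t, [/\ t \in J, t * e j = t & b * a = e j - t].
Proof.
move=> aJ aj; have [l la] := ex_hom_notin sd aJ.
have lj : l = j.
  apply: contraNeq la => lj; rewrite -aj mulrA; exact: sd_off.
rewrite {l}lj in la; have [c cJ] := sd_res sd j a.
rewrite -mulrA aj in cJ.
have c0 : c != 0 by apply: contraNneq la => c0; rewrite c0 scale0r subr0 in cJ.
exists (c^-1 *: e j), (e j - c^-1 *: (e j * a)); split.
- by rewrite -memvN opprB -[X in _ - X](scalerK c0) -scalerBr memvZ.
- by rewrite mulrBl (sd_idem sd) -scalerAl -mulrA aj.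
by rewrite subKr -scalerAl.
Qed.

Lemma sub_full j (M : lmodType A) (L : set M) (x : M) (a : A) : submodule L ->
  e j *: x = x -> a \notin J -> a * e j = a -> L (a *: x) -> L x.
Proof.
move=> sL jx aJ aj La; have [b [t [tJ _ E]]] := local_gen aJ aj.
apply: (nil_absorb sL tJ); rewrite -{1}jx -scalerBl -E -scalerA; exact: subZ.
Qed.

Section LocalQuotient.
Variables (Y : {vspace A}) (lY : lideal Y) (j : 'I_n).
Hypothesis Yj : forall x, x - x * e j \in Y.
Hypothesis Y1 : 1 \notin Y.

Lemma quo_fin_gen : fin_gen (quo lY).
Proof.
exists 1%N, (fun=> quo_pi lY 1) => q; have [x ->] := quo_pi_surj q.
by exists (fun=> x); rewrite big_ord1 quo_piZ mulr1.
Qed.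

Lemma quo_pi_e x : quo_pi lY (x * e j) = quo_pi lY x.
Proof.
by apply/esym/eqP; rewrite -subr_eq0 quo_piB; apply/eqP/quo_pi0.
Qed.

Lemma quo_local : local_module (quo lY).
Proof.
pose N := [set q : quo lY | exists2 a, a * e j \in J & q = quo_pi lY a].
have sN : submodule N.
  apply/submoduleP; split; first by exists 0; rewrite ?mul0r ?mem0v //; apply/esym/quo_pi0/mem0v.
  move=> a _ _ [x xJ ->] [y yJ ->]; exists (a * x + y); last by rewrite quo_piZ quo_piD.
  by rewrite mulrDl memvD // -mulrA (sd_mull sd).
have full L : submodule L -> ~ L `<=` N -> L = [set: quo lY].
  move=> sL nL; apply/seteqP; split=> // q _; have [x ->] := quo_pi_surj q.
  suff L1 : L (quo_pi lY (e j)) by rewrite -quo_pi_e -quo_piZ; apply: subZ.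
  have [q' [Lq' nN]] : exists q', L q' /\ ~ N q'.
    apply/not_existsP => h; apply: nL => q' Lq'.
    by apply: contrapT => nN; apply: (h q').
  have [a aE] := quo_pi_surj q'.
  apply: (@sub_full j _ _ _ (a * e j)) => //.
  - by rewrite quo_piZ (sd_idem sd).
  - by apply/negP => aJ; apply: nN; exists a.
  - by rewrite -mulrA (sd_idem sd).
  by rewrite quo_piZ -mulrA (sd_idem sd) quo_pi_e -aE.
have NT : N <> [set: quo lY].
  move=> E; have : N (quo_pi lY 1) by rewrite E.
  case=> a aJ /eqP; rewrite -subr_eq0 quo_piB => /eqP/quo_pi0 aY.
  case/negP: Y1; suff ejY : e j \in Y.
    by rewrite -[1](subrK (1 * e j)) memvD // mul1r.
  have : (Defs.submodule (fun x : A^o => x \in Y)).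
    apply/submoduleP; split; first exact: mem0v.
    by move=> b x y xY yY; rewrite memvD // lY.
  move/(@nil_absorb (A^o : lmodType A) (fun x : A^o => x \in Y) (a * e j) (e j : A^o)); apply=> //.
  rewrite /GRing.scale /= -mulrA (sd_idem sd).
  have -> : e j - a * e j = (1 - a) - ((1 - a) - (1 - a) * e j).
    by rewrite subKr mulrBl mul1r.
  by rewrite memvB.
have mN : maximal_in N [set: quo lY].
  split=> //; first exact: submoduleT.
  move=> L sL NL _; have [LN|nLN] := pselect (L `<=` N); last by right; apply: full.
  by left; apply/seteqP.
exists N; split=> // N' [sN' _ _ NT' mN'].
have [N'N|nN'] := pselect (N' `<=` N); last by case: NT'; apply: full.
by have [|E] := mN' N sN N'N (@subsetT _ _); last case: NT.
Qed.

End LocalQuotient.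

Lemma D4_split_of_free : ~ D4_left e -> D4_split e J.
Proof.
move=> nD i j Y a1 a2 a3 lY Yj ca1 a2J a3J ind J2; apply: contrapT => ns; apply: nD.
have [_ _ a1j] := ca1.
have Y1 : 1 \notin Y.
  apply/negP => Y1; have [|/eqP] := ind 1 0; last by rewrite oner_eq0.
  by rewrite scale0r addr0 scale1r -[_ * _]mulr1 lY.
exists (quo lY); split; first exact: quo_fin_gen.
split; first exact: (quo_local lY Yj Y1).
exists i, j, a1, a2, a3, (quo_pi lY 1).
split; first by split; [exact/corner_radP|exact/radAP|exact/radAP].
split.
- move=> c d; rewrite !quo_piZ !mulr1 quo_piD !mulr_algl => /quo_pi0; exact: ind.
- by move=> r /rad2AP r2; rewrite quo_piZ mulr1; apply/quo_pi0/J2.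
case=> a [a' [b [b' [[/corner_radP ca /corner_radP ca' /radAP bJ /radAP b'J]]]]].
case=> /indep_classesP[sb sb' ib].
rewrite !quo_piZ !mulr1 quo_piD => aa /quo_pi0 ba /quo_pi0 b'a; apply: ns.
exists a, a', b, b'; split=> //; split=> //; split=> //.
by apply/(quo_pi0 lY); rewrite -quo_piB aa subrr.
Qed.

Lemma ideal_step (X Y : {vspace A}) : lideal X -> lideal Y -> (Y <= X)%VS ->
  (forall r x, r \in J -> x \in X -> r * x \in Y) -> ~~ (X <= Y)%VS ->
  exists X' t, [/\ lideal X', (Y <= X')%VS, (X' <= X)%VS &
    [/\ t \in X, t \notin X' & (X <= <[t]> + X')%VS]].
Proof.
move=> lX lY YX JX nXY.
pose P (W : {vspace A}) := [/\ lideal W, (Y <= W)%VS, (W <= X)%VS & ~~ (X <= W)%VS].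
have [X' [lX' YX' X'X nX] maxX] := max_vspace (P := P) (And4 lY (subvv Y) YX nXY).
have [x xX xX'] := subvPn nX; have [i xi] := ex_hom_notin sd xX'.
exists X', (e i * x); split=> //; split=> //; first exact: lX.
apply: contraNT xi => nX2; have : (\dim (<[e i * x]> + X') <= \dim X')%N.
  apply: maxX; split=> //.
  - move=> a _ /memv_addP[_ /vlineP[c ->] [w wX ->]].
    have [d [r rJ E]] := hom_mul sd a (homP sd i x).
    rewrite mulrDr -scalerAr E scalerDr scalerA -addrA memv_add ?memvZ ?memv_line //.
    by rewrite memvD ?lX' // memvZ // (subvP YX') // JX // lX.
  - by apply: (subv_trans YX'); apply: addvSr.
  - by rewrite subv_add X'X andbT -memvE lX.
move=> d; rewrite memvE; have /eqP -> : X' == (<[e i * x]> + X')%VS.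
  by rewrite eqEdim addvSr.
exact: addvSl.
Qed.

(* The ideals X_i, i <= 3, lie between rad(A e_j) + A (1 - e_j) and
   rad^2(A e_j) + A (1 - e_j). *)
Definition codim3_chain j (X : nat -> {vspace A}) (t : nat -> A) :=
  [/\ forall i, lideal (X i), forall x, (x \in X 3%N) = (x * e j \in J),
      forall x, x * e j \in pw 2 -> x \in X 0%N &
      forall i, (i < 3)%N -> [/\ (X i <= X i.+1)%VS, t i \in X i.+1, t i \notin X i &
        (X i.+1 <= <[t i]> + X i)%VS]].

Lemma codim3 j : ~ top2 j -> exists X t, codim3_chain j X t.
Proof.
move=> nt.
pose B : {vspace A} := (amulr (e j) @^-1: pw 2)%VS.
pose X3 : {vspace A} := (amulr (e j) @^-1: J)%VS.
have memB x : (x \in B) = (x * e j \in pw 2) by rewrite -memv_preim lfunE.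
have memX x : (x \in X3) = (x * e j \in J) by rewrite -memv_preim lfunE.
have lB : lideal B by move=> a x; rewrite !memB -mulrA => /(pw_mull sd).
have lX3 : lideal X3 by move=> a x; rewrite !memX -mulrA => /(sd_mull sd).
have BX3 : (B <= X3)%VS.
  apply/subvP => x; rewrite memB memX => /(pw_sub sd (isT : (1 <= 2)%N)).
  by rewrite (pw1 sd).
have JX3 r x : r \in J -> x \in X3 -> r * x \in B.
  by rewrite memX memB -mulrA => rJ xJ; rewrite -(addn1 1) (mem_pwM sd) ?(pw1 sd).
have top_of u v : u \in X3 -> v \in X3 -> ~ (X3 <= <[u]> + (<[v]> + B))%VS.
  rewrite !memX => uJ vJ sX; apply: nt; exists (u * e j), (v * e j); split=> // x xJ.
  have xX : x \in X3 by rewrite memX (sd_mulr sd).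
  have /line_addE[c /line_addE[d]] := subvP sX _ xX; rewrite memB => cd.
  apply/span2P; exists c, d.
  by rewrite !scalerAl -mulrDl -mulrBl opprD addrA.
have n3 : ~~ (X3 <= B)%VS.
  apply/negP => s; apply: (top_of 0 0); rewrite ?mem0v //.
  by apply: (subv_trans s); rewrite addvA addvSr.
have [X2 [t2 [l2 B2 s2 [t2X t2n X3s]]]] := ideal_step lX3 lB BX3 JX3 n3.
have n2 : ~~ (X2 <= B)%VS.
  apply/negP => s; apply: (top_of t2 0); rewrite ?mem0v //.
  apply: (subv_trans X3s); apply: addvS => //; apply: (subv_trans s); exact: addvSr.
have JX2 r x : r \in J -> x \in X2 -> r * x \in B by move=> rJ /(subvP s2); apply: JX3.
have [X1 [t1 [l1 B1 s1 [t1X t1n X2s]]]] := ideal_step l2 lB B2 JX2 n2.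
have n1 : ~~ (X1 <= B)%VS.
  apply/negP => s; apply: (top_of t2 t1) => //; first exact: (subvP s2).
  apply: (subv_trans X3s); apply: addvS => //; apply: (subv_trans X2s); exact: addvS.
have JX1 r x : r \in J -> x \in X1 -> r * x \in B by move=> rJ /(subvP s1); apply: JX2.
have [X0 [t0 [l0 B0 s0 [t0X t0n X1s]]]] := ideal_step l1 lB B1 JX1 n1.
exists (fun i => nth X3 [:: X0; X1; X2] i), (fun i => nth t2 [:: t0; t1] i); split.
- by case=> [|[|[|i]]] //=; rewrite nth_nil.
- by move=> x /=; rewrite memX.
- by move=> x x2; apply: (subvP B0); rewrite memB.
by case=> [|[|[|i]]].
Qed.

Lemma codim3_le j X t i l : codim3_chain j X t -> (i <= l)%N -> (l <= 3)%N ->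
  (X i <= X l)%VS.
Proof.
move=> [_ _ _ h] il; have -> : l = (i + (l - i))%N by rewrite subnKC.
elim: (l - i)%N => [|m IH]; first by rewrite addn0.
rewrite addnS => lt; apply: subv_trans (IH (ltnW lt)) _.
by have [] := h _ lt.
Qed.

Lemma codim3_facts j X t : codim3_chain j X t ->
  [/\ 1 \notin X 3%N, forall x, x - x * e j \in X 0%N & forall x, x \in pw 2 -> x \in X 0%N].
Proof.
case=> _ X3 X0 _; split.
- rewrite X3 mul1r; exact: (e_notin sd).
- by move=> x; apply: X0; rewrite mulrBl -mulrA (sd_idem sd) subrr mem0v.
by move=> x x2; apply: X0; apply: pw_mulr.
Qed.

Lemma top2_of_free : ~ D4_local_rad3 A -> forall j, top2 j.
Proof.
move=> nD j; apply: contrapT => /codim3[X [t ch]]; apply: nD.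
have [lX X3 X0 h] := ch; have [n1 Xj X2] := codim3_facts ch.
have s03 := subvP (codim3_le (i := 0) (l := 3) ch isT isT).
have n10 : 1 \notin X 0%N by apply: contra n1; apply: s03.
pose M : lmodType A := quo (lX 0%N).
pose pi x : M := quo_pi (lX 0%N) x.
have fgM : fin_gen M := quo_fin_gen (lX 0%N).
have JX r x : r \in J -> x \in X 3%N -> r * x \in X 0%N.
  by rewrite X3 => rJ xJ; apply: X0; rewrite -mulrA -(addn1 1) (mem_pwM sd) ?(pw1 sd).
pose F i := [set q : M | exists2 x, x \in X i & q = pi x].
have sF i : submodule (F i).
  apply/submoduleP; split; first by exists 0; rewrite ?mem0v //; apply/esym/quo_pi0/mem0v.
  move=> a _ _ [x xX ->] [y yX ->]; exists (a * x + y).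
    by rewrite memvD // lX.
  by rewrite quo_piZ quo_piD.
have piE i x : (i <= 3)%N -> F i (pi x) -> x \in X i.
  move=> i3 [y yX /eqP]; rewrite -subr_eq0 quo_piB => /eqP/quo_pi0 xy.
  by rewrite -[x](subrK y) memvD // (subvP (codim3_le ch (leq0n i) i3)).
have Frad : radm [set: M] = F 3%N.
  apply/seteqP; split.
    apply: radm_sub => //; first exact: submoduleT.
    move=> r q rJ _; have [x ->] := quo_pi_surj q; rewrite quo_piZ; exists (r * x) => //.
    by rewrite X3 !(sd_mulr sd).
  move=> _ [x xX ->]; rewrite /pi -(quo_pi_e (lX 0%N) Xj) -[_ * _]mulr1 -quo_piZ.
  by apply: radm_J; [exact: submoduleT|rewrite -X3|].
have [_ t0X t0n _] := h 0%N isT.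
exists M; split=> //; first exact: (quo_local (lX 0%N) Xj n10).
  apply: loewy2 => //.
    move=> r s q rJ sJ; have [x ->] := quo_pi_surj q; rewrite !quo_piZ; apply/quo_pi0.
    by apply: JX; rewrite // X3 !(sd_mulr sd).
  have t03 : t 0%N \in X 3%N by apply: (subvP (codim3_le (i := 1) (l := 3) ch isT isT)).
  exists (t 0%N * e j), (pi 1); split; first by rewrite -X3.
  rewrite quo_piZ mulr1 quo_pi_e // => /quo_pi0; exact/negP.
split; [exact: submodule0|by rewrite Frad|].
exists F; split.
- apply/seteqP; split=> [_ [x xX ->]|_ /= ->]; first exact/quo_pi0.
  by exists 0; rewrite ?mem0v //; apply/esym/quo_pi0/mem0v.
- by rewrite Frad.
move=> i i3; have [sX tX tn sl] := h i i3; apply: (maximal_line (t := pi (t i))) => //.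
- by move=> _ [x xX ->]; exists x => //; apply: (subvP sX).
- by exists (t i).
- by move/(piE _ _ (ltnW i3)); exact/negP.
move=> _ [x xX ->]; have [c cx] := line_addE (subvP sl _ xX); exists c.
by exists (x - c *: t i) => //; rewrite quo_piZ quo_piB mulr_algl.
Qed.
End Modules.

Section Duality.
Variables (k : closedFieldType) (A : falgType k) (n : nat) (e : 'I_n -> A) (J : {vspace A}).
Hypothesis sd : split_data e J.

Let Ac : falgType k := A^c.
Let ec : 'I_n -> Ac := e.
Let Jc : {vspace Ac} := J.
Let sdc : split_data ec Jc := converse_split_data sd.

Lemma cotop2P j : cotop2 e J j <-> top2 ec Jc j.
Proof.
split=> -[x1 [x2 [x1J x2J h]]]; exists x1, x2; split=> // x xJ.
  by rewrite (converse_pw sd); apply: (h x xJ).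
by have := h x xJ; rewrite (converse_pw sd).
Qed.

Lemma dual_fin_gen (Y : {vspace Ac}) (lY : lideal Y) : fin_gen (dual_quo lY).
Proof.
pose V : vectType k := 'Hom(qspace Y, k^o); pose B := vbasis {: V}.
exists (\dim {: V}), (fun i => (B`_i : dual_quo lY)) => f.
exists (fun i => (coord B i (f : V))%:A); rewrite [LHS](coord_vbasis (memvf (f : V))).
apply: eq_bigr => i _; apply: dual_eval_inj => x.
rewrite dual_evalZ mulr_algr /dual_eval scale_lfunE.
by rewrite [in RHS]linearZ [in RHS]linearZ.
Qed.

Lemma cotop2_of_free : ~ D4_colocal_top3 A -> forall j, cotop2 e J j.
Proof.
move=> nD j; apply/cotop2P; apply: contrapT => /(codim3 sdc)[X [t ch]]; apply: nD.
have [lX X3 X0 h] := ch; have [n1 Xj X2] := codim3_facts sdc ch.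
have s03 := subvP (codim3_le (i := 0) (l := 3) ch isT isT).
pose M : lmodType A := dual_quo (lX 0%N).
have fgM : fin_gen M by apply: dual_fin_gen.
pose ev (f : M) (x : A) := dual_eval f x.
have evZ a f x : ev (a *: f) x = ev f (x * a) by apply: dual_evalZ.
have evD f g x : ev (f + g) x = ev f x + ev g x by apply: dual_evalD.
have evB f g x : ev (f - g) x = ev f x - ev g x by apply: dual_evalB.
have evl f c x y : ev f (c *: x + y) = c * ev f x + ev f y by apply: dual_eval_linear.
have ev0 f x : (x : Ac) \in X 0%N -> ev f x = 0 by apply: dual_evalY.
have evinj f g : (forall x, ev f x = ev g x) -> f = g by apply: dual_eval_inj.
have evalg f (c : k) x : ev (c%:A *: f) x = c * ev f x.
  by rewrite evZ mulr_algr -[_ *: x]addr0 evl [ev f 0]ev0 ?mem0v ?addr0.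
have ev00 x : ev 0 x = 0 by rewrite -[X in ev X](scale0r (0 : M)) evZ mulr0 ev0 ?mem0v.
pose F i := [set f : M | forall x, (x : Ac) \in X (3 - i)%N -> ev f x = 0].
have sF i : submodule (F i).
  apply/submoduleP; split=> [x _|a f g Ff Fg x xX]; first exact: ev00.
  rewrite evD evZ Ff ?Fg ?addr0 //; exact: (lX (3 - i)%N (a : Ac) (x : Ac) xX).
have socF : @socle A M = F 0%N.
  apply/seteqP; split=> f.
    move/(socleP sd) => Jf x; rewrite /= subn0 X3 => xJ.
    have := congr1 (fun g => ev g 1) (Jf _ xJ); rewrite ev00 evZ mul1r => <-.
    have xj := Xj (x : Ac); apply/eqP; rewrite -subr_eq0.
    have -> : ev f x - ev f (@GRing.mul Ac x (e j)) = ev f (x - @GRing.mul Ac x (e j)).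
      by rewrite addrC -mulN1r -evl scaleN1r addrC.
    by rewrite ev0.
  move=> Ff; apply/(socleP sd) => r rJ; apply: evinj => x; rewrite evZ ev00.
  by apply: Ff; rewrite /= subn0 X3 (sd_mulr sdc) // (sd_mull sd).
have le i l : (i <= l)%N -> (l <= 3)%N -> (X i <= X l)%VS := codim3_le ch.
have pick i : (i < 3)%N -> exists f : M,
    (forall x, (x : Ac) \in X i -> ev f x = 0) /\ ev f (t i) = 1.
  move=> i3; have [_ _ tn _] := h i i3; apply: dual_eval_ex => //.
  exact: (le 0%N i (leq0n i) (ltnW i3)).
have JJ r s (f : M) : r \in J -> s \in J -> r *: (s *: f) = 0.
  move=> rJ sJ; apply: evinj => x; rewrite !evZ ev00; apply: ev0; apply: X2.
  rewrite (converse_pw_aux sd) -mulrA; apply: (pw_mull sd).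
  by rewrite -(addn1 1) (mem_pwM sd) ?(pw1 sd).
have [f0 [f0X f01]] := dual_eval_ex (lX 0%N) (le 0%N 3%N isT isT) n1.
have evf f x : F 0%N f -> ev f x = ev f 1 * ev f0 x.
  move=> Ff.
  have [c [r rJ E] _] := split_elt sdc j (x : Ac).
  have cX : ((x - c *: 1 : A) : Ac) \in X 3%N.
    rewrite X3 mulrBl E -scalerAl mul1r addrAC subrr add0r; exact: rJ.
  have xE g : F 0%N g -> ev g x = c * ev g 1.
    by move=> Fg; rewrite -[x](subrK (c *: 1)) addrC evl (Fg _ cX) addr0.
  by rewrite !xE // [ev f0 1]f01 mulr1 mulrC.
exists M; split=> //.
- rewrite /colocal_module socF; apply: (simple_line (s := f0)) => //.
    by move=> f00; have := f01; rewrite -/(ev f0 1) f00 ev00 => /eqP; rewrite eq_sym oner_eq0.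
  by move=> f Ff; exists (ev f 1); apply: evinj => x; rewrite evalg evf.
- apply: (loewy2 sd) => //.
  have [_ t0X _ _] := h 0%N isT; have [f [fX ft]] := pick 0%N isT.
  exists (@GRing.mul Ac (t 0%N) (e j)), f; split.
    by have := subvP (le 1%N 3%N isT isT) _ t0X; rewrite X3.
  move=> /(congr1 (fun g => ev g 1)); rewrite ev00 evZ mul1r => E.
  have : ev f (t 0%N - @GRing.mul Ac (t 0%N) (e j)) = 0 by apply: ev0; apply: Xj.
  have -> : t 0%N - @GRing.mul Ac (t 0%N) (e j) = (-1) *: (@GRing.mul Ac (t 0%N) (e j) : A) + t 0%N.
    by rewrite scaleN1r addrC.
  by rewrite evl E mulr0 add0r ft => /eqP; rewrite oner_eq0.
split; [by rewrite socF|exact: submoduleT|].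
exists F; split; first by rewrite socF.
  by apply/seteqP; split=> // f _ x; apply: ev0.
move=> i i3; have i3' : (3 - i.+1 < 3)%N by rewrite ltn_subrL.
have iS : (3 - i)%N = (3 - i.+1).+1 by rewrite subnS prednK // subn_gt0.
have [f [fX ft]] := pick _ i3'; have [sX tX tn sl] := h _ i3'.
rewrite -iS in sX tX sl.
apply: (maximal_line (t := f)) => //.
- by move=> g Fg x /(subvP sX); apply: Fg.
- by move=> Ff; have := ft; rewrite Ff // => /eqP; rewrite eq_sym oner_eq0.
move=> g Fg; exists (ev g (t (3 - i.+1)%N)) => x xX.
have /line_addE[c cx] := subvP sl _ xX; rewrite evB evalg.
have xE f' : (forall y, (y : Ac) \in X (3 - i.+1)%N -> ev f' y = 0) ->
    ev f' x = c * ev f' (t (3 - i.+1)%N).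
  by move=> f'X; rewrite -[RHS]addr0 -(f'X _ cx) -evl addrC subrK.
by rewrite (xE g Fg) (xE f fX) ft mulr1 mulrC subrr.
Qed.

End Duality.

(** * Indecomposable projective modules *)

Section Projectives.
Variables (k : closedFieldType) (A : falgType k) (n : nat) (e : 'I_n -> A) (J : {vspace A}).
Hypothesis sd : split_data e J.

Section Transfer.
Variables (P : lmodType A) (g : {linear P -> A^o}) (j : 'I_n) (p0 : P).
Hypotheses (fgP : fin_gen P) (ginj : injective g) (ge : forall p, (g p : A) * e j = g p)
  (g0 : g p0 = e j).

Definition gset (X : {vspace A}) : set P := [set p | (g p : A) \in X].

Lemma gZ a p : g (a *: p) = a * (g p : A). Proof. exact: linearZ. Qed.

Lemma g_surj (x : A) : x * e j = x -> g (x *: p0) = x.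
Proof. by rewrite gZ g0. Qed.

Lemma gset_submodule X : lideal X -> submodule (gset X).
Proof.
move=> lX; apply/submoduleP; split; first by rewrite /gset /= linear0 mem0v.
by move=> a p q; rewrite /gset /= linearD gZ => pX qX; rewrite memvD // lX.
Qed.

Lemma memPe x : x \in pl J 0 (e j) <-> x * e j = x.
Proof.
split=> [/mem_pl[a _ ->]|<-]; first by rewrite -mulrA (sd_idem sd).
by apply: mem_pl_pw; apply: mem_pw0.
Qed.

Lemma gset_of S : submodule S -> exists X : {vspace A},
  [/\ lideal X, (X <= pl J 0 (e j))%VS & S = gset X].
Proof.
move=> sS; have [|c x y [p Sp ->] [q Sq ->]|X XE] :=
  @vspace_of_set k A (fun x => exists2 p, S p & x = g p).
- by exists 0; [exact: sub0|rewrite linear0].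
- exists (c%:A *: p + q); first by apply: subD => //; apply: subZ.
  by rewrite linearD gZ mulr_algl.
exists X; split.
- move=> a x /XE[p Sp ->]; apply/XE; exists (a *: p); first exact: subZ.
  by rewrite gZ.
- by apply/subvP => x /XE[p Sp ->]; apply/memPe.
apply/seteqP; split=> p; first by move=> Sp; apply/XE; exists p.
by move=> /XE[q Sq /ginj ->].
Qed.

Lemma gset_le X Y : (X <= pl J 0 (e j))%VS -> (gset X `<=` gset Y) <-> (X <= Y)%VS.
Proof.
move=> sX; split=> [h|/subvP h p]; last exact: h.
apply/subvP => x xX; have xe : x * e j = x by apply/memPe/(subvP sX).
by rewrite -(g_surj xe); apply: h; rewrite /gset /= g_surj.
Qed.

Lemma gset_eq X Y : (X <= pl J 0 (e j))%VS -> (Y <= pl J 0 (e j))%VS ->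
  gset X = gset Y -> X = Y.
Proof.
move=> sX sY E; apply/eqP; rewrite eqEsubv; apply/andP; split.
  by apply/gset_le => //; rewrite E.
by apply/gset_le => //; rewrite E.
Qed.

Lemma gset0 : gset 0%VS = [set 0].
Proof.
apply/seteqP; split=> p; rewrite /gset /= memv0.
  by move/eqP => gp; apply: ginj; rewrite linear0.
by move=> ->; rewrite linear0.
Qed.

Lemma gset_uniserial X : (X <= pl J 0 (e j))%VS -> lideal X ->
  uniserial (gset X) <-> unis X.
Proof.
move=> sX lX; split=> [[_ h]|[_ h]]; split=> //.
- move=> L N lL lN LX NX.
  have [||||/gset_le h'|/gset_le h'] := h (gset L) (gset N).
  + exact: gset_submodule.
  + exact: gset_submodule.
  + by apply/gset_le => //; apply: subv_trans sX.
  + by apply/gset_le => //; apply: subv_trans sX.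
  + by left; apply: h'; apply: subv_trans sX.
  by right; apply: h'; apply: subv_trans sX.
- exact: gset_submodule.
move=> S T /gset_of[L [lL Le ->]] /gset_of[N [lN Ne ->]] /gset_le LX /gset_le NX.
by have [LN|NL] := h L N lL lN (LX Le) (NX Ne); [left|right]; apply/gset_le.
Qed.

Lemma gset_rad : radm [set: P] = gset (pl J 1 (e j)).
Proof.
have sT := submoduleT P; apply/seteqP; split.
  apply: (radm_sub sd) => //; first exact/gset_submodule/(pl_lideal sd).
  by move=> r p rJ _; rewrite /gset /= gZ -ge mulrA (mem_pl1 sd) // (sd_mulr sd).
move=> p; rewrite /gset /= => /(pl1P sd)[r rJ gp].
have -> : p = r *: p0 by apply: ginj; rewrite gp gZ g0.
exact: (radm_J sd).
Qed.

Lemma gset_sum U V : (U <= pl J 0 (e j))%VS -> (V <= pl J 0 (e j))%VS ->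
  sum_sub (gset U) (gset V) = gset (U + V)%VS.
Proof.
move=> sU sV; apply/seteqP; split.
  by move=> _ [p pU [q qV <-]]; rewrite /gset /= linearD memv_add.
move=> p; rewrite /gset /= => /memv_addP[u uU [v vV gp]].
have ue : u * e j = u by apply/memPe/(subvP sU).
have ve : v * e j = v by apply/memPe/(subvP sV).
exists (u *: p0); rewrite /gset /= ?g_surj //; exists (v *: p0); rewrite ?g_surj //.
by apply: ginj; rewrite linearD !g_surj.
Qed.

Lemma gset_cap U V : gset U `&` gset V = gset (U :&: V)%VS.
Proof. by apply/seteqP; split=> p; rewrite /gset /= memv_cap => /andP. Qed.

Lemma gset_simple W : (W <= pl J 0 (e j))%VS -> unis W ->
  (gset W = [set 0] \/ simple_sub (gset W)) <-> (\dim W <= 1)%N.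
Proof.
move=> sW uW; have [lW _] := uW; split.
  case=> [|[_ n0 h]].
    by rewrite -gset0 => /gset_eq -> //; rewrite ?dimv0 // sub0v.
  have sJW : (J * W <= W)%VS by apply/prodvP => a x _; apply: lW.
  have sJW0 := subv_trans sJW sW.
  have lJW : lideal (J * W)%VS by apply/prodv_lideal/(sd_mull sd).
  have [] := h (gset (J * W)%VS) (gset_submodule lJW).
  - exact/gset_le.
  - by rewrite -gset0 => /gset_eq E; apply: (dim_thin sd uW); apply: E; rewrite ?sub0v.
  move/gset_eq => /(_ sJW0 sW) E; rewrite (nakayama0 sd (U := W)) ?dimv0 //.
  by rewrite E.
move=> d1; have [W0|W0] := eqVneq W 0%VS; first by left; rewrite W0 gset0.
right; have wW := memv_pick W; set w := vpick W in wW.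
have w0 : w != 0 by rewrite vpick0.
have EW : W = <[w]>%VS.
  by apply/esym/eqP; rewrite eqEdim -memvE wW dim_vline w0.
have we : w * e j = w by apply/memPe/(subvP sW).
apply: (simple_line (s := w *: p0)); first exact: gset_submodule.
- by rewrite /gset /= g_surj.
- by move=> /(congr1 g); rewrite g_surj // linear0 => /eqP; rewrite (negPf w0).
move=> p; rewrite /gset /= EW => /vlineP[c gp]; exists c; apply: ginj.
by rewrite gZ g_surj // mulr_algl.
Qed.

Lemma transfer_biserial :
  (exists U V : set P, [/\ uniserial U, uniserial V, radm [set: P] = sum_sub U V &
     U `&` V = [set 0] \/ simple_sub (U `&` V)]) <-> biserial_at e J j.
Proof.
have s1 : (pl J 1 (e j) <= pl J 0 (e j))%VS by apply: (pl_le sd).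
split.
  case=> U0 [V0 [uU uV rE cE]].
  have [[sU _] [sV _]] := (uU, uV).
  have [U [lU Ue EU]] := gset_of sU; have [V [lV Ve EV]] := gset_of sV.
  rewrite {U0}EU {V0}EV in uU uV rE cE sU sV.
  have uniU := (gset_uniserial Ue lU).1 uU; have uniV := (gset_uniserial Ve lV).1 uV.
  exists U, V; split=> //.
    move: rE; rewrite gset_rad gset_sum // => /gset_eq -> //.
    by rewrite subv_add Ue.
  rewrite gset_cap in cE; apply/gset_simple => //.
    by apply: subv_trans Ue; apply: capvSl.
  by apply: (unis_sub uniU); [apply: capv_lideal|apply: capvSl].
case=> U [V [uniU uniV UV d1]]; have [lU _] := uniU; have [lV _] := uniV.
have Ue : (U <= pl J 0 (e j))%VS by apply: subv_trans s1; rewrite -UV addvSl.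
have Ve : (V <= pl J 0 (e j))%VS by apply: subv_trans s1; rewrite -UV addvSr.
exists (gset U), (gset V); split.
- exact/gset_uniserial.
- exact/gset_uniserial.
- by rewrite gset_rad gset_sum // UV.
rewrite gset_cap; apply/gset_simple => //.
  by apply: subv_trans Ue; apply: capvSl.
by apply: (unis_sub uniU); [apply: capv_lideal|apply: capvSl].
Qed.

End Transfer.

Lemma projective_iso (P : lmodType A) : fin_gen P -> projective P -> indecomposable P ->
  exists j (g : {linear P -> A^o}) p0,
    [/\ injective g, forall p, (g p : A) * e j = g p & g p0 = e j].
Proof.
move=> [m [gen genP]] projP [P0 indP].
pose X : lmodType A := {ffun 'I_m -> A^o}.
pose pi (c : X) : P := \sum_i (c i : A) *: gen i.
have pi_lin : linear pi.
  move=> a c d; rewrite /pi scaler_sumr -big_split; apply: eq_bigr => i _.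
  by rewrite !ffunE scalerDl scalerA.
pose piL : {linear X -> P} := HB.pack pi (GRing.isLinear.Build A X P _ pi pi_lin).
have [y|s sP] := projP X P piL idfun.
  have [c ->] := genP y; exists [ffun i => c i]; rewrite /piL /= /pi.
  by apply: eq_bigr => i _; rewrite ffunE.
have sE x : x = \sum_i (s x i : A) *: gen i by rewrite -[LHS](sP x).
have [x [i xiJ]] : exists x i, (s x i : A) \notin J.
  apply: contrapT => h; apply: P0; apply/seteqP; split=> // x _ /=.
  have sJ y i : (s y i : A) \in J by apply/negPn/negP => h'; apply: h; exists y, i.
  have step l : exists2 c : 'I_m -> A, forall i, c i \in pw J l & x = \sum_i c i *: gen i.
    elim: l => [|l [c cl xE]].
      by exists (fun i => (s x i : A)) => // i; apply: mem_pw0.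
    exists (fun i' => \sum_i c i * (s (gen i) i' : A)).
      by move=> i'; apply: memv_suml => i _; rewrite -(pwSr sd) memv_mul.
    rewrite {1}xE; under eq_bigr do rewrite {1}[gen _]sE scaler_sumr.
    rewrite exchange_big; apply: eq_bigr => i' _; rewrite scaler_suml.
    by apply: eq_bigr => i _; rewrite scalerA.
  have [l l0] := sd_nil sd; have [c c0 ->] := step l.
  by apply: big1 => i _; have := c0 i; rewrite l0 memv0 => /eqP->; rewrite scale0r.
have [j xj] := ex_homr_notin sd xiJ.
pose h (y : P) : A^o := (s y i : A) * e j.
have h_lin : linear h.
  by move=> a y z; rewrite /h linearD linearZ !ffunE /= mulrDl -mulrA.
pose hL : {linear P -> A^o} := HB.pack h (GRing.isLinear.Build A P A^o _ h h_lin).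
have he y : (h y : A) * e j = h y by rewrite /h -mulrA (sd_idem sd).
have hZ a y : h (a *: y) = a * (h y : A) by rewrite -[LHS]/(hL (a *: y)) linearZ.
have [b [t [tJ tj bE]]] := local_gen sd xj (he x).
have [y0 hy0] : exists y0, h y0 = e j.
  pose L : set A^o := [set z | exists y, z = h y].
  have sL : @submodule A (A^o : lmodType A) L.
    apply/submoduleP; split; first by exists 0; rewrite -[RHS]/(hL 0) linear0.
    by move=> a _ _ [y ->] [z ->]; exists (a *: y + z); rewrite h_lin.
  have [|y ->] := @nil_absorb _ _ _ _ _ sd (A^o : lmodType A) L t (e j : A^o) sL tJ;
    last by exists y.
  by exists (b *: x); rewrite hZ [RHS]bE /GRing.scale /= tj.
pose p0 := e j *: y0.
have jp0 : e j *: p0 = p0 by rewrite scalerA (sd_idem sd).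
have hp0 : h p0 = e j by rewrite hZ hy0 (sd_idem sd).
exists j, hL, p0; split=> //.
pose U := [set y : P | h y = 0]; pose V := [set y : P | exists a, y = a *: p0].
have sU : submodule U.
  apply/submoduleP; split; first by rewrite /U /= -[LHS]/(hL 0) linear0.
  by move=> a y z; rewrite /U /= => hy hz; rewrite h_lin hy hz scaler0 addr0.
have sV : submodule V by apply: submodule_cyclic.
have UV : sum_sub U V = [set: P].
  apply/seteqP; split=> // y _; exists (y - (h y : A) *: p0).
    rewrite /U /= -[LHS]/(hL (y - (h y : A) *: p0)) linearB.
    by rewrite -[hL (_ *: _)]/(h _) hZ hp0 he subrr.
  by exists ((h y : A) *: p0); [exists (h y : A)|rewrite subrK].
have cUV : U `&` V = [set 0].
  apply/seteqP; split=> [y [hy [a yE]]|_ ->]; last by split; apply: sub0.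
  move: hy; rewrite /U /= yE hZ hp0 => ae.
  by rewrite -jp0 scalerA ae scale0r.
have [U0|V0] := indP U V sU sV UV cUV; last first.
  have : V p0 by exists 1; rewrite scale1r.
  rewrite V0 => /= p00; have := hp0; rewrite p00 -[LHS]/(hL 0) linear0 => /esym/eqP.
  by rewrite (negPf (sd_neq0 sd j)).
move=> y z yz; apply/eqP; rewrite -subr_eq0; apply/eqP.
have : U (y - z) by rewrite /U /= -[LHS]/(hL (y - z)) linearB yz subrr.
by rewrite U0.
Qed.

End Projectives.

Section FixedIdeal.
Variables (R : nzRingType) (f : R).

Definition fixed_pred : {pred R^o} := [pred x : R | x * f == x].

Fact fixed_submod_closed : submod_closed fixed_pred.
Proof.
split; first by rewrite inE mul0r.
move=> a x y; rewrite !inE => /eqP xf /eqP yf.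
by rewrite /GRing.scale /= mulrDl -mulrA xf yf.
Qed.

HB.instance Definition _ :=
  GRing.isSubmodClosed.Build R R^o fixed_pred fixed_submod_closed.

Record fixed_ideal := FixedIdeal {
  fixed_val : R^o; fixed_valP : fixed_val \in fixed_pred }.

HB.instance Definition _ := [isSub for fixed_val].
HB.instance Definition _ := [Choice of fixed_ideal by <:].
HB.instance Definition _ := [SubChoice_isSubLmodule of fixed_ideal by <:].

Lemma fixed_valE (x : fixed_ideal) : (fixed_val x : R) * f = fixed_val x.
Proof. exact/eqP/fixed_valP. Qed.

Lemma fixed_val_linear : linear fixed_val.
Proof. exact: (linearP (\val : fixed_ideal -> R^o)). Qed.

Hypothesis ff : f * f = f.

Fact fixed_gen_subproof : (f : R^o) \in fixed_pred.
Proof. by rewrite inE ff. Qed.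
Definition fixed_gen := FixedIdeal fixed_gen_subproof.

Lemma fixed_genE (x : fixed_ideal) : (fixed_val x : R) *: fixed_gen = x.
Proof. by apply: val_inj; rewrite linearZ; apply: fixed_valE. Qed.

Lemma fixed_fin_gen : fin_gen (fixed_ideal : lmodType R).
Proof.
exists 1%N, (fun=> fixed_gen) => x; exists (fun=> fixed_val x : R).
by rewrite big_ord1 fixed_genE.
Qed.

Lemma fixed_projective : projective (fixed_ideal : lmodType R).
Proof.
move=> X Y p h surj; have [x0 px0] := surj (h fixed_gen).
pose g (a : fixed_ideal) : X := (fixed_val a : R) *: x0.
have g_lin : linear g by move=> a x y; rewrite /g fixed_val_linear scalerDl scalerA.
pose gL : {linear fixed_ideal -> X} :=
  HB.pack g (GRing.isLinear.Build R fixed_ideal X _ g g_lin).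
by exists gL => a; rewrite /= /g linearZ px0 -linearZ fixed_genE.
Qed.

End FixedIdeal.

Section BiserialProjectives.
Variables (k : closedFieldType) (A : falgType k) (n : nat) (e : 'I_n -> A) (J : {vspace A}).
Hypothesis sd : split_data e J.

Lemma fixed_indecomposable j : indecomposable (fixed_ideal (e j) : lmodType A).
Proof.
pose P : lmodType A := fixed_ideal (e j); pose p0 : P := fixed_gen (sd_idem sd j).
have p00 : p0 <> 0.
  by move/(congr1 (@fixed_val _ _)) => /= /eqP; rewrite (negPf (sd_neq0 sd j)).
have full (S : set P) : submodule S -> S p0 -> S = [set: P].
  move=> sS Sp0; apply/seteqP; split=> // x _; rewrite -[x](fixed_genE (sd_idem sd j)).
  exact: subZ.
split; first by move=> E; apply: p00; have : [set: P] p0 by []; rewrite E.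
move=> U V sU sV UV cUV.
have other (S T : set P) : S `&` T = [set 0] -> submodule T -> S = [set: P] -> T = [set 0].
  by move=> ST sT ES; rewrite -ST ES setTI.
have : sum_sub U V p0 by rewrite UV.
case=> u Uu [v Vv uv].
have jp0 : e j *: p0 = p0 by apply: val_inj; rewrite linearZ; apply: (sd_idem sd).
have [uJ|uJ] := boolP ((fixed_val u : A) \in J).
  left; apply: (other V U) => //; first by rewrite setIC.
  apply: full => //; apply: (nil_absorb sd sV uJ).
  by rewrite (fixed_genE (sd_idem sd j)) -uv addrAC subrr add0r.
right; apply: (other U V) => //; apply: full => //.
apply: (sub_full sd sU jp0 uJ (fixed_valE u)).
by rewrite (fixed_genE (sd_idem sd j)).
Qed.

Lemma biserial_projectivesP : biserial_projectives A <-> forall j, biserial_at e J j.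
Proof.
split=> [bis j|bis P fgP projP indP]; last first.
  have [j [g [p0 [ginj ge g0]]]] := projective_iso sd fgP projP indP.
  by apply/(transfer_biserial sd fgP ginj ge g0).
pose P : lmodType A := fixed_ideal (e j); have ff := sd_idem sd j.
pose g (x : P) : A^o := fixed_val x.
have g_lin : linear g by exact: fixed_val_linear.
pose gL : {linear P -> A^o} := HB.pack g (GRing.isLinear.Build A P A^o _ g g_lin).
have fgP : fin_gen P := fixed_fin_gen ff.
have ginj : injective gL by move=> x y; apply: val_inj.
have ge p : (gL p : A) * e j = gL p by apply: fixed_valE.
apply/(@transfer_biserial _ _ _ _ _ sd P gL j (fixed_gen ff) fgP ginj ge erefl).
exact: bis fgP (fixed_projective ff) (@fixed_indecomposable j).
Qed.

End BiserialProjectives.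

(** * The radical of a basic algebra *)

Section Structure.
Variables (k : closedFieldType) (A : falgType k).
Implicit Types (a b f u v w x y z : A).

Definition nilp x := exists m, x ^+ m = 0.

Lemma nilp_mulC x y : nilp (x * y) -> nilp (y * x).
Proof.
case=> m xy; exists m.+1; suff E l : (y * x) ^+ l.+1 = y * (x * y) ^+ l * x.
  by rewrite E xy mulr0 mul0r.
elim: l => [|l IH]; first by rewrite expr1 expr0 mulr1.
by rewrite exprSr IH [in RHS]exprSr -!mulrA.
Qed.

Lemma nilp_inv x : nilp x -> exists y, (1 - x) * y = 1 /\ y * (1 - x) = 1.
Proof.
case=> m x0; have E : (1 - x) * (\sum_(i < m) x ^+ i) = 1.
  by have := subrX1 x m; rewrite x0 sub0r -opprB mulNr => /oppr_inj.
exists (\sum_(i < m) x ^+ i); split=> //; rewrite -[RHS]E mulr_suml mulr_sumr.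
by apply: eq_bigr => i _; rewrite mulrBl mulrBr mul1r mulr1 -exprS -exprSr.
Qed.

Section Corner.
Variable f : A.
Hypothesis pf : primitive_idempotent f.
Let f0 : f <> 0. Proof. by case: pf. Qed.
Let ff : f * f = f. Proof. by case: pf. Qed.

Lemma poly_annihilator x : exists2 p : {poly k}, p != 0 & horner_alg x p = 0.
Proof.
pose d := \dim {: A}; pose X := [tuple x ^+ i | i < d.+1].
have nf : ~~ free X.
  by rewrite /free size_tuple neq_ltn ltnS dimvS ?subvf.
have [c c0 [i ci]] : exists2 c : 'I_d.+1 -> k, \sum_i c i *: X`_i = 0 & exists i, c i != 0.
  apply: contrapT => h; case/negP: nf; apply/freeP => c c0 i.
  by apply/eqP/negPn/negP => ci; apply: h; exists c => //; exists i.
exists (\poly_(l < d.+1) c (inord l)).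
  apply/eqP => /(congr1 (fun p : {poly k} => p`_i)); rewrite coef_poly ltn_ord inord_val coef0.
  by move/eqP; rewrite (negPf ci).
rewrite poly_def linear_sum /= -[RHS]c0; apply: eq_bigr => l _.
rewrite linearZ /= inord_val rmorphXn /= horner_algX mulr_algl; congr (_ *: _).
by rewrite -[RHS](tnth_nth 0 X) tnth_mktuple.
Qed.

Lemma corner_eigenvalue x : f * x = x -> x * f = x ->
  exists c : k, nilp (x - c *: f).
Proof.
move=> fx xf; pose H := horner_alg x.
have comm p : f * H p = H p * f.
  elim/poly_ind: p => [|p c IH]; first by rewrite /H rmorph0 mulr0 mul0r.
  rewrite /H rmorphD rmorphM /= horner_algX horner_algC mulrDr mulrDl mulrA [f * _]IH.
  by rewrite -[H p * f * x]mulrA fx -[_ * x * f]mulrA xf mulr_algr mulr_algl.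
pose ev p := H p * f.
have evM p q : ev (p * q) = ev p * ev q.
  by rewrite /ev {1}/H rmorphM /= -/H [RHS]mulrA -[H p * f * H q]mulrA comm -!mulrA ff.
have evD p q : ev (p + q) = ev p + ev q by rewrite /ev /H rmorphD mulrDl.
have ev1 : ev 1 = f by rewrite /ev /H rmorph1 mul1r.
have [p0 p00 Hp0] := poly_annihilator x.
have : ev p0 = 0 by rewrite /ev /H Hp0 mul0r.
have [m] := ubnP (size p0); elim: m p0 p00 {Hp0} => // m IH p p0 sp evp.
have [/size_poly1P[c c0 pE]|/closed_rootP[c rc]] := boolP (size p == 1%N).
  case: f0; have := evp; rewrite pE /ev /H horner_algC mulr_algl => cf.
  by rewrite -[f](scalerK c0) cf scaler0.
have [l [q]] := multiplicity_XsubC p c; rewrite p0 /= => rq pE.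
have l0 : (0 < l)%N.
  by rewrite lt0n; apply/eqP => l0; move: rc rq; rewrite pE l0 expr0 mulr1 => ->.
set r := ('X - c%:P) ^+ l in pE.
have cqr : coprimep q r by apply: coprimep_expr; rewrite coprimep_XsubC.
have /Bezout_eq1_coprimepP[[s t] /= st] := cqr.
have evE : ev (s * q) + ev (t * r) = f by rewrite -evD st ev1.
have ev0 (u v : {poly k}) : ev (u * q * (v * r)) = 0.
  have -> : u * q * (v * r) = u * v * p by rewrite pE mulrACA.
  by rewrite evM evp mulr0.
have gh : ev (s * q) * ev (t * r) = 0 by rewrite -evM ev0.
have hg : ev (t * r) * ev (s * q) = 0 by rewrite -evM [t * r * _]mulrC ev0.
have fr p' : ev p' * f = ev p' by rewrite /ev -mulrA ff.
have gg : ev (s * q) * ev (s * q) = ev (s * q).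
  by have := fr (s * q); rewrite -{1}evE mulrDr gh addr0.
have hh : ev (t * r) * ev (t * r) = ev (t * r).
  by have := fr (t * r); rewrite -{1}evE mulrDr hg add0r.
have [_ _ prim] := pf.
have [g0|h0] := prim _ _ gg hh gh hg (esym evE).
  apply: (IH q).
  - by apply: contraNneq p0 => q0; rewrite pE q0 mul0r.
  - have q0 : q != 0 by apply: contraNneq p0 => q0; rewrite pE q0 mul0r.
    rewrite pE size_Mmonic ?monic_exp ?monicXsubC // size_exp_XsubC in sp.
    by rewrite -ltnS; apply: leq_trans sp; rewrite addnS /= -{1}[size q]addn0 ltnS ltn_add2l.
  rewrite -fr -evE g0 add0r -evM.
  by rewrite -[q]mul1r ev0.
exists c, l.+1.
have yE : x - c *: f = ev ('X - c%:P).
  by rewrite /ev /H rmorphB /= horner_algX horner_algC mulrBl xf mulr_algl.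
have yX i : ev (('X - c%:P) ^+ i) = (x - c *: f) ^+ i * f.
  elim: i => [|i IHi]; first by rewrite !expr0 ev1 mul1r.
  by rewrite !exprS evM IHi -yE mulrA.
have yf : f * (x - c *: f) = x - c *: f by rewrite mulrBr fx -scalerAr ff.
have r0 : ev r = 0 by rewrite -fr -evE h0 addr0 -evM mulrC -[r]mul1r ev0.
by rewrite exprSr -{2}yf mulrA -yX -/r r0 mul0r.
Qed.

Definition in_corner x := f * x = x /\ x * f = x.

Lemma in_cornerM x y : in_corner x -> in_corner y -> in_corner (x * y).
Proof. by move=> [fx _] [_ yf]; split; rewrite ?mulrA ?fx // -mulrA yf. Qed.

Lemma in_cornerI x : in_corner (f * x * f).
Proof. by split; rewrite ?mulrA ?ff // -mulrA ff. Qed.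

Lemma corner_nilp_or_inv x : in_corner x ->
  nilp x \/ exists w, [/\ in_corner w, x * w = f & w * x = f].
Proof.
move=> [fx xf]; have [c cn] := corner_eigenvalue fx xf.
have [c0|c0] := eqVneq c 0; first by left; rewrite c0 scale0r subr0 in cn.
right; set y := x - c *: f in cn.
have yn : nilp (- c^-1 *: y) by have [m y0] := cn; exists m; rewrite exprZn y0 scaler0.
have [v [v1 v2]] := nilp_inv yn.
have xE : x = c *: (f * (1 - (- c^-1 *: y))).
  rewrite mulrBr mulr1 -scalerAr scaleNr opprK scalerDr scalerA mulfV // scale1r.
  by rewrite /y mulrBr fx -scalerAr ff addrC subrK.
have yf : y * f = f * y by rewrite /y mulrBr mulrBl fx xf -scalerAr -scalerAl.
have xE' : x = c *: ((1 - (- c^-1 *: y)) * f).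
  by rewrite {1}xE; congr (_ *: _); rewrite mulrBr mulrBl mulr1 mul1r -scalerAr -scalerAl yf.
exists (f * (c^-1 *: v) * f); split; first exact: in_cornerI.
  rewrite !mulrA xf {1}xE -scalerAl -scalerAr scalerA mulfV // scale1r.
  by rewrite -[f * _ * v]mulrA v1 mulr1 ff.
rewrite -!mulrA fx {1}xE' -scalerAl -!scalerAr scalerA mulVf // scale1r.
by rewrite [v * _]mulrA v2 mul1r ff.
Qed.

Lemma nilp_no_inv x w : in_corner x -> nilp x -> x * w <> f.
Proof.
move=> [fx xf] [m x0] xw; apply: f0.
have E l : f = x ^+ l * (f * w ^+ l) .
  elim: l => [|l IH]; first by rewrite !expr0 mul1r mulr1.
  have -> : x ^+ l.+1 * (f * w ^+ l.+1) = x ^+ l * (x * f * w * w ^+ l).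
    by rewrite exprSr exprS !mulrA.
  by rewrite xf xw.
by rewrite (E m) x0 mul0r.
Qed.

Lemma nilp_corner_mul x y : in_corner x -> in_corner y -> nilp x -> nilp (x * y).
Proof.
move=> cx cy nx; have [//|[w [cw xyw _]]] := corner_nilp_or_inv (in_cornerM cx cy).
by case: (@nilp_no_inv x (y * w) cx nx); rewrite mulrA.
Qed.

Lemma nilp_corner_add x y : in_corner x -> in_corner y -> nilp x -> nilp y -> nilp (x + y).
Proof.
move=> cx cy nx ny; have cxy : in_corner (x + y).
  by have [fx xf] := cx; have [fy yf] := cy; split; rewrite ?mulrDr ?mulrDl ?fx ?fy ?xf ?yf.
have [//|[w [cw xyw _]]] := corner_nilp_or_inv cxy.
have [v [v1 _]] := nilp_inv (nilp_corner_mul cy cw ny).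
case: (@nilp_no_inv x (w * (f * v * f)) cx nx); have [fw wf] := cw; have [_ yf] := cy.
have xwE : x * w = f - y * w by rewrite -xyw mulrDl addrK.
have fyw : f * (y * w) = y * w by have [fy _] := cy; rewrite mulrA fy.
have -> : x * (w * (f * v * f)) = f * ((1 - y * w) * v) * f.
  have -> : f * ((1 - y * w) * v) * f = (f - y * w) * v * f.
    by rewrite [f * (_ * v)]mulrA mulrBr mulr1 fyw.
  by rewrite -xwE !mulrA -[x * w * f]mulrA wf.
by rewrite v1 mulr1 ff.
Qed.

Lemma nilp_corner_sum (I : finType) (F : I -> A) :
  (forall i, in_corner (F i)) -> (forall i, nilp (F i)) -> nilp (\sum_i F i).
Proof.
move=> cF nF; suff [] : in_corner (\sum_i F i) /\ nilp (\sum_i F i) by [].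
elim/big_rec: _ => [|i x _ [cx nx]].
  by split; [split; rewrite ?mulr0 ?mul0r|exists 1%N].
split; last exact: nilp_corner_add.
have [fF Ff] := cF i; have [fx xf] := cx.
by split; rewrite ?mulrDr ?mulrDl ?fF ?fx ?Ff ?xf.
Qed.

End Corner.

Variables (n : nat) (e : 'I_n -> A).
Hypothesis he : complete_primitive_orthogonal e.
Hypothesis hb : basic e.

Let prim i : primitive_idempotent (e i). Proof. by case: he. Qed.
Let idem i : e i * e i = e i. Proof. by case: (prim i). Qed.
Let orth i j : i != j -> e i * e j = 0.
Proof. by move=> ij; case: he => _ + _; apply; apply/eqP. Qed.
Let esum : \sum_i e i = 1. Proof. by case: he. Qed.

(* If e_i a e_j b e_i were invertible in e_i A e_i, right multiplication by
   e_i a e_j would be an isomorphism from A e_i to A e_j. *)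
Lemma nilp_off_diagonal i j a b : i != j -> nilp (e i * a * e j * b * e i).
Proof.
move=> ij; set x := _ * e i.
have cx : in_corner (e i) x by split; rewrite /x ?mulrA ?idem // -!mulrA idem.
have [//|[w [[iw wi] xw _]]] := corner_nilp_or_inv (prim i) cx.
pose p := e i * a * e j; pose q := e j * b * e i * w.
have pq : p * q = e i.
  have -> : p * q = x * w by rewrite /p /q /x !mulrA -[_ * e j * e j]mulrA idem.
  exact: xw.
have ip : e i * p = p by rewrite /p !mulrA idem.
have pj : p * e j = p by rewrite /p -!mulrA idem.
have jq : e j * q = q by rewrite /q !mulrA idem.
have qi : q * e i = q by rewrite /q -!mulrA wi.
clearbody p q.
have g0 : q * p <> 0.
  move=> qp; have [f0 _ _] := prim i; apply: f0.
  by rewrite -(idem i) -{1}pq -{1}pq -mulrA [q * _]mulrA qp mul0r mulr0.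
have gg : (q * p) * (q * p) = q * p by rewrite -mulrA [p * _]mulrA pq mulrA qi.
have jg : e j * (q * p) = q * p by rewrite mulrA jq.
have gj : (q * p) * e j = q * p by rewrite -mulrA pj.
have [_ _ primj] := prim j.
have qpj : q * p = e j.
  have [|||||//|/eqP] := primj (q * p) (e j - q * p).
  - exact: gg.
  - by rewrite mulrBr !mulrBl idem jg gj gg subrr subr0.
  - by rewrite mulrBr gj gg subrr.
  - by rewrite mulrBl jg gg subrr.
  - by rewrite addrC subrK.
  by rewrite subr_eq0 => /eqP.
case: (hb (elimN eqP ij)); exists (fun y : A => y * p); split; last first.
  by move=> c y z _ _; exact: (etrans (mulrDl _ _ _) (congr1 (+%R^~ _) (esym (mulrA _ _ _)))).
split.
- by move=> _ [y _ <-]; exists (y * p) => //; rewrite -!mulrA ip pj.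
- move=> y z /set_mem[y' _ <-] /set_mem[z' _ <-] /= E.
  have := congr1 (fun t => t * q) E; rewrite /= -!mulrA -![p * (q)]/(p * q).
  by rewrite !pq !idem.
move=> _ [y _ <-]; exists (y * q); first by exists (y * q) => //; rewrite -mulrA qi.
by rewrite -mulrA qpj.
Qed.

Lemma basic_split_data : exists J : {vspace A}, split_data e J.
Proof.
pose S x := forall i, nilp (e i * x * e i).
have cor i x : in_corner (e i) (e i * x * e i) by apply: in_cornerI.
have n0 : nilp 0 by exists 1%N.
have SM i a x : S x -> nilp (e i * (a * x) * e i).
  move=> Sx; have -> : e i * (a * x) * e i = \sum_l e i * (a * e l * x) * e i.
    by rewrite -mulr_suml -mulr_sumr -mulr_suml -mulr_sumr esum mulr1.
  apply: (nilp_corner_sum (prim i)) => l; first exact: cor.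
  have [<-|il] := eqVneq i l; last by rewrite !mulrA; apply: nilp_off_diagonal.
  have -> : e i * (a * e i * x) * e i = (e i * a * e i) * (e i * x * e i).
    by rewrite -!mulrA [e i * (e i * _)]mulrA idem.
  have := Sx i => nx; apply: nilp_mulC.
  exact: (nilp_corner_mul (prim i)).
have SMr i x a : S x -> nilp (e i * (x * a) * e i).
  move=> Sx; have -> : e i * (x * a) * e i = \sum_l e i * (x * e l * a) * e i.
    by rewrite -mulr_suml -mulr_sumr -mulr_suml -mulr_sumr esum mulr1.
  apply: (nilp_corner_sum (prim i)) => l; first exact: cor.
  have [<-|il] := eqVneq i l; last by rewrite !mulrA; apply: nilp_off_diagonal.
  have -> : e i * (x * e i * a) * e i = (e i * x * e i) * (e i * a * e i).
    by rewrite -!mulrA [e i * (e i * _)]mulrA idem.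
  exact: (nilp_corner_mul (prim i)).
have [||J JE] := @vspace_of_set k A S.
- by move=> i; rewrite mulr0 mul0r.
- move=> c x y Sx Sy i; rewrite mulrDr mulrDl; apply: (nilp_corner_add (prim i) _ _ _ (Sy i)).
  + exact: cor.
  + exact: cor.
  have [m x0] := Sx i; exists m.
  by rewrite -scalerAr -scalerAl exprZn x0 scaler0.
exists J.
have Jl a x : x \in J -> a * x \in J by move/JE => Sx; apply/JE => i; apply: SM.
have Jr x a : x \in J -> x * a \in J by move/JE => Sx; apply/JE => i; apply: SMr.
have lJ U : lideal U -> lideal (J * U)%VS by move=> _; apply: prodv_lideal.
(* For L maximal among the left ideals properly inside I, J I <= L: if r w is
   not in L, then w = t w modulo L for a nilpotent t in e_i A e_i. *)
have unstable I : lideal I -> (I <= J * I)%VS -> I = 0%VS.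
  move=> lI sI; apply/eqP/negPn/negP => I0.
  pose P (L : {vspace A}) := [/\ lideal L, (L <= I)%VS & ~~ (I <= L)%VS].
  have P0 : P 0%VS.
    split; [|exact: sub0v|by rewrite subv0].
    by move=> a x; rewrite !memv0 => /eqP ->; rewrite mulr0.
  have [L [lL sL nL] maxL] := max_vspace P0.
  have up z : z \in I -> z \notin L -> (I <= L + fullv * <[z]>)%VS.
    move=> zI zL; apply/negPn/negP => nI.
    have lz : lideal (fullv * <[z]>)%VS by apply: prodv_lideal => a x _; apply: memvf.
    have zz : z \in (fullv * <[z]>)%VS.
      by rewrite -[z in z \in _]mul1r memv_mul ?memvf ?memv_line.
    have sz : (fullv * <[z]> <= I)%VS.
      by apply/prodvP => a _ _ /vlineP[c ->]; rewrite -scalerAr memvZ // lI.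
    have d : (\dim (L + fullv * <[z]>) <= \dim L)%N.
      by apply: maxL; split; rewrite ?subv_add ?sL //; apply: addv_lideal.
    have /eqP E : L == (L + fullv * <[z]>)%VS by rewrite eqEdim addvSl.
    by case/negP: zL; rewrite E (subvP (addvSr _ _)).
  have [x xI xL] := subvPn nL.
  have [i iL] : exists i, e i * x \notin L.
    apply/existsP; apply: contraR xL; rewrite negb_exists => /forallP h.
    rewrite -[x]mul1r -esum mulr_suml memv_suml // => l _.
    by have := h l; rewrite negbK.
  set w := e i * x in iL; have wI : w \in I by apply: lI.
  have iw : e i * w = w by rewrite mulrA idem.
  clearbody w.
  have Jw r : r \in J -> r * w \in L.
    move=> rJ; apply/negPn/negP => rwL.
    have [l lrw] : exists l, e l * (r * w) \notin L.
      apply/existsP; apply: contraR rwL; rewrite negb_exists => /forallP h.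
      rewrite -[r * w]mul1r -esum mulr_suml memv_suml // => l _.
      by have := h l; rewrite negbK.
    have /memv_addP[y yL [_ /memv_cosetP[b _ ->] wE]] :=
      subvP (up _ (lI _ _ (lI _ _ wI)) lrw) _ wI.
    pose t := e i * (b * e l * r) * e i.
    have tn : nilp t by have /JE/(_ i) : b * e l * r \in J by apply: Jl.
    have twL : w - t * w \in L.
      have yE := canRL (addrK _) (esym wE).
      have -> : w - t * w = e i * y by rewrite yE mulrBr iw /t -!mulrA iw.
      exact: lL.
    clearbody t; have [m t0] := tn; case/negP: iL; rewrite -[w]subr0 -[X in _ - X](mul0r w) -t0.
    elim: {t0} m => [|m IH]; first by rewrite expr0 mul1r subrr mem0v.
    have -> : w - t ^+ m.+1 * w = (w - t ^+ m * w) + t ^+ m * (w - t * w).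
      by rewrite exprSr mulrBr mulrA addrA subrK.
    by rewrite memvD // lL.
  case/negP: nL; apply: (subv_trans sI); apply/prodvP => r y rJ yI.
  have /memv_addP[l lL' [_ /memv_cosetP[b _ ->] ->]] := subvP (up _ wI iL) _ yI.
  rewrite mulrDr; apply: memvD; first exact: lL.
  by rewrite mulrA; apply/Jw/Jr.
have pwl m : lideal (pw J m).
  by case: m => [|m] a x; [rewrite !mem_pw0|rewrite pwS; apply: prodv_lideal].
split.
- by move=> i; case: (prim i) => /eqP.
- exact: idem.
- exact: orth.
- exact: esum.
- exact: Jl.
- exact: Jr.
- have step m : pw J m = 0%VS \/ (\dim (pw J m) + m <= \dim {: A})%N.
    elim: m => [|m [IH|IH]]; first by right; rewrite addn0 dimvS ?subvf.
      by left; rewrite pwS IH prodv0.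
    have sm : (pw J m.+1 <= pw J m)%VS by rewrite pwS; apply/prodvP => a x _; apply: pwl.
    have [s|ns] := boolP (pw J m <= pw J m.+1)%VS.
      by left; rewrite pwS (unstable _ (pwl m) s) prodv0.
    right; rewrite addnS; apply: leq_trans IH; rewrite -addSn leq_add2r.
    exact: dim_lt.
  exists (\dim {: A}).+1; case: (step (\dim {: A}).+1) => //.
  by rewrite addnS ltnNge leq_addl.
- move=> i a; have [ci ic] := cor i a.
  have [c cn] := corner_eigenvalue (prim i) ci ic; exists c; apply/JE => l.
  have [->|li] := eqVneq l i.
    by rewrite mulrBr mulrBl ci ic -scalerAr -scalerAl !idem.
  by rewrite mulrBr -scalerAr !mulrA orth // !mul0r scaler0 subr0 mul0r.
move=> i j a ij; apply/JE => l; have [li|li] := eqVneq l i.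
  by rewrite li -!mulrA orth ?mulr0 // eq_sym.
by rewrite !mulrA orth // !mul0r.
Qed.

End Structure.

(** * The main theorem *)

Lemma left_gen_uniserial (k : fieldType) (A : falgType k) n (e : 'I_n -> A) (J : {vspace A}) :
  left_gen e J -> uniserial_gen e J.
Proof.
by move=> h i j N a sN ca aN; have [a' [? ? ? _]] := h i j N a sN ca aN; exists a'.
Qed.

Section RightModules.
Variables (k : closedFieldType) (A : falgType k) (n : nat) (e : 'I_n -> A) (J : {vspace A}).
Hypothesis sd : split_data e J.

Let Ac : falgType k := A^c.
Let ec : 'I_n -> Ac := e.
Let Jc : {vspace Ac} := J.
Let sdc : split_data ec Jc := converse_split_data sd.

Lemma converse_radA (x : A) : radA (x : Ac) <-> radA x.
Proof. by split=> [/(radAP sdc)|/(radAP sd)] h; [apply/(radAP sd)|apply/(radAP sdc)]. Qed.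

Lemma converse_rad2A (x : A) : rad2A (x : Ac) <-> rad2A x.
Proof.
split=> [/(rad2AP sdc)|/(rad2AP sd)] h; [apply/(rad2AP sd)|apply/(rad2AP sdc)].
  by rewrite -(converse_pw_aux sd).
by rewrite (converse_pw_aux sd).
Qed.

Lemma converse_corner_rad i j (a : A) :
  corner_rad (ec i) (ec j) (a : Ac) <-> corner_rad (e j) (e i) a.
Proof.
split=> [/(corner_radP sdc)|/(corner_radP sd)] h.
  exact/(corner_radP sd)/converse_corner.
exact/(corner_radP sdc)/converse_corner.
Qed.

Lemma converse_indep_classes (a2 a3 b2 b3 : A) :
  indep_classes (a2 : Ac) (a3 : Ac) (b2 : Ac) (b3 : Ac) <-> indep_classes a2 a3 b2 b3.
Proof.
split=> [/(indep_classesP sdc)|/(indep_classesP sd)] h.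
  by apply/(indep_classesP sd); rewrite -(converse_pw sd).
by apply/(indep_classesP sdc); rewrite (converse_pw sd).
Qed.

Lemma ract_mul (M : lmodType A^c) (b : M) (x y : A) :
  ract b (x * y) = @GRing.scale Ac M (@GRing.mul Ac y x) b.
Proof. by rewrite converse_mul. Qed.

Lemma lin_indep2r_converse (M : lmodType A^c) (x y : M) :
  lin_indep2r x y = @lin_indep2 k Ac M x y.
Proof. by []. Qed.

Lemma D4_rightP : D4_right e <-> D4_left ec.
Proof.
split=> -[M [fgM [locM [i [j [a1 [a2 [a3 [b0 [[c1 r2 r3] [ind J2 ns]]]]]]]]]]].
  exists M; split; [exact: fgM|split; [exact: locM|]]; exists i, j, a1, a2, a3, b0; split.
    by split; [apply/converse_corner_rad|apply/converse_radA|apply/converse_radA].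
  split.
  - by rewrite lin_indep2r_converse !ract_mul in ind.
  - by move=> r /converse_rad2A /J2; rewrite ract_mul.
  case=> a [a' [b [b' [[ca ca' rb rb'] [ic aa ba ba']]]]].
  apply: ns; exists a, a', b, b'; split; last first.
    split; [by apply/converse_indep_classes|exact: aa| |]; rewrite ract_mul.
      exact: ba.
    exact: ba'.
  split; [exact/converse_corner_rad|exact/converse_corner_rad|exact/converse_radA|
    exact/converse_radA].
exists M; split; [exact: fgM|split; [exact: locM|]]; exists i, j, a1, a2, a3, b0; split.
  by split; [apply/converse_corner_rad|apply/converse_radA|apply/converse_radA].
split.
- by rewrite lin_indep2r_converse !ract_mul.
- by move=> r /converse_rad2A /J2 h; rewrite ract_mul.
case=> a [a' [b [b' [[ca ca' rb rb'] [ic aa ba ba']]]]].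
rewrite !ract_mul in ba ba'; apply: ns; exists a, a', b, b'; split; last first.
  by split; [apply/converse_indep_classes|exact: aa|exact: ba|exact: ba'].
split; [exact/converse_corner_rad|exact/converse_corner_rad|exact/converse_radA|
    exact/converse_radA].
Qed.

Lemma biserial_D4_free : biserial A -> D4_free e.
Proof.
case=> /(biserial_projectivesP sd) bl /(biserial_projectivesP sdc) br.
have tl j := top2_of_biserial sd (bl j); have tr j := top2_of_biserial sdc (br j).
split.
- exact: (not_D4_local_rad3 sd tl).
- by apply: (not_D4_colocal_top3 sd) => j; apply/(cotop2P sd)/tr.
- apply: (not_D4_left sd tl _ bl).
  exact: (right_gen_of_converse sd (uniserial_gen_of_biserial sdc br)).
move/D4_rightP; apply: (not_D4_left sdc tr _ br).
exact: (right_gen_converse sd (uniserial_gen_of_biserial sd bl)).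
Qed.

Lemma D4_free_biserial : D4_free e -> biserial A.
Proof.
case=> n1 n2 n3 n4; have tl := top2_of_free sd n1.
have tr j : top2 ec Jc j by apply/(cotop2P sd)/(cotop2_of_free sd n2).
have lg := uniserial_gen_of_D4 sd tl (D4_split_of_free sd n3).
have rg := uniserial_gen_of_D4 sdc tr (D4_split_of_free sdc (fun h => n4 (D4_rightP.2 h))).
split.
  apply/(biserial_projectivesP sd) => j; apply: (biserial_atI sd lg _ (tl j)).
  exact: (right_gen_of_converse sd (left_gen_uniserial rg)).
apply/(biserial_projectivesP sdc) => j; apply: (biserial_atI sdc rg _ (tr j)).
exact: (right_gen_converse sd (left_gen_uniserial lg)).
Qed.

End RightModules.

Theorem theorem1p1 (k : closedFieldType) (A : falgType k) (n : nat)
    (e : 'I_n -> A)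
    (he : complete_primitive_orthogonal e) (hb : basic e) :
  biserial A <-> D4_free e.
Proof.
have [J sd] := basic_split_data he hb.
by split; [apply: biserial_D4_free sd|apply: D4_free_biserial sd].
Qed.
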